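(* Let $\mu_1, \mu_2$ be complex Borel measures on $\mathbb{T} = \mathbb{R}/2\pi\mathbb{Z}$, and let $F \colon \mathbb{T}\times\mathbb{T} \to \mathbb{T}\times\mathbb{T}$ be $F(x_1,x_2) := (x_1+x_2, x_1-x_2)$. Then the pushforward measure $F_*(\mu_1\times\mu_2)$ is the product measure of two complex measures on $\mathbb{T}$ if and only if at least one of the following conditions holds: (1) $\mu_1 = 0$. (2) $\mu_2 = 0$. (3) There exist $a_1,a_2\in\mathbb{Z}$ with $a_1+a_2\in 2\mathbb{Z}$, $\nu\in M_-$, and $A_1,A_2\in\mathbb{C}$ such that $\mu_1 = A_1 e^{ia_1x}\,dm_{\mathbb{T}}(x)$ and $\mu_2 = e^{ia_2x}(A_2\,dm_{\mathbb{T}}(x)+\nu)$. (4) There exist $a_1,a_2\in\mathbb{Z}$ with $a_1+a_2\in 2\mathbb{Z}$, $\nu\in M_-$, and $A_1,A_2\in\mathbb{C}$ such that $\mu_1 = e^{ia_1x}(A_1\,dm_{\mathbb{T}}(x)+\nu)$ and $\mu_2 = A_2e^{ia_2x}\,dm_{\mathbb{T}}(x)$. (5) $\mu_1\in M_+$ and $\mu_2\in M_-$. (6) $\mu_1\in M_-$ and $\mu_2\in M_+$. (7) There exist $a_1,a_2,k\in\mathbb{Z}$ with $k \in 1+2\mathbb{Z}$ and $a_1+a_2\in 1+2\mathbb{Z}$, and $A_1,\dots,A_6\in\mathbb{C}$ with $A_1^2A_5A_6 = A_4^2A_2A_3$, such that $$\mu_1 = (A_1e^{ia_1x}+A_2e^{i(a_1-k)x}+A_3e^{i(a_1+k)x})\,dm_{\mathbb{T}}(x),\qquad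 \mu_2 = (A_4e^{ia_2x}+A_5e^{i(a_2-k)x}+A_6e^{i(a_2+k)x})\,dm_{\mathbb{T}}(x).$$ (8) There exist $c_2,c_3',c_4,c_5',c_6\in\mathbb{C}$, $\tau\in\mathbb{H}$, a positive odd integer $k$, and $a_1,a_2\in\mathbb{Z}$ with $a_1+a_2\in2\mathbb{Z}$ such that $$\mu_1 = e^{ia_1x+c_4}\left(\cosh(c_2)\,\vartheta\left(\frac{kx}{2\pi}+c_3',\tau\right)+\sinh(c_2)\,\vartheta\left(\frac{kx}{2\pi}+c_3'+\frac12,\tau\right)\right)dm_{\mathbb{T}}(x),$$ $$\mu_2 = e^{ia_2x+c_6}\left(\cosh(c_2)\,\vartheta\left(\frac{kx}{2\pi}+c_5',\tau\right)-\sinh(c_2)\,\vartheta\left(\frac{kx}{2\pi}+c_5'+\frac12,\tau\right)\right)dm_{\mathbb{T}}(x).$$ (9) There exist $C\in\mathbb{R}$ and a complex Borel measure $\rho$ on $\mathbb{T}$ such that $\hat\rho(u)=e^{iCu^2}$ for all $u\in\mathbb{Z}$, and moreover there exist $c_2,c_4,c_6\in\mathbb{C}$, $\theta_1,\theta_2\in\mathbb{T}$, a positive odd integer $k$, and $a_1,a_2\in\mathbb{Z}$ with $a_1+a_2\in2\mathbb{Z}$ such that $$\mu_1 = e^{ia_1x+c_4}\left(\cosh(c_2)\,\rho(kx+\theta_1)+\sinh(c_2)\,\rho(kx+\theta_1+\pi)\right),$$ $$\mu_2 = e^{ia_2x+c_6}\left(\cosh(c_2)\,\rho(kx+\theta_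2)-\sinh(c_2)\,\rho(kx+\theta_2+\pi)\right).$$
   Context: $\mathbb{T} := \mathbb{R}/2\pi\mathbb{Z}$; $dm_{\mathbb{T}}$ is the normalized (total mass 1) Haar measure on $\mathbb{T}$; $\delta_x$ is the Dirac measure at $x$. $M_+$ (resp. $M_-$) is the set of all complex Borel measures $\mu$ on $\mathbb{T}$ with $\mu*\delta_\pi=\mu$ (resp. $\mu*\delta_\pi=-\mu$). An expression $g(x)\mu$ (with $g$ a function and $\mu$ a measure) denotes the measure with density $g$ with respect to $\mu$. $\mathbb{H} := \{\tau\in\mathbb{C}\mid \operatorname{Im}\tau>0\}$, and $\vartheta\colon\mathbb{C}\times\mathbb{H}\to\mathbb{C}$ is the Jacobi theta function $\vartheta(z,\tau) := \sum_{u=-\infty}^{\infty} e^{\pi iu^2\tau+2\pi iuz}$ (it is 1-periodic in $z$). The Fourier--Stieltjes transform of a complex Borel measure $\rho$ on $\mathbb{T}$ is $\hat\rho(u) = \int_{\mathbb{T}}e^{-iux}\,d\rho(x)$, $u\in\mathbb{Z}$. For a complex Borel measure $\rho$ on $\mathbb{T}$, a positive odd integer $k$ and $\theta\in\mathbb{T}$, the measure $\rho(kx+\theta)$ on $\mathbb{T}$ is defined by $$\int_{\mathbb{T}}\phi(x)\,d\rho(kx+\theta) := \frac1k\int_{\mathbb{T}}\ \sum_{x\in\mathbb{T},\ y=kx+\theta}\phi(x)\ d\rho(y).$$ *)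

(* Defs.v *)
From HB Require Import structures.
From mathcomp Require Import all_boot all_order all_algebra.
From mathcomp Require Import generic_quotient ring_quotient.
From mathcomp Require Import complex.
From mathcomp Require Import all_classical all_reals all_analysis.

Set Implicit Arguments.
Unset Strict Implicit.
Unset Printing Implicit Defensive.

Import Order.TTheory GRing.Theory Num.Theory.
Import numFieldNormedType.Exports.

Local Open Scope classical_set_scope.
Local Open Scope ring_scope.
Local Open Scope quotient_scope.

Definition twopiZ (R : realType) : pred R :=
  fun x => `[< exists n : int, x = (2 * pi) *~ n >].

Lemma twopiZ_zmod_closed (R : realType) : zmod_closed (@twopiZ R).
Proof.
split; first by apply/asboolP; exists 0; rewrite mulr0z.
move=> x y /asboolP[m ->] /asboolP[n ->].
by apply/asboolP; exists (m - n); rewrite mulrzBr.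
Qed.

HB.instance Definition _ (R : realType) :=
  GRing.isZmodClosed.Build R (@twopiZ R) (twopiZ_zmod_closed R).

Section torus.
Variable R : realType.

(* R / 2 pi Z, with the group structure of the quotient; below it gets the
   Borel sigma-algebra of the quotient topology. *)
Definition torus : Type :=
  Quotient.quot (GRing.ZmodClosed.clone R (@twopiZ R) _).

HB.instance Definition _ := GRing.Zmodule.on torus.
HB.instance Definition _ := Quotient.on torus.
HB.instance Definition _ := isPointed.Build torus 0.

Definition torus_open : set (set torus) := @open (quotient_topology torus).

HB.instance Definition _ := Measurable.copy torus
  (g_sigma_algebraType torus_open).

Definition to_torus (x : measurableTypeR R) : torus := \pi_torus x.

Lemma measurable_to_torus : measurable_fun setT to_torus.
Proof.
refine (@measurability _ _ _ _ setT to_torus torus_open erefl _).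
by move=> _ [U oU <-]; rewrite setTI; exact: measurable_realfun.open_measurable.
Qed.

HB.instance Definition _ :=
  isMeasurableFun.Build _ _ (measurableTypeR R) torus to_torus
    measurable_to_torus.

Lemma twopi_gt0 : 0 < 2 * pi :> R.
Proof. by rewrite mulr_gt0// pi_gt0. Qed.

End torus.

Local Open Scope complex_scope.

Section complex_functions.
Variable R : realType.
Implicit Types z tau : R[i].

Definition cexp z : R[i] :=
  (expR (complex.Re z) * cos (complex.Im z)) +i*
  (expR (complex.Re z) * sin (complex.Im z)).

Definition ccosh z : R[i] := (cexp z + cexp (- z)) / 2.

Definition csinh z : R[i] := (cexp z - cexp (- z)) / 2.

Definition clim (u : nat -> R[i]) : R[i] :=
  limn (fun n => complex.Re (u n)) +i* limn (fun n => complex.Im (u n)).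

(* The series converges absolutely when 0 < Im tau, so that summing it over
   [-N, N] with N going to infinity gives its value. *)
Definition theta z tau : R[i] :=
  clim (fun N => \sum_(j < N.*2.+1)
    let u : int := j%:Z - N%:Z in
    cexp (pi%:C * 'i%C * (u ^+ 2)%:~R * tau + 2 * pi%:C * 'i%C * u%:~R * z)).

End complex_functions.

Section complex_measures.
Context d (T : measurableType d) (R : realType).

(* A complex measure is given by its real and imaginary parts, which are finite
   signed measures. *)
Record cmeasure := CMeasure {
  cmre : {charge set T -> \bar R} ;
  cmim : {charge set T -> \bar R} }.

Definition cmeasure_fun (mu : cmeasure) (A : set T) : R[i] :=
  fine (cmre mu A) +i* fine (cmim mu A).

(* Equality of measures: charges of the library are also defined, with
   unspecified values, on nonmeasurable sets. *)
Definition eq_on_measurable (m1 m2 : set T -> R[i]) :=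
  forall A, measurable A -> m1 A = m2 A.

Definition cm_of_measure (m : {finite_measure set T -> \bar R}) : cmeasure :=
  CMeasure (charge_of_finite_measure m) czero.

Definition cmzero : cmeasure := CMeasure czero czero.

Definition cmadd (mu nu : cmeasure) : cmeasure :=
  CMeasure (cadd (cmre mu) (cmre nu)) (cadd (cmim mu) (cmim nu)).

Definition cmscale (a : R[i]) (mu : cmeasure) : cmeasure :=
  CMeasure
    (cadd (cscale (complex.Re a) (cmre mu)) (cscale (- complex.Im a) (cmim mu)))
    (cadd (cscale (complex.Re a) (cmim mu)) (cscale (complex.Im a) (cmre mu))).

Lemma hahn_ex (nu : {charge set T -> \bar R}) :
  exists PN : set T * set T, hahn_decomposition nu PN.1 PN.2.
Proof. by have [P [N PN]] := Hahn_decomposition nu; exists (P, N). Qed.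

(* Integral with respect to a signed measure, through its Jordan decomposition,
   which does not depend on the choice of the Hahn decomposition. *)
Definition charge_integral (nu : {charge set T -> \bar R}) (D : set T)
    (f : T -> R) : R :=
  let nuPN := projT2 (cid (hahn_ex nu)) in
  \int[jordan_pos nuPN]_(x in D) f x - \int[jordan_neg nuPN]_(x in D) f x.

Definition cintegral (mu : cmeasure) (D : set T) (f : T -> R[i]) : R[i] :=
  let re x := complex.Re (f x) in
  let im x := complex.Im (f x) in
  (charge_integral (cmre mu) D re - charge_integral (cmim mu) D im) +i*
  (charge_integral (cmre mu) D im + charge_integral (cmim mu) D re).

Definition with_density (g : T -> R[i]) (mu : cmeasure) : set T -> R[i] :=
  fun A => cintegral mu A g.

Definition bounded_borel (f : T -> R[i]) :=
  [/\ measurable_fun setT (fun x => complex.Re (f x)),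
      measurable_fun setT (fun x => complex.Im (f x)) &
      exists M : R[i], forall x, `|f x| <= M].

End complex_measures.

Coercion cmeasure_fun : cmeasure >-> Funclass.

Notation "m1 =m m2" := (eq_on_measurable m1 m2) (at level 70).

Section complex_product.
Context d1 d2 (T1 : measurableType d1) (T2 : measurableType d2) (R : realType).

(* The iterated integral, as for product_measure1. *)
Definition cproduct (mu : cmeasure T1 R) (nu : cmeasure T2 R) :
    set (T1 * T2) -> R[i] :=
  fun E => cintegral mu setT (fun x => nu (xsection E x)).

Definition cpushforward (f : T1 -> T2) (m : set T1 -> R[i]) :
    set T2 -> R[i] :=
  fun B => m (f @^-1` B).

End complex_product.

Section torus_measures.
Variable R : realType.
Local Notation T := (torus R).
Local Notation M := (cmeasure T R).
Implicit Types (mu nu rho sigma : M) (x theta : T).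

(* The image of the uniform probability on [0, 2 pi]. *)
Definition haar : M :=
  cm_of_measure (@distribution _ _ (measurableTypeR R) T R
    (uniform_prob (@twopi_gt0 R)) (@to_torus R)).

Definition cdirac x : M := cm_of_measure (dirac x).

Definition convolution mu nu : set T -> R[i] :=
  fun A => cproduct mu nu [set p : T * T | A (p.1 + p.2)].

Definition Mplus nu := convolution nu (cdirac (to_torus pi)) =m nu.

Definition Mminus nu :=
  convolution nu (cdirac (to_torus pi)) =m (fun A => - nu A).

(* A representative modulo 2 pi of x. It is only used in expressions that are
   2 pi-periodic in it. *)
Definition angle x : R[i] := (repr x)%:C.

Definition fourier_stieltjes rho (u : int) : R[i] :=
  cintegral rho setT (fun x => cexp (- 'i%C * u%:~R * angle x)).

(* sigma is the measure rho(kx + theta), which is determined by its integrals.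
   For 0 < k, the sum below has k terms. *)
Definition is_dilation rho (k : nat) theta sigma :=
  forall phi : T -> R[i], bounded_borel phi ->
    cintegral sigma setT phi =
    k%:R^-1 * cintegral rho setT
      (fun y => \sum_(x \in [set x | y = x *+ k + theta]) phi x).

Definition sum_diff (p : T * T) : T * T := (p.1 + p.2, p.1 - p.2).

End torus_measures.

(* Main.v *)
Require Import Defs.
From HB Require Import structures.
From mathcomp Require Import all_boot all_order all_algebra.
From mathcomp Require Import complex.
From mathcomp Require Import all_classical all_reals all_analysis.
From mathcomp Require Import finmap measurable_realfun.
From mathcomp Require Import ring lra zify.

Set Implicit Arguments.
Unset Strict Implicit.
Unset Printing Implicit Defensive.

Import Order.TTheory GRing.Theory Num.Theory.
Import numFieldNormedType.Exports.
Import ComplexField.Normc.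

Local Open Scope classical_set_scope.
Local Open Scope ring_scope.
Local Open Scope complex_scope.

(** Characters of the product of two tori are pulled back by F to characters:
    the frequency (u, v) of F_*(mu1 x mu2) is the frequency (u + v, u - v) of
    mu1 x mu2. So if a and b are the Fourier-Stieltjes transforms of mu1 and
    mu2, the pushforward is a product measure exactly when
      a(u + v) b(u - v) = f(u) g(v)
    for some functions f and g on the integers ([pushforward_product_iff]; that
    f and g are then transforms of measures is seen by freezing one variable).
    The theorem is the solution of this equation ([separable]).

    Such a product is a matrix of rank at most one in (u, v). Its nonzero entries
    form a rectangle, which says that two pairs of points of the supports of a and b
    may exchange their coordinates v. Averaging frequencies in this way
    ([rectangular_mid]) forces the supports, as soon as both meet both parity
    classes, into progressions with a common odd step k; there they are either
    the whole progressions or sets of at most three points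
    ([rectangular_step], [rectangular_consecutive]). When some parity class is
    missed the supports degenerate; these are the cases (1) to (6). Three-point
    supports leave one two by two minor, the polynomial relation of (7). On full
    progressions the vanishing minors say that the second logarithmic
    differences of a and b take two values, alternating with the parity and
    exchanged between a and b ([separable_second_difference]). Hence a and b are
      exp (c4 + (-1)^j c2 + w j^2 + l j) and exp (c6 - (-1)^j c2 + w j^2 + l' j)
    along the progressions ([separable_exponential]). As transforms of measures
    are bounded, Re w <= 0. For Re w < 0 these are the coefficients of theta
    functions (8); for Re w = 0 the linear terms are translations and exp (w j^2)
    is the transform of the measure rho of (9), which is a measure because it is
    obtained from mu1 by modulation, translations and a pushforward. In both
    cases (-1)^j is translation by pi, which turns exp ((-1)^j c2) into
    cosh c2 + (-1)^j sinh c2.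

    On the analytic side a complex measure is replaced by its integral, a linear
    functional on bounded Borel functions that is continuous for bounded
    pointwise convergence ([cfunctional]). Every bounded Borel function on the
    torus is obtained from characters by linear combinations and bounded limits
    ([torus_bclosure]), so two measures with the same transform are equal, and
    measurability, Fubini and the identity defining rho(kx + theta) are checked
    on characters. *)

(** * Convergence of complex sequences *)

Section complex_convergence.
Context {R : realType}.
Implicit Types (z w : R[i]) (u v : nat -> R[i]).

Lemma cReD z w : complex.Re (z + w) = complex.Re z + complex.Re w.
Proof. by case: z w => [a b] [c e]. Qed.

Lemma cImD z w : complex.Im (z + w) = complex.Im z + complex.Im w.
Proof. by case: z w => [a b] [c e]. Qed.

Lemma cReM z w : complex.Re (z * w) =
  complex.Re z * complex.Re w - complex.Im z * complex.Im w.
Proof. by case: z w => [a b] [c e]. Qed.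

Lemma cImM z w : complex.Im (z * w) =
  complex.Re z * complex.Im w + complex.Im z * complex.Re w.
Proof. by case: z w => [a b] [c e]. Qed.

Lemma complex_eqP z w :
  complex.Re z = complex.Re w -> complex.Im z = complex.Im w -> z = w.
Proof. by case: z w => [a b] [c e] /= -> ->. Qed.

Lemma normr_Re_le z : `|complex.Re z| <= normc z.
Proof.
by case: z => a b /=; rewrite -(sqrtr_sqr a) ler_wsqrtr// lerDl sqr_ge0.
Qed.

Lemma normr_Im_le z : `|complex.Im z| <= normc z.
Proof.
by case: z => a b /=; rewrite -(sqrtr_sqr b) ler_wsqrtr// lerDr sqr_ge0.
Qed.

Lemma normcE_real (x : R) : normc x%:C = `|x|.
Proof. by rewrite /= expr0n addr0 sqrtr_sqr. Qed.

Lemma normc_ge0 z : 0 <= normc z.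
Proof. by case: z => a b /=; exact: sqrtr_ge0. Qed.

Lemma normc_le_Re_Im z : normc z <= `|complex.Re z| + `|complex.Im z|.
Proof.
case: z => a b /=; rewrite -[leRHS]ger0_norm ?addr_ge0// -sqrtr_sqr.
rewrite ler_wsqrtr// sqrrD !real_normK ?num_real// addrAC lerDl.
by rewrite mulrn_wge0// mulr_ge0.
Qed.

Definition ccvg u z := (fun n => complex.Re (u n)) @ \oo --> complex.Re z /\
  (fun n => complex.Im (u n)) @ \oo --> complex.Im z.

Lemma ccvg_cst z : ccvg (fun=> z) z.
Proof. by split; exact: cvg_cst. Qed.

Lemma ccvgD u v z w : ccvg u z -> ccvg v w -> ccvg (fun n => u n + v n) (z + w).
Proof.
move=> [ru iu] [rv iv]; split.
  by under eq_fun do rewrite cReD; rewrite cReD; exact: cvgD.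
by under eq_fun do rewrite cImD; rewrite cImD; exact: cvgD.
Qed.

Lemma ccvgM u v z w : ccvg u z -> ccvg v w -> ccvg (fun n => u n * v n) (z * w).
Proof.
move=> [ru iu] [rv iv]; split.
  by under eq_fun do rewrite cReM; rewrite cReM; apply: cvgB; exact: cvgM.
by under eq_fun do rewrite cImM; rewrite cImM; apply: cvgD; exact: cvgM.
Qed.

Lemma ccvg_unique u z w : ccvg u z -> ccvg u w -> z = w.
Proof.
by move=> [ru iu] [ru' iu']; apply: complex_eqP; [exact: (cvg_unique _ ru ru')
  | exact: (cvg_unique _ iu iu')].
Qed.

Lemma ccvg_shift u z k : ccvg (fun n => u (n + k)%N) z -> ccvg u z.
Proof.
move=> [ru iu]; split.
  by rewrite -(cvg_shiftn k).
by rewrite -(cvg_shiftn k).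
Qed.

Lemma ccvg_real (x : nat -> R) (l : R) : x @ \oo --> l ->
  ccvg (fun n => (x n)%:C) l%:C.
Proof. by move=> xl; split => //; exact: cvg_cst. Qed.

(** The factor two is the price of passing to the limit in the real and the
    imaginary part separately. *)
Lemma normc_lim u z M : (forall n, normc (u n) <= M) -> ccvg u z ->
  normc z <= M + M.
Proof.
move=> uM [ru iu]; apply: le_trans (normc_le_Re_Im z) _.
apply: lerD; [move/(cvg_norm (V := R)): ru | move/(cvg_norm (V := R)): iu];
  move/cvgr_to_le; apply; apply: nearW => n; apply: le_trans (uM n).
  exact: normr_Re_le.
exact: normr_Im_le.
Qed.

Lemma normcD z w : normc (z + w) <= normc z + normc w.
Proof. exact: le_normcD. Qed.

End complex_convergence.

(** * Bounded measurable functions and bounded pointwise limits *)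

Definition bfun d (T : measurableType d) (R : realType) (f : T -> R[i]) :=
  [/\ measurable_fun setT (fun x => complex.Re (f x)),
      measurable_fun setT (fun x => complex.Im (f x)) &
      exists M : R, forall x, normc (f x) <= M].

(** Identities between functionals, and measurability statements, that are
    stable under linear combinations and bounded pointwise limits pass from G
    to this closure by induction. *)
Inductive bclosure (T : Type) (R : realType) (G : (T -> R[i]) -> Prop) :
    (T -> R[i]) -> Prop :=
  | bclosure_gen f of G f : bclosure G f
  | bclosure_add f g of bclosure G f & bclosure G g :
      bclosure G (fun x => f x + g x)
  | bclosure_scale c f of bclosure G f : bclosure G (fun x => c * f x)
  | bclosure_lim (fs : nat -> T -> R[i]) f M of
      (forall n, bclosure G (fs n)) & (forall n x, normc (fs n x) <= M) &
      (forall x, ccvg (fs ^~ x) (f x)) : bclosure G f.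

Definition cind (T : Type) (R : realType) (A : set T) (x : T) : R[i] :=
  (\1_A x)%:C.

Section bfun_theory.
Context d (T : measurableType d) (R : realType).
Implicit Types f g : T -> R[i].

Lemma bfunD f g : bfun f -> bfun g -> bfun (fun x => f x + g x).
Proof.
move=> [rf jf [M fM]] [rg jg [N gN]]; split.
- by under eq_fun do rewrite cReD; exact: measurable_funD.
- by under eq_fun do rewrite cImD; exact: measurable_funD.
- by exists (M + N) => x; apply: le_trans (normcD _ _) _; exact: lerD.
Qed.

Lemma bfunM f g : bfun f -> bfun g -> bfun (fun x => f x * g x).
Proof.
move=> [rf jf [M fM]] [rg jg [N gN]]; split.
- under eq_fun do rewrite cReM.
  by apply: measurable_funB; exact: measurable_funM.
- under eq_fun do rewrite cImM.
  by apply: measurable_funD; exact: measurable_funM.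
- exists (M * N) => x; rewrite normcM.
  by apply: ler_pM => //; exact: normc_ge0.
Qed.

Lemma bfun_cst (c : R[i]) : bfun (fun _ : T => c).
Proof. by split => //; exists (normc c). Qed.

Lemma bfunZ c f : bfun f -> bfun (fun x => c * f x).
Proof. by move=> bf; apply: bfunM => //; exact: bfun_cst. Qed.

Lemma bfun_lim (fs : nat -> T -> R[i]) f M :
  (forall n, bfun (fs n)) -> (forall n x, normc (fs n x) <= M) ->
  (forall x, ccvg (fs ^~ x) (f x)) -> bfun f.
Proof.
move=> bfs fsM fsf; split.
- apply: (measurable_fun_cvg (h := fun n x => complex.Re (fs n x))).
    by move=> n; case: (bfs n).
  by move=> x _; case: (fsf x).
- apply: (measurable_fun_cvg (h := fun n x => complex.Im (fs n x))).
    by move=> n; case: (bfs n).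
  by move=> x _; case: (fsf x).
- exists (M + M) => x; apply: normc_lim (fsf x) => n; exact: fsM.
Qed.

Lemma bclosure_bfun (G : (T -> R[i]) -> Prop) f :
  (forall g, G g -> bfun g) -> bclosure G f -> bfun f.
Proof.
move=> Gb; elim=> {f} [f /Gb //|f g _ + _|c f _|fs f M _ bfs fsM fsf].
- exact: bfunD.
- exact: bfunZ.
- exact: bfun_lim bfs fsM fsf.
Qed.

Lemma cind_bfun (A : set T) : measurable A -> bfun (cind R A).
Proof.
move=> mA; split; [exact: measurable_indic|exact: measurable_cst|].
by exists 1 => x; rewrite /cind normcE_real ger0_norm ?indicE// lern1 leq_b1.
Qed.

Lemma bfun_cind_measurable (A : set T) : bfun (cind R A) -> measurable A.
Proof.
move=> [/(_ measurableT [set 1] (measurable_set1 _)) + _ _].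
rewrite setTI /preimage/=; congr measurable; apply/seteqP; split => x /=.
  rewrite indicE; have [/set_mem//|_ /eqP] := boolP (x \in A).
  by rewrite eq_sym oner_eq0.
by move=> Ax; rewrite indicE mem_set.
Qed.

End bfun_theory.

Section bclosure_theory.
Context (T : Type) (R : realType) (G : (T -> R[i]) -> Prop).
Implicit Types f g : T -> R[i].

Lemma bclosure_ext f g : f =1 g -> bclosure G f -> bclosure G g.
Proof. by move=> /funext ->. Qed.

Lemma bclosure_sum n (fs : 'I_n -> T -> R[i]) : bclosure G (fun=> 0) ->
  (forall i, bclosure G (fs i)) -> bclosure G (fun x => \sum_(i < n) fs i x).
Proof.
move=> G0; elim: n fs => [|n IHn] fs Gfs.
  by apply: bclosure_ext G0 => x; rewrite big_ord0.
apply: (@bclosure_ext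
    (fun x => fs ord0 x + \sum_(i < n) fs (lift ord0 i) x)).
  by move=> x; rewrite big_ord_recl.
by apply: bclosure_add => //; exact: IHn.
Qed.

Lemma bclosure_bounded f : (forall g, G g -> exists M : R, forall x,
  normc (g x) <= M) -> bclosure G f -> exists M : R, forall x, normc (f x) <= M.
Proof.
move=> Gb; elim=> {f} [f /Gb //|f g _ [M fM] _ [N gN]|c f _ [M fM]|
  fs f M _ bfs fsM fsf].
- by exists (M + N) => x; apply: le_trans (normcD _ _) _; exact: lerD.
- by exists (normc c * M) => x; rewrite normcM ler_wpM2l ?normc_ge0.
- by exists (M + M) => x; apply: normc_lim (fsf x) => n; exact: fsM.
Qed.

End bclosure_theory.

Lemma bclosure_sub (T : Type) (R : realType) (G H : (T -> R[i]) -> Prop) f :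
  (forall g, G g -> bclosure H g) -> bclosure G f -> bclosure H f.
Proof.
move=> GH; elim=> {f} [f /GH //|f g _ + _|c f _|fs f M _ bfs fsM fsf].
- exact: bclosure_add.
- exact: bclosure_scale.
- exact: bclosure_lim bfs fsM fsf.
Qed.

Lemma bclosure_comp (S T : Type) (R : realType) (G : (T -> R[i]) -> Prop)
    (H : (S -> R[i]) -> Prop) (h : S -> T) f :
  (forall g, G g -> H (g \o h)) -> bclosure G f -> bclosure H (f \o h).
Proof.
move=> GH; elim=> {f} [f /GH Hf|f g _ + _|c f _|fs f M _ bfs fsM fsf].
- exact: bclosure_gen.
- exact: bclosure_add.
- exact: bclosure_scale.
- apply: (bclosure_lim (fs := fun n => fs n \o h) (M := M)) => //.
  + by move=> n x; exact: fsM.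
  + by move=> x; exact: fsf.
Qed.

Section bclosure_simple.
Import HBSimple HBNNSimple.
Context d (T : measurableType d) (R : realType).
Variable G : (T -> R[i]) -> Prop.
Hypothesis Gind : forall A, measurable A -> bclosure G (cind R A).

Let G0 : bclosure G (fun=> 0).
Proof.
apply: bclosure_ext (bclosure_scale 0 (Gind measurable0)) => x.
by rewrite mul0r.
Qed.

Let ge0_bclosure (f : T -> R) (M : R) : measurable_fun setT f ->
  (forall x, 0 <= f x <= M) -> bclosure G (fun x => (f x)%:C).
Proof.
move=> mf fM; have mEf : measurable_fun setT (EFin \o f).
  exact/measurable_EFinP.
pose g := nnsfun_approx measurableT mEf.
have f0 x : setT x -> (0 <= (EFin \o f) x)%E.
  by move=> _; rewrite lee_fin; case/andP: (fM x).
refine (@bclosure_lim _ _ _ (fun n (x : T) => (g n x)%:C) _ M _ _ _).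
- move=> n; apply: (@bclosure_ext _ _ _ (fun x =>
    \sum_(i < #|` fset_set (g n @` setT)|) ((fset_set (g n @` setT))`_i)%:C *
      cind R (g n @^-1` [set (fset_set (g n @` setT))`_i]) x)).
    move=> x; rewrite [in RHS]fimfunEord rmorph_sum/=; apply: eq_bigr => i _.
    by rewrite rmorphM.
  apply: bclosure_sum => // i; apply: bclosure_scale; apply: Gind.
  exact: measurable_sfunP.
- move=> n x; rewrite /cind normcE_real ger0_norm//.
  case/andP: (fM x) => _; apply: le_trans.
  by rewrite -lee_fin /g nnsfun_approxE; exact: le_approx.
- move=> x; apply: ccvg_real; have := cvg_nnsfun_approx measurableT mEf f0.
  move=> /(_ x Logic.I) /fine_cvgP[_]; exact.
Qed.

Let real_bclosure (f : T -> R) (M : R) : measurable_fun setT f ->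
  (forall x, `|f x| <= M) -> bclosure G (fun x => (f x)%:C).
Proof.
move=> mf fM; pose g x := f x + M.
have gG : bclosure G (fun x => (g x)%:C).
  apply: (ge0_bclosure (M := M + M)); first exact: measurable_funD.
  by move=> x; have := fM x; rewrite /g ler_norml => /andP[]; lra.
have mG : bclosure G (fun x => (- M)%:C * cind R setT x).
  by apply: bclosure_scale; exact: Gind.
apply: bclosure_ext (bclosure_add gG mG) => x.
by rewrite /cind indicT mulr1 -rmorphD/= /g; congr (_%:C); ring.
Qed.

(** The real and imaginary parts, made nonnegative by adding a constant, are
    increasing limits of simple functions. *)
Lemma bfun_bclosure f : bfun f -> bclosure G f.
Proof.
move=> [rf jf [M fM]].
have rG : bclosure G (fun x => (complex.Re (f x))%:C).
  by apply: (real_bclosure (M := M)) => // x; apply: le_trans (fM x);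
    exact: normr_Re_le.
have iG : bclosure G (fun x => (complex.Im (f x))%:C).
  by apply: (real_bclosure (M := M)) => // x; apply: le_trans (fM x);
    exact: normr_Im_le.
apply: bclosure_ext (bclosure_add rG (bclosure_scale 'i%C iG)) => x.
by rewrite -complexE.
Qed.

End bclosure_simple.

(** * The functional monotone class theorem *)

Section bclosure_algebra.
Context (T : Type) (R : realType) (G : (T -> R[i]) -> Prop).
Hypothesis G1 : G (fun=> 1).
Hypothesis GM : forall f g, G f -> G g -> G (fun x => f x * g x).
Hypothesis Gb : forall g, G g -> exists M : R, forall x, normc (g x) <= M.
Implicit Types (f g : T -> R[i]) (p q : T -> R).

Lemma bclosureM f g : bclosure G f -> bclosure G g ->
  bclosure G (fun x => f x * g x).
Proof.
have lim h fs f' M : bclosure G h ->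
    (forall n, bclosure G (fun x => fs n x * h x)) ->
    (forall n x, normc (fs n x) <= M) -> (forall x, ccvg (fs ^~ x) (f' x)) ->
    bclosure G (fun x => f' x * h x).
  move=> Gh Gfs fsM fsf; have [N hN] := bclosure_bounded Gb Gh.
  apply: (bclosure_lim (fs := fun n x => fs n x * h x) (M := M * N)) => //.
    by move=> n x; rewrite normcM; apply: ler_pM => //; exact: normc_ge0.
  by move=> x; apply: ccvgM => //; exact: ccvg_cst.
have step h : G h -> forall f', bclosure G f' ->
    bclosure G (fun x => f' x * h x).
  move=> Gh f'; elim=> {f'} [f' Gf|f1 f2 _ G1' _ G2'|c f1 _ G1'|
    fs f1 M _ bfs fsM fsf].
  - by apply: bclosure_gen; exact: GM.
  - by apply: bclosure_ext (bclosure_add G1' G2') => x; rewrite mulrDl.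
  - by apply: bclosure_ext (bclosure_scale c G1') => x; rewrite mulrA.
  - by apply: lim bfs fsM fsf; exact: bclosure_gen.
move=> Gf; elim: {f} Gf g => [f Gf|f1 f2 _ G1' _ G2'|c f1 _ G1'|
    fs f1 M _ bfs fsM fsf] g Gg.
- by apply: bclosure_ext (step _ Gf _ Gg) => x; rewrite mulrC.
- by apply: bclosure_ext (bclosure_add (G1' _ Gg) (G2' _ Gg)) => x;
    rewrite mulrDl.
- by apply: bclosure_ext (bclosure_scale c (G1' _ Gg)) => x; rewrite mulrA.
- by apply: lim fsM fsf => // n; exact: bfs.
Qed.

Lemma bclosure_cst c : bclosure G (fun=> c).
Proof.
apply: bclosure_ext (bclosure_scale c (bclosure_gen G1)) => x.
by rewrite mulr1.
Qed.

Let rG p := bclosure G (fun x => (p x)%:C).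

Let rG_ext p q : p =1 q -> rG p -> rG q.
Proof. by move=> /funext ->. Qed.

Let rGD p q : rG p -> rG q -> rG (fun x => p x + q x).
Proof.
by move=> Gp Gq; apply: bclosure_ext (bclosure_add Gp Gq) => x; rewrite rmorphD.
Qed.

Let rGM p q : rG p -> rG q -> rG (fun x => p x * q x).
Proof.
by move=> Gp Gq; apply: bclosure_ext (bclosureM Gp Gq) => x; rewrite rmorphM.
Qed.

Let rGc (a : R) : rG (fun=> a). Proof. exact: bclosure_cst. Qed.

Let sgn_step (t : R) := (3 * t - t ^+ 3) / 2.

Let sgn_step_ler1 (t : R) : `|t| <= 1 -> `|sgn_step t| <= 1.
Proof.
rewrite !ler_norml /sgn_step => /andP[t1 t2]; apply/andP; split; last first.
  have : 0 <= (1 - t) ^+ 2 * (2 + t) by rewrite mulr_ge0 ?sqr_ge0//; lra.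
  by rewrite (_ : _ * _ = 2 - (3 * t - t ^+ 3)); [lra|ring].
have : 0 <= (1 + t) ^+ 2 * (2 - t) by rewrite mulr_ge0 ?sqr_ge0//; lra.
by rewrite (_ : _ * _ = 2 + (3 * t - t ^+ 3)); [lra|ring].
Qed.

Let sgn_iter n (t : R) := iter n sgn_step t.

Let sgn_iter_ler1 n (t : R) : `|t| <= 1 -> `|sgn_iter n t| <= 1.
Proof. by move=> t1; elim: n => //= n; exact: sgn_step_ler1. Qed.

Let sgn_iterN n (t : R) : sgn_iter n (- t) = - sgn_iter n t.
Proof.
by elim: n => //= n; rewrite /sgn_iter/= => ->; rewrite /sgn_step; field.
Qed.

Let sgn_iter0 n : sgn_iter n 0 = 0 :> R.
Proof.
by elim: n => //= n; rewrite /sgn_iter /= => ->; rewrite /sgn_step; field.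
Qed.

Let sgn_iter_cvg (t : R) : `|t| <= 1 -> (sgn_iter ^~ t) @ \oo --> Num.sg t.
Proof.
have pos (s : R) : 0 < s -> s <= 1 -> (sgn_iter ^~ s) @ \oo --> (1 : R).
  move=> s0 s1; have ind n : s <= sgn_iter n s <= 1 /\
      1 - sgn_iter n s <= (1 - s / 2) ^+ n.
    elim: n => [|n [/andP[h1 h2] h3]]; first by rewrite /= expr0; split; lra.
    rewrite /sgn_iter iterS -/(sgn_iter n s); set r := sgn_iter n s in h1 h2 h3 *.
    have rE : 1 - sgn_step r = (1 - r) * (1 - r * (1 + r) / 2).
      by rewrite /sgn_step; field.
    have r0 : 0 < r by lra.
    have h4 : 0 <= (1 - r) * (r * (1 + r) / 2).
      by rewrite mulr_ge0//; [lra | rewrite divr_ge0// mulr_ge0//; lra].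
    have h5 : 0 <= (1 - r) * (1 - r * (1 + r) / 2).
      rewrite mulr_ge0//; first lra.
      have : r * (1 + r) <= 1 * (1 + 1) by apply: ler_pM; lra.
      lra.
    split; first by apply/andP; split; lra.
    rewrite rE exprS mulrC; apply: ler_pM => //; [|lra|].
      have : r * (1 + r) <= 1 * (1 + 1) by apply: ler_pM; lra.
      lra.
    have : s * 1 <= r * (1 + r) by apply: ler_pM; lra.
    lra.
  have cv : (fun n => 1 - (1 - s / 2) ^+ n) @ \oo --> (1 : R).
    rewrite -[X in _ --> X]subr0; apply: cvgB; first exact: cvg_cst.
    by apply: cvg_expr; rewrite ger0_norm; lra.
  apply: (squeeze_cvgr _ cv (cvg_cst (1:R))); apply: nearW => n.
  by have [/andP[_ ?] ?] := ind n; apply/andP; split; lra.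
have [t0|t0|->] := ltgtP t 0; last first.
- by rewrite sgr0; under eq_fun do rewrite sgn_iter0; move=> _; exact: cvg_cst.
- by rewrite gtr0_sg// ler_norml => /andP[_ t1]; exact: pos.
- rewrite ltr0_sg// ler_norml => /andP[t1 _].
  rewrite -(opprK t); under eq_fun do rewrite sgn_iterN.
  by apply: cvgN; apply: pos; lra.
Qed.

(** The iterates of (3t - t^3)/2 are odd polynomials mapping [-1, 1] to itself
    and converging to the sign of t; so the indicator of p > 0 is a bounded
    limit of polynomials in p. *)
Lemma bclosure_pos p : bclosure G (fun x => (p x)%:C) ->
  bclosure G (cind R [set x | 0 < p x]).
Proof.
move=> Gp; have [M pM] := bclosure_bounded Gb Gp.
have {}pM x : `|p x| <= M by rewrite -normcE_real.
pose q x := (`|M| + 1)^-1 * p x.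
have M0 : 0 < `|M| + 1 by rewrite ltr_pwDr.
have q1 x : `|q x| <= 1.
  rewrite normrM gtr0_norm ?invr_gt0// mulrC ler_pdivrMr// mul1r.
  by apply: le_trans (pM x) _; have := ler_norm M; lra.
have Gq : rG q by apply: rGM => //; exact: rGc.
have Giter n : rG (fun x => sgn_iter n (q x)).
  elim: n => //= n IHn; apply: (@rG_ext (fun x =>
      3 / 2 * sgn_iter n (q x) + - (1 / 2) *
        (sgn_iter n (q x) * (sgn_iter n (q x) * sgn_iter n (q x))))).
    by move=> x; rewrite /sgn_iter/= /sgn_step; field.
  apply: rGD; first by apply: rGM => //; exact: rGc.
  by apply: rGM; [exact: rGc|apply: rGM => //; exact: rGM].
have Gsg : rG (fun x => Num.sg (q x)).
  apply: (bclosure_lim (M := 1) Giter).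
    by move=> n x; rewrite /cind normcE_real; exact: sgn_iter_ler1.
  by move=> x; apply: ccvg_real; exact: sgn_iter_cvg.
apply: (@rG_ext (fun x => 1 / 2 * (Num.sg (q x) * (Num.sg (q x) + 1)))).
  move=> x; rewrite /q sgrM gtr0_sg ?invr_gt0// mul1r indicE.
  have [px|px] := boolP (0 < p x).
    by rewrite mem_set// gtr0_sg//=; field.
  rewrite memNset/=; last exact/negP.
  by move: px; rewrite -leNgt le_eqVlt => /orP[/eqP->|/ltr0_sg->];
    rewrite ?sgr0; field.
apply: rGM; first exact: rGc.
by apply: rGM => //; apply: rGD => //; exact: rGc.
Qed.

Lemma bclosure_setI A B : bclosure G (cind R A) -> bclosure G (cind R B) ->
  bclosure G (cind R (A `&` B)).
Proof.
move=> GA GB; apply: bclosure_ext (bclosureM GA GB) => x.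
by rewrite /cind -rmorphM indicI.
Qed.

Lemma bclosure_sigma_algebra :
  sigma_algebra setT [set A : set T | bclosure G (cind R A)].
Proof.
have setC A : bclosure G (cind R A) -> bclosure G (cind R (~` A)).
  move=> GA; apply: bclosure_ext
      (bclosure_add (bclosure_cst 1) (bclosure_scale (-1) GA)) => x.
  rewrite /cind !indicE in_setC.
  by case: (x \in A); rewrite /= ?mulr1 ?subrr ?mulr0 ?addr0.
split => /=.
- by apply: bclosure_ext (bclosure_cst 0) => x; rewrite /cind indic0.
- by move=> A GA; rewrite setTD; exact: setC.
- move=> F GF; rewrite -[\bigcup_k F k]setCK; apply: (setC); rewrite setC_bigcup.
  apply: (bclosure_lim (fs := fun n => cind R (\bigcap_(k < n) ~` F k)) (M := 1)).
  + elim=> [|n IHn].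
      apply: bclosure_ext (bclosure_cst 1) => x.
      by rewrite /cind indicE mem_set.
    rewrite (_ : \bigcap_(k < n.+1) _ =
        (\bigcap_(k < n) ~` F k) `&` ~` F n).
      by apply: bclosure_setI => //; exact: setC.
    apply/seteqP; split => x.
      move=> h; split; first by move=> k /= kn; apply: h => /=; exact: ltnW.
      by apply: h => /=.
    move=> [h1 h2] k /=; rewrite ltnS leq_eqVlt => /orP[/eqP->//|].
    exact: h1.
  + by move=> n x; rewrite /cind normcE_real ger0_norm ?indicE// lern1 leq_b1.
  + move=> x; apply: ccvg_real.
    have [Fx|] := pselect ((\bigcap_k ~` F k) x).
      rewrite [X in _ --> X]indicE mem_set//=; apply: cvg_near_cst.
      by apply: nearW => n; rewrite indicE mem_set// => k _; exact: Fx.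
    rewrite -[X in ~ X]/(_ x) => nF; rewrite [X in _ --> X]indicE memNset//.
    have [k Fk] : exists k, F k x.
      apply: contrapT => /forallNP h; apply: nF => k _; exact: h.
    apply: cvg_near_cst; near=> n; rewrite indicE memNset// => /(_ k); apply => //=.
    by near: n; exact: nbhs_infty_gt.
Unshelve. all: by end_near. Qed.

End bclosure_algebra.

(** * Functionals continuous for bounded pointwise convergence *)

(** The Daniell-style form of a complex measure. Iterated integrals, densities
    and pushforwards stay in this form by mere substitution, whereas for set
    functions each of them would require its own theory. *)
Record cfunctional d (T : measurableType d) (R : realType)
    (I : (T -> R[i]) -> R[i]) : Prop := {
  cfunctionalD : forall f g, bfun f -> bfun g ->
    I (fun x => f x + g x) = I f + I g ;
  cfunctionalZ : forall c f, bfun f -> I (fun x => c * f x) = c * I f ;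
  cfunctional_lim : forall (fs : nat -> T -> R[i]) f M,
    (forall n, bfun (fs n)) -> (forall n x, normc (fs n x) <= M) ->
    (forall x, ccvg (fs ^~ x) (f x)) -> ccvg (fun n => I (fs n)) (I f) }.

Section cfunctional_theory.
Context d (T : measurableType d) (R : realType).
Implicit Types (I J : (T -> R[i]) -> R[i]) (f g : T -> R[i]).

Lemma cfunctional0 I : cfunctional I -> I (fun=> 0) = 0.
Proof.
move=> cI; have := cfunctionalZ cI 0 (bfun_cst T (0 : R[i])).
by rewrite !mul0r.
Qed.

Lemma cfunctional_sum I n (fs : 'I_n -> T -> R[i]) : cfunctional I ->
  (forall i, bfun (fs i)) ->
  bfun (fun x => \sum_(i < n) fs i x) /\
  I (fun x => \sum_(i < n) fs i x) = \sum_(i < n) I (fs i).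
Proof.
move=> cI; elim: n fs => [|n IHn] fs bfs.
  rewrite big_ord0 (_ : (fun x => _) = fun=> 0); last first.
    by apply/funext => x; rewrite big_ord0.
  by split; [exact: bfun_cst|exact: cfunctional0].
have [bf If] := IHn (fun i => fs (lift ord0 i)) (fun i => bfs _).
rewrite big_ord_recl -If -cfunctionalD//.
rewrite (_ : (fun x => \sum_(i < n.+1) fs i x) =
  fun x => fs ord0 x + \sum_(i < n) fs (lift ord0 i) x); last first.
  by apply/funext => x; rewrite big_ord_recl.
by split => //; exact: bfunD.
Qed.

Lemma cfunctional_eq_bclosure I J (G : (T -> R[i]) -> Prop) :
  cfunctional I -> cfunctional J ->
  (forall g, G g -> bfun g /\ I g = J g) ->
  forall f, bclosure G f -> I f = J f.
Proof.
move=> cI cJ GIJ f Gf; suff [] : bfun f /\ I f = J f by [].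
elim: {f} Gf => [f /GIJ //|f g _ [bf If] _ [bg Ig]|c f _ [bf If]|
  fs f M _ bfs fsM fsf].
- by rewrite !cfunctionalD// If Ig; split => //; exact: bfunD.
- by rewrite !cfunctionalZ// If; split => //; exact: bfunZ.
- have bfs' n : bfun (fs n) by have [] := bfs n.
  split; first exact: bfun_lim bfs' fsM fsf.
  apply: (ccvg_unique (cfunctional_lim cI bfs' fsM fsf)).
  rewrite (_ : (fun n => I (fs n)) = fun n => J (fs n)).
    exact: (cfunctional_lim cJ bfs' fsM fsf).
  by apply/funext => n; have [] := bfs n.
Qed.

Lemma cfunctional_eq_ind I J : cfunctional I -> cfunctional J ->
  (forall A, measurable A -> I (cind R A) = J (cind R A)) ->
  forall f, bfun f -> I f = J f.
Proof.
move=> cI cJ IJ f bf.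
apply: (cfunctional_eq_bclosure
    (G := fun g => exists2 A, measurable A & g = cind R A) cI cJ).
  by move=> _ [A mA ->]; split; [exact: cind_bfun|exact: IJ].
by apply: bfun_bclosure => // A mA; apply: bclosure_gen; exists A.
Qed.

(** Otherwise some f_n with |f_n| <= 1 have |I f_n| > n, and f_n / n, which
    tends to 0 uniformly, contradicts continuity. *)
Lemma cfunctional_bounded I : cfunctional I -> exists C : R,
  forall f, bfun f -> (forall x, normc (f x) <= 1) -> normc (I f) <= C.
Proof.
move=> cI; apply: contrapT => /forallNP nC.
have {nC} H n : exists f, [/\ bfun f, forall x, normc (f x) <= 1 &
    2 * n.+1%:R < normc (I f)].
  have /existsNP[f /not_implyP[bf /not_implyP[f1 /negP]]] := nC (2 * n.+1%:R).
  by rewrite -ltNge => Cf; exists f.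
have [f Hf] := choice H.
pose g n x := (n.+1%:R^-1)%:C * f n x.
have g_le n x : normc (g n x) <= n.+1%:R^-1.
  rewrite normcM normcE_real ger0_norm ?invr_ge0//.
  by rewrite ler_piMr ?invr_ge0//; case: (Hf n).
have gcvg x : ccvg (g ^~ x) 0.
  have sq (h : R[i] -> R) : (forall z, `|h z| <= normc z) ->
      (fun n => h (g n x)) @ \oo --> (0 : R).
    move=> hle; apply: norm_cvg0.
    apply: (squeeze_cvgr _ (cvg_cst (0:R)) (@cvg_harmonic R)).
    by apply: nearW => n; rewrite normr_ge0 /= (le_trans (hle _)).
  by split; [exact: (sq _ normr_Re_le)|exact: (sq _ normr_Im_le)].
have bg n : bfun (g n) by apply: bfunZ; case: (Hf n).
have [|rI iI] := cfunctional_lim (f := fun=> 0) (M := 1) cI bg _ gcvg.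
  move=> n x; apply: (le_trans (g_le n x)).
  by rewrite invf_le1// ler1n.
rewrite (cfunctional0 cI) /= in rI iI.
have [N [hr hi]] : exists N, `|complex.Re (I (g N))| < 1 /\
    `|complex.Im (I (g N))| < 1.
  have [N _ hN] : \forall n \near \oo, `|complex.Re (I (g n))| < 1 /\
      `|complex.Im (I (g n))| < 1.
    have h1 : \forall n \near \oo, `|complex.Re (I (g n))| < 1.
      exact: (cvgr0Pnorm_lt _).1 rI 1 ltr01.
    have h2 : \forall n \near \oo, `|complex.Im (I (g n))| < 1.
      exact: (cvgr0Pnorm_lt _).1 iI 1 ltr01.
    by near=> n; split; near: n.
  by exists N; exact: (hN N (leqnn N)).
have [bf _ If] := Hf N.
have : normc (I (g N)) < 2.
  by apply: le_lt_trans (normc_le_Re_Im _) _; lra.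
rewrite /g cfunctionalZ// normcM normcE_real ger0_norm ?invr_ge0//.
by rewrite mulrC ltr_pdivrMr// => /lt_trans/(_ If); rewrite ltxx.
Unshelve. all: by end_near. Qed.

Lemma cfunctional_le I C g M : cfunctional I ->
  (forall f, bfun f -> (forall x, normc (f x) <= 1) -> normc (I f) <= C) ->
  0 < M -> bfun g -> (forall y, normc (g y) <= M) -> normc (I g) <= C * M.
Proof.
move=> cI IC M0 bg gM; have := IC (fun y => (M^-1)%:C * g y) (bfunZ _ bg).
rewrite (cfunctionalZ cI)// normcM normcE_real gtr0_norm ?invr_gt0//.
rewrite [_ * normc _]mulrC ler_pdivrMr//; apply => y.
rewrite normcM normcE_real gtr0_norm ?invr_gt0//.
by rewrite mulrC ler_pdivrMr// mul1r.
Qed.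

Lemma cfunctional_density I g : cfunctional I -> bfun g ->
  cfunctional (fun f => I (fun x => g x * f x)).
Proof.
move=> cI bg; split => [f1 f2 b1 b2|c f bf|fs f M bfs fsM fsf].
- rewrite -cfunctionalD; [|exact: cI|exact: bfunM|exact: bfunM].
  by congr I; apply/funext => x; rewrite mulrDr.
- rewrite -cfunctionalZ; [|exact: cI|exact: bfunM].
  by congr I; apply/funext => x; rewrite mulrCA.
- have [_ _ [N gN]] := bg.
  apply: (cfunctional_lim (fs := fun n x => g x * fs n x)
    (f := fun x => g x * f x) (M := N * M) cI).
  + by move=> n; exact: bfunM.
  + by move=> n x; rewrite normcM; apply: ler_pM => //; exact: normc_ge0.
  + by move=> x; apply: ccvgM => //; exact: ccvg_cst.
Qed.

Lemma cfunctional_add I J : cfunctional I -> cfunctional J ->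
  cfunctional (fun f => I f + J f).
Proof.
move=> cI cJ; split => [f g bf bg|c f bf|fs f M bfs fsM fsf].
- by rewrite !cfunctionalD// addrACA.
- by rewrite !cfunctionalZ// mulrDr.
- by apply: ccvgD; [exact: (cfunctional_lim cI bfs fsM fsf)|
    exact: (cfunctional_lim cJ bfs fsM fsf)].
Qed.

Lemma cfunctional_scale I c : cfunctional I -> cfunctional (fun f => c * I f).
Proof.
move=> cI; split => [f g bf bg|k f bf|fs f M bfs fsM fsf].
- by rewrite cfunctionalD// mulrDr.
- by rewrite cfunctionalZ// mulrCA.
- by apply: ccvgM; [exact: ccvg_cst|exact: (cfunctional_lim cI bfs fsM fsf)].
Qed.

Lemma cfunctional_eval (x : T) : cfunctional (fun f => f x).
Proof. by split => // fs f M bfs fsM; exact. Qed.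

End cfunctional_theory.

Lemma cfunctional_comp d d' (S : measurableType d) (T : measurableType d')
    (R : realType) (h : S -> T) (I : (S -> R[i]) -> R[i]) :
  (forall f : T -> R[i], bfun f -> bfun (f \o h)) -> cfunctional I ->
  cfunctional (fun f : T -> R[i] => I (f \o h)).
Proof.
move=> bh cI; split => [f g bf bg|c f bf|fs f M bfs fsM fsf].
- by rewrite -(cfunctionalD cI) //; exact: bh.
- by rewrite -(cfunctionalZ cI)//; exact: bh.
- apply: (cfunctional_lim (fs := fun n => fs n \o h) (M := M) cI).
  + by move=> n; exact: bh.
  + by move=> n x; exact: fsM.
  + by move=> x; exact: fsf.
Qed.

(** * Iterated functionals *)

Section iterated_functional.
Context d1 d2 (X : measurableType d1) (Y : measurableType d2) (R : realType).

Let rect (f : X * Y -> R[i]) := exists A B, [/\ measurable A, measurable B &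
  f = cind R (A `*` B)].

Lemma prod_bclosure (f : X * Y -> R[i]) : bfun f -> bclosure (fun f =>
  exists A B, [/\ measurable A, measurable B & f = cind R (A `*` B)]) f.
Proof.
apply: bfun_bclosure => E.
rewrite measurable_prod_measurableType.
have rect1 : rect (fun=> 1).
  exists setT, setT; split => //; apply/funext => x.
  by rewrite setXTT /cind indicE mem_set.
have rectM f1 f2 : rect f1 -> rect f2 -> rect (fun x => f1 x * f2 x).
  move=> [A1 [B1 [mA1 mB1 ->]]] [A2 [B2 [mA2 mB2 ->]]].
  exists (A1 `&` A2), (B1 `&` B2).
  split; [exact: measurableI|exact: measurableI|].
  by apply/funext => x; rewrite setXI /cind indicI rmorphM.
have rectb f1 : rect f1 -> exists M : R, forall x, normc (f1 x) <= M.
  move=> [A [B [mA mB ->]]]; exists 1 => x.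
  by rewrite /cind normcE_real ger0_norm ?indicE// lern1 leq_b1.
apply: (smallest_sub (bclosure_sigma_algebra rect1 rectM rectb)).
by move=> _ [A mA [B mB <-]]; apply: bclosure_gen; exists A, B.
Qed.

Lemma bfun_section (f : X * Y -> R[i]) x : bfun f -> bfun (fun y => f (x, y)).
Proof.
move=> [rf jf [M fM]]; split.
- exact: (measurableT_comp rf (measurable_pair1 x)).
- exact: (measurableT_comp jf (measurable_pair1 x)).
- by exists M.
Qed.

Variables (I : (X -> R[i]) -> R[i]) (J : (Y -> R[i]) -> R[i]).
Hypotheses (cI : cfunctional I) (cJ : cfunctional J).

(** Measurability of a partial integral is clear for the indicator of a
    rectangle, and is kept by the closure; the bound of J provides the uniform
    bound that limits require. *)
Lemma bfun_partial (f : X * Y -> R[i]) : bfun f ->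
  bfun (fun x => J (fun y => f (x, y))).
Proof.
move=> bf; have [C JC] := cfunctional_bounded cJ.
suff [] : bfun f /\ bfun (fun x => J (fun y => f (x, y))) by [].
move: (prod_bclosure bf) => {bf}; elim=> {f} [f|||].
- move=> [A [B [mA mB ->]]]; split; first by apply: cind_bfun; exact: measurableX.
  rewrite (_ : (fun x => _) = fun x => J (cind R B) * cind R A x).
    by apply: bfunZ; exact: cind_bfun.
  apply/funext => x; rewrite mulrC -(cfunctionalZ cJ); last exact: cind_bfun.
  congr J.
  by apply/funext => y; rewrite /cind -rmorphM/= !indicE in_setX/= -natrM mulnb.
- move=> f1 f2 _ [b1 h1] _ [b2 h2]; split; first exact: bfunD.
  rewrite (_ : (fun x => _) =
      fun x => J (fun y => f1 (x, y)) + J (fun y => f2 (x, y))).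
    exact: bfunD.
  by apply/funext => x; rewrite -(cfunctionalD cJ)//; exact: bfun_section.
- move=> c f1 _ [b1 h1]; split; first exact: bfunZ.
  rewrite (_ : (fun x => _) = fun x => c * J (fun y => f1 (x, y))).
    exact: bfunZ.
  by apply/funext => x; rewrite -(cfunctionalZ cJ)//; exact: bfun_section.
- move=> fs f1 M _ bfs fsM fsf.
  have {}fsM n x : normc (fs n x) <= `|M| + 1.
    by apply: le_trans (fsM n x) _; have := ler_norm M; lra.
  split; first by apply: bfun_lim fsM fsf => n; case: (bfs n).
  apply: (bfun_lim (fs := fun n x => J (fun y => fs n (x, y)))
      (M := C * (`|M| + 1))).
  + by move=> n; case: (bfs n).
  + by move=> n x; apply: (cfunctional_le cJ JC) => //; apply: bfun_section;
      case: (bfs n).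
  + move=> x; apply: (cfunctional_lim (M := `|M| + 1) cJ) => //.
    by move=> n; apply: bfun_section; case: (bfs n).
Qed.

Lemma cfunctional_iter : cfunctional (fun f : X * Y -> R[i] =>
  I (fun x => J (fun y => f (x, y)))).
Proof.
have [C JC] := cfunctional_bounded cJ.
split => [f g bf bg|c f bf|fs f M bfs fsM fsf].
- rewrite -(cfunctionalD cI); [|exact: bfun_partial|exact: bfun_partial].
  congr I; apply/funext => x; rewrite -(cfunctionalD cJ)//; exact: bfun_section.
- rewrite -(cfunctionalZ cI); last exact: bfun_partial.
  congr I; apply/funext => x; rewrite -(cfunctionalZ cJ)//; exact: bfun_section.
- have {}fsM n x : normc (fs n x) <= `|M| + 1.
    by apply: le_trans (fsM n x) _; have := ler_norm M; lra.
  apply: (cfunctional_lim (fs := fun n x => J (fun y => fs n (x, y)))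
      (f := fun x => J (fun y => f (x, y))) (M := C * (`|M| + 1)) cI).
  + by move=> n; exact: bfun_partial.
  + move=> n x; apply: (cfunctional_le cJ JC) => //.
    exact: bfun_section.
  + move=> x; apply: (cfunctional_lim (M := `|M| + 1) cJ) => //.
    by move=> n; exact: bfun_section.
Qed.

End iterated_functional.

(** * Complex measures as functionals *)

Section charge_integral_theory.
Context d (T : measurableType d) (R : realType).
Implicit Types (f g : T -> R) (nu : {charge set T -> \bar R}).

Definition rbfun f := measurable_fun setT f /\ exists M, forall x, `|f x| <= M.

(** The analogue of [cfunctional] for real functions, which signed measures
    satisfy. *)
Record rfunctional (L : (T -> R) -> R) : Prop := {
  rfunctionalD : forall f g, rbfun f -> rbfun g ->
    L (fun x => f x + g x) = L f + L g ;
  rfunctionalZ : forall c f, rbfun f -> L (fun x => c * f x) = c * L f ;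
  rfunctional_lim : forall (fs : nat -> T -> R) f M,
    (forall n, measurable_fun setT (fs n)) -> (forall n x, `|fs n x| <= M) ->
    (forall x, (fs ^~ x) @ \oo --> f x) ->
    (fun n => L (fs n)) @ \oo --> L f }.

Section finite_measure.
Variable m : {finite_measure set T -> \bar R}.

Lemma rbfun_integrable f : rbfun f -> m.-integrable setT (EFin \o f).
Proof.
move=> [mf [M fM]]; apply: measurable_bounded_integrable => //.
- by rewrite -ge0_fin_numE//; exact: fin_num_measure.
- exists M; split; first exact: num_real.
  by move=> N MN x _; exact: le_trans (fM x) (ltW MN).
Qed.

Lemma Rintegral_lim (fs : nat -> T -> R) f M :
  (forall n, measurable_fun setT (fs n)) -> (forall n x, `|fs n x| <= M) ->
  (forall x, (fs ^~ x) @ \oo --> f x) ->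
  (fun n => \int[m]_x fs n x) @ \oo --> \int[m]_x f x.
Proof.
move=> mfs fsM fsf.
have mf : measurable_fun setT f.
  by apply: (measurable_fun_cvg (h := fs)) => // x _; exact: fsf.
have mEfs n : measurable_fun setT (EFin \o fs n) by exact/measurable_EFinP.
have mEf : measurable_fun setT (EFin \o f) by exact/measurable_EFinP.
have [] := @dominated_convergence _ _ _ m _ measurableT
  (fun n => EFin \o fs n) (EFin \o f) (fun=> M%:E) mEfs mEf.
- by apply: aeW => x _; apply: cvg_EFin; [exact: nearW|exact: fsf].
- exact: finite_measure_integrable_cst.
- by apply: aeW => x n _; rewrite lee_fin fsM.
move=> intf _.
by rewrite -[X in _ --> X](fineK (integrable_fin_num measurableT intf)) =>
  /fine_cvg.
Qed.

Lemma measure_rfunctional : rfunctional (fun f => \int[m]_x f x).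
Proof.
split => [f g bf bg|c f bf|fs f M mfs fsM fsf].
- by rewrite RintegralD//; exact: rbfun_integrable.
- by rewrite RintegralZl//; exact: rbfun_integrable.
- exact: Rintegral_lim mfs fsM fsf.
Qed.

End finite_measure.

Lemma charge_rfunctional nu : rfunctional (charge_integral nu setT).
Proof.
have D (f g h k : R) : f + g - (h + k) = f - h + (g - k) by ring.
split => [f g bf bg|c f bf|fs f M mfs fsM fsf].
- rewrite /charge_integral; set PN := projT2 _.
  by rewrite !rfunctionalD//; exact: measure_rfunctional.
- rewrite /charge_integral; set PN := projT2 _.
  by rewrite !rfunctionalZ ?mulrBr//; exact: measure_rfunctional.
- by apply: cvgB; exact: Rintegral_lim mfs fsM fsf.
Qed.

Lemma charge_integral_indic nu A : measurable A ->
  charge_integral nu setT \1_A = fine (nu A).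
Proof.
move=> mA; rewrite /charge_integral; set PN := projT2 _.
have fP : jordan_pos PN A \is a fin_num by rewrite fin_num_measure.
have fN : jordan_neg PN A \is a fin_num by rewrite fin_num_measure.
rewrite /Rintegral !integral_indic// setIT (jordan_decomp PN mA).
have fineB (a b : \bar R) : a \is a fin_num -> b \is a fin_num ->
    fine (a + (-1)%:E * b)%E = fine a - fine b.
  by case: a b => [a||] [b||] //= _ _; rewrite mulN1r.
by rewrite /cadd/= /cscale/= fineB.
Qed.

Lemma charge_integral_mkcond nu D f :
  charge_integral nu D f = charge_integral nu setT (f \_ D).
Proof. by rewrite /charge_integral -!Rintegral_mkcond. Qed.

End charge_integral_theory.

Section cmeasure_functional.
Context d (T : measurableType d) (R : realType).
Implicit Types (mu nu : cmeasure T R) (f g : T -> R[i]).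

(** The pair (L1, L2) acts as L1 + i L2. *)
Lemma complexify_functional (L1 L2 : (T -> R) -> R) :
  rfunctional L1 -> rfunctional L2 ->
  cfunctional (fun f : T -> R[i] =>
    let re x := complex.Re (f x) in let im x := complex.Im (f x) in
    (L1 re - L2 im) +i* (L1 im + L2 re)).
Proof.
move=> [L1D L1Z L1lim] [L2D L2Z L2lim].
have bR f : bfun f -> rbfun (fun x => complex.Re (f x)).
  move=> [rf _ [M fM]]; split => //; exists M => x.
  exact: le_trans (normr_Re_le _) (fM x).
have bI f : bfun f -> rbfun (fun x => complex.Im (f x)).
  move=> [_ jf [M fM]]; split => //; exists M => x.
  exact: le_trans (normr_Im_le _) (fM x).
split => [f g bf bg|c f bf|fs f M bfs fsM fsf] /=.
- have -> : (fun x => complex.Re (f x + g x)) =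
    fun x => complex.Re (f x) + complex.Re (g x).
    by apply/funext => x; rewrite cReD.
  have -> : (fun x => complex.Im (f x + g x)) =
    fun x => complex.Im (f x) + complex.Im (g x).
    by apply/funext => x; rewrite cImD.
  rewrite !L1D ?L2D; try by [exact: bR|exact: bI].
  by apply: complex_eqP; rewrite /=; ring.
- have -> : (fun x => complex.Re (c * f x)) = fun x =>
      complex.Re c * complex.Re (f x) + - complex.Im c * complex.Im (f x).
    by apply/funext => x; rewrite cReM mulNr.
  have -> : (fun x => complex.Im (c * f x)) = fun x =>
      complex.Re c * complex.Im (f x) + complex.Im c * complex.Re (f x).
    by apply/funext => x; rewrite cImM.
  have bZ k (h : T -> R) : rbfun h -> rbfun (fun x => k * h x).
    move=> [mh [M hM]]; split; first exact: measurable_funM.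
    by exists (`|k| * M) => x; rewrite normrM ler_wpM2l.
  rewrite !L1D ?L2D; try by [exact/bZ/bR|exact/bZ/bI].
  rewrite !L1Z ?L2Z; try by [exact: bR|exact: bI].
  by apply: complex_eqP; rewrite ?cReM ?cImM /=; ring.
- have fsR n x : `|complex.Re (fs n x)| <= M.
    by apply: le_trans (fsM n x); exact: normr_Re_le.
  have fsI n x : `|complex.Im (fs n x)| <= M.
    by apply: le_trans (fsM n x); exact: normr_Im_le.
  have mR n : measurable_fun setT (fun x => complex.Re (fs n x)).
    by case: (bfs n).
  have mI n : measurable_fun setT (fun x => complex.Im (fs n x)).
    by case: (bfs n).
  by split; [apply: cvgB|apply: cvgD];
    (apply: L1lim || apply: L2lim) => // x; case: (fsf x).
Qed.

Lemma cintegral_functional mu : cfunctional (cintegral mu setT).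
Proof. by apply: complexify_functional; exact: charge_rfunctional. Qed.

Lemma cintegral_ind mu A : measurable A -> cintegral mu setT (cind R A) = mu A.
Proof.
move=> mA; have I0 (nu : {charge set T -> \bar R}) : charge_integral nu setT (fun=> 0 : R) = 0.
  by rewrite /charge_integral /Rintegral !integral0 subrr.
rewrite /cintegral /cind /= !I0 !subr0 add0r.
by rewrite !charge_integral_indic.
Qed.

Lemma cintegral_mkcond mu D f :
  cintegral mu D f = cintegral mu setT (fun x => f x * cind R D x).
Proof.
rewrite /cintegral.
have eR : (fun x => complex.Re (f x * cind R D x)) =
    (fun x => complex.Re (f x)) \_ D.
  apply/funext => x; rewrite cReM /cind /= mulr0 subr0 patchE indicE.
  by case: (x \in D); rewrite ?mulr1 ?mulr0.
have eI : (fun x => complex.Im (f x * cind R D x)) =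
    (fun x => complex.Im (f x)) \_ D.
  apply/funext => x; rewrite cImM /cind /= mulr0 add0r patchE indicE.
  by case: (x \in D); rewrite ?mulr1 ?mulr0.
by rewrite eR eI -!charge_integral_mkcond.
Qed.

Lemma cintegralE mu I : cfunctional I ->
  (forall A, measurable A -> mu A = I (cind R A)) ->
  forall f, bfun f -> cintegral mu setT f = I f.
Proof.
move=> cI muI; apply: cfunctional_eq_ind => //; first exact: cintegral_functional.
by move=> A mA; rewrite cintegral_ind// muI.
Qed.

Lemma cintegral_of_measure (m : {finite_measure set T -> \bar R}) f : bfun f ->
  cintegral (cm_of_measure m) setT f =
  (\int[m]_x complex.Re (f x)) +i* (\int[m]_x complex.Im (f x)).
Proof.
have r0 : rfunctional (fun _ : T -> R => 0 : R).
  by split => // *; [rewrite addr0|rewrite mulr0|exact: cvg_cst].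
have cI := complexify_functional (measure_rfunctional m) r0.
move=> bf; rewrite (cintegralE cI _ bf) /=; first by rewrite subr0 addr0.
move=> A mA; rewrite /cind /= subr0 addr0 /cmeasure_fun /=.
by rewrite /Rintegral integral_indic// setIT integral0.
Qed.

Section representation.
Variable I : (T -> R[i]) -> R[i].
Hypothesis cI : cfunctional I.

Section part.
Variable p : R[i] -> R.
Hypothesis p0 : p 0 = 0.
Hypothesis pD : forall z w, p (z + w) = p z + p w.
Hypothesis p_lim : forall u z, ccvg u z -> (fun n => p (u n)) @ \oo --> p z.

(** The real and imaginary parts of the set function A |-> I 1_A. *)
Definition part_set (A : set T) : \bar R := (p (I (cind R A)))%:E.

Let part_set0 : part_set set0 = 0%E.
Proof.
rewrite /part_set (_ : cind R set0 = fun=> 0) ?cfunctional0 ?p0//.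
by apply/funext => x; rewrite /cind indic0.
Qed.

Let part_fin A : measurable A -> part_set A \is a fin_num.
Proof. by []. Qed.

Let part_sigma_additive : semi_sigma_additive part_set.
Proof.
move=> F mF tF mUF.
have indF n x : \sum_(i < n) cind R (F i) x = cind R (\bigcup_(i < n) F i) x.
  have [[k [kn Fk]]|nF] := pselect (exists k, (k < n)%N /\ F k x).
    rewrite (bigD1 (Ordinal kn))//= big1 ?addr0.
      by rewrite /cind !indicE !mem_set//; exists k.
    move=> j jk; rewrite /cind indicE memNset// => Fj.
    move/trivIsetP: tF => /(_ j k Logic.I Logic.I).
    rewrite -(inj_eq val_inj) /= in jk *.
    by move=> /(_ jk)/seteqP[/(_ x) + _] => /(_ (conj Fj Fk)).
  rewrite big1 => [|j _]; rewrite /cind indicE memNset//.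
    by move=> [j /= jn Fj]; apply: nF; exists j.
  by move=> Fj; apply: nF; exists j.
have -> : (fun n => (\sum_(0 <= i < n) part_set (F i))%E) =
    fun n => (p (I (fun x => \sum_(i < n) cind R (F i) x)))%:E.
  apply/funext => n; rewrite big_mkord /part_set sumEFin; congr (_%:E).
  have [_ ->] := cfunctional_sum (n := n) (fs := fun i x => cind R (F i) x) cI
    (fun i => cind_bfun R (mF i)).
  by symmetry; apply: (big_morph p).
apply: cvg_EFin; first exact: nearW.
apply: p_lim; apply: (cfunctional_lim (M := 1) cI).
- move=> n; rewrite (_ : (fun x => _) = cind R (\bigcup_(i < n) F i)).
    by apply: cind_bfun; apply: bigcup_measurable => k _; exact: mF.
  by apply/funext => x; rewrite indF.
- by move=> n x; rewrite indF normcE_real ger0_norm ?indicE// lern1 leq_b1.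
- move=> x; under eq_fun do rewrite indF; apply: ccvg_real.
  have [[k _ Fk]|nF] := pselect ((\bigcup_k F k) x).
    rewrite [X in _ --> X]indicE mem_set; last by exists k.
    apply: cvg_near_cst; near=> n; rewrite indicE mem_set//; exists k => //=.
    by near: n; exact: nbhs_infty_gt.
  rewrite [X in _ --> X]indicE memNset//; apply: cvg_near_cst.
  apply: nearW => n; rewrite indicE memNset// => -[k _ Fk].
  by apply: nF; exists k.
Unshelve. all: by end_near. Qed.

Let part_isCharge := isCharge.Build _ _ _ part_set
  part_set0 part_fin part_sigma_additive.

Definition part_charge : {charge set T -> \bar R} :=
  HB.pack part_set part_isCharge.

End part.

(** Countable additivity of A |-> I 1_A is continuity of I along the partial
    sums of indicators of disjoint sets. *)
Lemma cfunctional_measure : exists mu : cmeasure T R,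
  forall A, measurable A -> mu A = I (cind R A).
Proof.
exists (CMeasure
  (part_charge (p := @complex.Re R) erefl cReD (fun u z h => h.1))
  (part_charge (p := @complex.Im R) erefl cImD (fun u z h => h.2))).
by move=> A mA; rewrite /cmeasure_fun/= /part_set/=; case: (I _).
Qed.

End representation.

End cmeasure_functional.

(** * Complex exponential and characters of the torus *)

Section cexp_theory.
Context {R : realType}.
Implicit Types (z w : R[i]).

Lemma cexpD z w : cexp (z + w) = cexp z * cexp w.
Proof.
apply: complex_eqP; rewrite ?cReM ?cImM /cexp /= ?cReD ?cImD expRD ?cosD ?sinD;
  ring.
Qed.

Lemma cexp0 : cexp 0 = 1 :> R[i].
Proof. by apply: complex_eqP; rewrite /cexp /= expR0 ?cos0 ?sin0 mul1r. Qed.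

Lemma cexp_neq0 z : cexp z != 0.
Proof.
apply/eqP => z0; have := cexpD z (- z); rewrite subrr z0 mul0r cexp0.
by move/eqP; rewrite oner_eq0.
Qed.

Lemma cexpN z : cexp (- z) = (cexp z)^-1.
Proof.
apply: (mulfI (cexp_neq0 z)); rewrite -cexpD subrr cexp0 divff//.
exact: cexp_neq0.
Qed.

Lemma normc_cexp z : normc (cexp z) = expR (complex.Re z).
Proof.
rewrite /cexp /= !exprMn -mulrDr cos2Dsin2 mulr1 sqrtr_sqr ger0_norm//.
Qed.

Lemma cexp_i (t : R) : cexp ('i%C * t%:C) = cos t +i* sin t.
Proof.
by apply: complex_eqP; rewrite /cexp /= !(mul0r, mul1r, mulr0) ?subr0 ?add0r
  ?addr0 expR0 mul1r.
Qed.

Lemma cexp_2pi_int (n : int) : cexp ('i%C * ((2 * pi) *~ n)%:C) = 1 :> R[i].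
Proof.
have pn (m : nat) : cexp ('i%C * ((2 * pi) *~ m)%:C) = 1 :> R[i].
  rewrite cexp_i -pmulrn mulr_natl; apply: complex_eqP => /=.
    by have := periodicn (@cosD2pi R) m 0; rewrite add0r cos0.
  by have := periodicn (@sinD2pi R) m 0; rewrite add0r sin0.
case: n => n; first exact: pn.
by rewrite NegzE mulrNz rmorphN mulrN cexpN pn invr1.
Qed.

End cexp_theory.

Section torus_characters.
Context {R : realType}.
Local Notation T := (torus R).
Implicit Types (x y : T) (s t : R) (u v : int).

Definition char u x : R[i] := cexp ('i%C * u%:~R * angle x).

Lemma to_torusD s t : @to_torus R (s + t) = to_torus s + to_torus t.
Proof. exact: (GRing.raddfD \pi_T%qT). Qed.

Lemma to_torusN s : @to_torus R (- s) = - to_torus s.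
Proof. exact: (GRing.raddfN \pi_T%qT). Qed.

Lemma to_torus_repr x : to_torus (repr x) = x.
Proof. exact: reprK. Qed.

Lemma to_torusP s t :
  to_torus s = to_torus t <-> exists n : int, s - t = (2 * pi) *~ n.
Proof.
split.
  move=> /eqP st; have : s - t \in @twopiZ R.
    by rewrite (Quotient.idealrBE (GRing.ZmodClosed.clone R (@twopiZ R) _)).
  by move/asboolP.
move=> stn; apply/eqP.
have : s - t \in @twopiZ R by apply/asboolP.
by rewrite (Quotient.idealrBE (GRing.ZmodClosed.clone R (@twopiZ R) _)).
Qed.

Lemma char_to_torus u t : char u (to_torus t) = cexp ('i%C * (u%:~R * t)%:C).
Proof.
rewrite /char /angle; have [n tn] := (to_torusP _ _).1 (to_torus_repr (to_torus t)).
rewrite -(subrK t (repr _)) tn rmorphD/= mulrDr cexpD.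
rewrite -mulrA (_ : u%:~R * _ = ((2 * pi) *~ (n * u))%:C); last first.
  by rewrite mulrzA -[(_ *~ _) *~ u]mulrzr [in RHS]rmorphM/= rmorph_int mulrC.
by rewrite cexp_2pi_int mul1r -mulrA rmorphM/= rmorph_int.
Qed.

Lemma charD u v x : char (u + v) x = char u x * char v x.
Proof. by rewrite /char intrD mulrDr mulrDl cexpD. Qed.

Lemma char0 x : char 0 x = 1.
Proof. by rewrite /char mulr0 mul0r cexp0. Qed.

Lemma charN u x : char (- u) x = (char u x)^-1.
Proof. by rewrite /char mulrNz mulrN mulNr cexpN. Qed.

Lemma char_addr u x y : char u (x + y) = char u x * char u y.
Proof.
rewrite -(to_torus_repr x) -(to_torus_repr y) -to_torusD !char_to_torus.
by rewrite mulrDr rmorphD/= mulrDr cexpD.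
Qed.

Lemma char_oppr u x : char u (- x) = (char u x)^-1.
Proof.
rewrite -(to_torus_repr x) -to_torusN !char_to_torus.
by rewrite mulrN rmorphN/= mulrN cexpN.
Qed.

Lemma char_subr u x y : char u (x - y) = char u x * char (- u) y.
Proof. by rewrite char_addr char_oppr charN. Qed.

Lemma normc_char u x : normc (char u x) = 1.
Proof.
rewrite -(to_torus_repr x) char_to_torus normc_cexp/=.
by rewrite mul0r mulr0 subr0 expR0.
Qed.

Lemma torus_measurable_open (f : T -> R) :
  continuous (f \o @to_torus R) -> measurable_fun setT f.
Proof.
move=> cf mD; apply: (measurability _ (RGenOInfty.measurableE R)) => //.
move=> /= _ [_ [a ->] <-]; rewrite setTI; apply: sub_sigma_algebra.
rewrite /torus_open /= /open/= /quotient_open.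
rewrite (_ : _ @^-1` _ = (f \o @to_torus R) @^-1` `]a, +oo[)//.
by apply: open_comp => // t _; exact: cf.
Qed.

Lemma char_bfun u : bfun (char u).
Proof.
have cM : continuous (fun t : R => u%:~R * t).
  by move=> t; apply: cvgM; [exact: cvg_cst|exact: cvg_id].
split.
- apply: torus_measurable_open.
  rewrite (_ : _ \o _ = cos \o (fun t => u%:~R * t)).
    by move=> t; apply: continuous_comp; [exact: cM|exact: continuous_cos].
  apply/funext => t; exact: (congr1 (@complex.Re R)
    (etrans (char_to_torus u t) (cexp_i _))).
- apply: torus_measurable_open.
  rewrite (_ : _ \o _ = sin \o (fun t => u%:~R * t)).
    by move=> t; apply: continuous_comp; [exact: cM|exact: continuous_sin].
  apply/funext => t; exact: (congr1 (@complex.Im R)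
    (etrans (char_to_torus u t) (cexp_i _))).
- by exists 1 => x; rewrite normc_char.
Qed.

Definition characters (f : T -> R[i]) := exists u, f = char u.

Let characters1 : characters (fun=> 1).
Proof. by exists 0; apply/funext => x; rewrite char0. Qed.

Let charactersM f g : characters f -> characters g ->
  characters (fun x => f x * g x).
Proof.
by move=> [u ->] [v ->]; exists (u + v); apply/funext => x; rewrite charD.
Qed.

Let characters_bounded f : characters f ->
  exists M : R, forall x, normc (f x) <= M.
Proof. by move=> [u ->]; exists 1 => x; rewrite normc_char. Qed.

Definition arc_fun (c r : R) x : R :=
  complex.Re (char 1 x * cexp (- ('i%C * c%:C))) - cos r.

Lemma arc_fun_to_torus c r t : arc_fun c r (to_torus t) = cos (t - c) - cos r.
Proof.
rewrite /arc_fun char_to_torus mul1r -cexpD -mulrN -mulrDr -rmorphN -rmorphD.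
by rewrite cexp_i.
Qed.

(** The arc of centre c and half-length r, as the positivity set of a
    trigonometric polynomial: cos (t - c) > cos r. *)
Definition arc (c r : R) : set T := [set x | 0 < arc_fun c r x].

Lemma arc_bclosure c r : bclosure characters (cind R (arc c r)).
Proof.
apply: (bclosure_pos characters1 charactersM characters_bounded).
pose k := (1 / 2)%:C * cexp (- ('i%C * c%:C)).
pose l := (1 / 2)%:C * cexp ('i%C * c%:C).
have Gc a : bclosure characters (fun=> a).
  exact: (bclosure_cst characters1).
have Gchar u : bclosure characters (char u) by apply: bclosure_gen; exists u.
apply: bclosure_ext (bclosure_add (bclosure_add (bclosure_scale k (Gchar 1))
  (bclosure_scale l (Gchar (-1)))) (Gc (- cos r)%:C)) => x.
rewrite -(to_torus_repr x); set t := repr x.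
rewrite arc_fun_to_torus !char_to_torus -!mulrA -!cexpD.
rewrite -mulrN -!mulrDr -rmorphN -!rmorphD !cexp_i.
rewrite mulrN1z mulr1z (mul1r t) (mulN1r t) (_ : - c + t = t - c); last by ring.
rewrite (_ : c - t = - (t - c)); last by ring.
by rewrite cosN sinN; apply: complex_eqP; rewrite /=; field.
Qed.

Lemma mod_2pi t : exists n : int, `|t + (2 * pi) *~ n| <= pi.
Proof.
have p0 := @twopi_gt0 R.
exists (- Num.floor (t / (2 * pi) + 1 / 2)).
set z := Num.floor _; have := floor_itv (t / (2 * pi) + 1 / 2).
rewrite -/z => /andP[z1 z2]; rewrite mulrNz -mulrzr.
move: z2 z1; rewrite intrD -(ler_pM2l p0) -(ltr_pM2l p0).
have -> : 2 * pi * (t / (2 * pi) + 1 / 2) = t + pi.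
  by rewrite mulrDr [X in X + _]mulrC divfK ?gt_eqF//; congr (_ + _); field.
by rewrite ler_norml mulrDr mulr1 => h1 h2; apply/andP; split; lra.
Qed.

Lemma arcP c r t : 0 <= r <= pi -> arc c r (to_torus t) <->
  exists2 s, to_torus s = to_torus t & `|s - c| < r.
Proof.
move=> /andP[r0 rpi]; rewrite /arc/= arc_fun_to_torus subr_gt0; split.
  move=> h; have [n ns] := mod_2pi (t - c).
  exists (t + 2 * pi *~ n).
    by apply/to_torusP; exists n; rewrite addrC addKr.
  move: ns; rewrite addrAC => ns.
  have : cos r < cos `|t + 2 * pi *~ n - c|.
    rewrite cos_norm; move: h; rewrite addrAC.
    suff -> : cos (t - c + 2 * pi *~ n) = cos (t - c) by [].
    have /(congr1 (@complex.Re R)) := cexpD ('i%C * (t - c)%:C)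
      ('i%C * (2 * pi *~ n)%:C).
    by rewrite cexp_2pi_int mulr1 -mulrDr -rmorphD !cexp_i.
  by rewrite ltr_cos// ?in_itv/= ?r0 ?rpi ?normr_ge0.
move=> [s st sc]; have [n sn] := (to_torusP _ _).1 (esym st).
have -> : cos (t - c) = cos (s - c).
  have /(congr1 (@complex.Re R)) := cexpD ('i%C * (s - c)%:C)
    ('i%C * (2 * pi *~ n)%:C).
  rewrite cexp_2pi_int mulr1 -mulrDr -rmorphD !cexp_i /= => <-.
  by congr cos; rewrite -sn; ring.
rewrite -[cos (s - c)]cos_norm ltr_cos// ?in_itv/= ?r0 ?rpi ?normr_ge0//.
exact: le_trans (ltW sc) rpi.
Qed.

(** Every open set of the torus is a union of arcs with rational centres and
    radii 1/(n+1). *)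
Lemma torus_open_bclosure (U : set T) : torus_open U ->
  bclosure characters (cind R U).
Proof.
move=> oU; pose S := [set A : set T | bclosure characters (cind R A)].
have [S0 SD SU] : sigma_algebra setT S.
  exact: (bclosure_sigma_algebra characters1 charactersM characters_bounded).
pose good (q : rat * nat) := arc (ratr q.1) q.2.+1%:R^-1 `<=` U.
pose F k := if (choice.unpickle k : option (rat * nat)%type) is Some q then
  (if `[< good q >] then arc (ratr q.1) q.2.+1%:R^-1 else set0) else set0.
have SF k : S (F k).
  rewrite /F; case: choice.unpickle => [q|//]; case: ifPn => // _.
  exact: arc_bclosure.
have inv_pi (n : nat) : (0 : R) <= n.+1%:R^-1 <= (pi : R).
  rewrite invr_ge0 ler0n/= (le_trans _ (@pi_ge2 R))//.
  by rewrite (le_trans (y := 1))//; [rewrite invf_le1// ler1n|lra].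
rewrite (_ : U = \bigcup_k F k); first exact: SU.
apply/seteqP; split => [x Ux|x [k _]]; last first.
  rewrite /F; case: choice.unpickle => [q|//]; case: asboolP => // qU.
  exact: qU.
have [t xE] : exists t : R, x = to_torus t.
  by exists (repr x); rewrite to_torus_repr.
rewrite {}xE in Ux *.
have oV : open (@to_torus R @^-1` U) by exact: oU.
have [e /= e0 eU] : nbhs t (@to_torus R @^-1` U).
  by apply: open_nbhs_nbhs; split.
have [n ne] : exists n : nat, n.+1%:R^-1 < e / 2.
  have e20 : 0 < e / 2 by rewrite divr_gt0.
  exists (Num.bound (e / 2)^-1); rewrite -[ltRHS]invrK ltf_pV2 ?posrE ?invr_gt0//.
  apply: (lt_le_trans (archi_boundP _)); first by rewrite invr_ge0 ltW.
  by rewrite ler_nat.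
have n0 : 0 < n.+1%:R^-1 :> R by rewrite invr_gt0.
have [r rE] : exists r : R, r = n.+1%:R^-1 by exists n.+1%:R^-1.
rewrite -rE in n0 ne.
have [q qx] : exists q : rat, `|t - ratr q| < r.
  have [|q] := @rat_in_itvoo R (t - r) (t + r); first lra.
  by rewrite in_itv/= => /andP[h1 h2]; exists q; rewrite ltr_norml;
    apply/andP; split; lra.
have qU : good (q, n).
  move=> y; rewrite -(to_torus_repr y) => /(arcP _ _ (inv_pi n))[s <- sq].
  rewrite -rE in sq.
  apply: eU => /=; apply: (le_lt_trans (ler_distD (ratr q) _ _)).
  by rewrite distrC /= in sq; lra.
exists (choice.pickle (q, n)); first exact: Logic.I.
rewrite /F choice.pickleK (asboolT qU).
apply/arcP; first exact: inv_pi.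
by exists t; rewrite -?rE.
Qed.

(** The sets whose indicator lies in the closure of the characters form a
    sigma-algebra, and it contains the open sets. *)
Lemma torus_bclosure (f : T -> R[i]) : bfun f -> bclosure characters f.
Proof.
apply: bfun_bclosure => A.
apply: (smallest_sub (bclosure_sigma_algebra characters1 charactersM
  characters_bounded)).
exact: torus_open_bclosure.
Qed.

End torus_characters.

(** * The square of the torus *)

Lemma bfun_comp d d' (S : measurableType d) (T : measurableType d')
    (R : realType) (h : S -> T) (f : T -> R[i]) :
  measurable_fun setT h -> bfun f -> bfun (f \o h).
Proof.
move=> mh [rf jf [M fM]]; split.
- exact: (measurableT_comp rf mh).
- exact: (measurableT_comp jf mh).
- by exists M => x; exact: fM.
Qed.

Section torus_square.
Context {R : realType}.
Local Notation T := (torus R).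

Definition characters2 (f : T * T -> R[i]) :=
  exists u v, f = fun p => char u p.1 * char v p.2.

Lemma characters2_bfun f : characters2 f -> bfun f.
Proof.
move=> [u [v ->]]; apply: bfunM.
  exact: (bfun_comp measurable_fst (char_bfun u)).
exact: (bfun_comp measurable_snd (char_bfun v)).
Qed.

Lemma torus2_bclosure (f : T * T -> R[i]) : bfun f -> bclosure characters2 f.
Proof.
move=> /prod_bclosure; apply: bclosure_sub => g [A [B [mA mB ->]]].
have c2_1 : characters2 (fun=> 1).
  by exists 0, 0; apply/funext => p; rewrite !char0 mul1r.
have c2M f1 f2 : characters2 f1 -> characters2 f2 ->
    characters2 (fun x => f1 x * f2 x).
  move=> [u1 [v1 ->]] [u2 [v2 ->]]; exists (u1 + u2), (v1 + v2).
  by apply/funext => p; rewrite !charD mulrACA.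
have c2b f1 : characters2 f1 -> exists M : R, forall x, normc (f1 x) <= M.
  by move=> [u [v ->]]; exists 1 => x; rewrite normcM !normc_char mul1r.
apply: (@bclosure_ext _ _ _ (fun p => (cind R A \o fst) p * (cind R B \o snd) p)).
  by move=> [x y]; rewrite /cind /= -rmorphM !indicE in_setX /= -natrM mulnb.
apply: (bclosureM c2M c2b).
  apply: bclosure_comp (torus_bclosure (cind_bfun R mA)) => _ [u ->].
  by exists u, 0; apply/funext => p; rewrite char0 mulr1.
apply: bclosure_comp (torus_bclosure (cind_bfun R mB)) => _ [u ->].
by exists 0, u; apply/funext => p; rewrite char0 mul1r.
Qed.

Lemma bfun_addr (f : T -> R[i]) : bfun f ->
  bfun (f \o (fun p : T * T => p.1 + p.2)).
Proof.
move=> /torus_bclosure bf; apply: (bclosure_bfun characters2_bfun).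
apply: bclosure_comp bf => _ [u ->]; exists u, u.
by apply/funext => p; rewrite /= char_addr.
Qed.

Lemma char_sum_diff u v (x y : T) :
  char u (x + y) * char v (x - y) = char (u + v) x * char (u - v) y.
Proof.
by rewrite char_addr char_subr mulrACA (charD u v x) (charD u (- v) y).
Qed.

Lemma bfun_sum_diff (f : T * T -> R[i]) : bfun f -> bfun (f \o @sum_diff R).
Proof.
move=> /torus2_bclosure bf; apply: (bclosure_bfun characters2_bfun).
apply: bclosure_comp bf => _ [u [v ->]]; exists (u + v), (u - v).
by apply/funext => p; rewrite /= char_sum_diff.
Qed.

(** Measurability of addition is read off from characters, which it turns into
    products of characters. *)
Lemma measurable_addr_preimage (A : set T) : measurable A ->
  measurable [set p : T * T | A (p.1 + p.2)].
Proof.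
by move=> mA; apply: (@bfun_cind_measurable _ _ R);
  exact: bfun_addr (cind_bfun R mA).
Qed.

Lemma measurable_sum_diff_preimage (E : set (T * T)) : measurable E ->
  measurable (@sum_diff R @^-1` E).
Proof.
by move=> mE; apply: (@bfun_cind_measurable _ _ R);
  exact: bfun_sum_diff (cind_bfun R mE).
Qed.

(** * Fourier-Stieltjes transforms of set functions *)

(** The functional I witnesses that m is a complex measure with transform a.
    The set function m itself is arbitrary outside the measurable sets, which
    lets products, convolutions and densities be treated on the same footing as
    complex measures. *)
Definition has_ft (m : set T -> R[i]) (a : int -> R[i]) :=
  exists2 I, cfunctional I & (forall A, measurable A -> m A = I (cind R A)) /\
    (forall u, I (char (- u)) = a u).

Implicit Types (m : set T -> R[i]) (a b : int -> R[i]) (mu nu : cmeasure T R).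

(** Bounded Borel functions lie in the closure of the characters, on which the
    two functionals agree. *)
Lemma has_ft_unique m m' a : has_ft m a -> has_ft m' a -> m =m m'.
Proof.
move=> [I cI [mI Ia]] [J cJ [mJ Ja]] A mA; rewrite mI// mJ//.
apply: (cfunctional_eq_bclosure cI cJ _ (torus_bclosure (cind_bfun R mA))).
by move=> _ [u ->]; split; [exact: char_bfun|rewrite -(opprK u) Ia Ja].
Qed.

Lemma has_ft_eqm m m' a : m =m m' -> has_ft m a -> has_ft m' a.
Proof.
move=> mm' [I cI [mI Ia]]; exists I => //; split => // A mA.
by rewrite -mm'// mI.
Qed.

Lemma has_ft_fun m a b : has_ft m a -> has_ft m b -> a =1 b.
Proof.
move=> [I cI [mI Ia]] [J cJ [mJ Jb]] u; rewrite -Ia -Jb.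
apply: (cfunctional_eq_ind cI cJ); last exact: char_bfun.
by move=> A mA; rewrite -mI// mJ.
Qed.

Lemma eq_has_ft m a b : a =1 b -> has_ft m a -> has_ft m b.
Proof. by move=> /funext ->. Qed.

Lemma has_ft_iff m m' a b : has_ft m a -> has_ft m' b -> (m =m m' <-> a =1 b).
Proof.
move=> ma mb; split=> [mm'|ab].
  exact: has_ft_fun (has_ft_eqm mm' ma) mb.
exact: has_ft_unique (eq_has_ft ab ma) mb.
Qed.

Lemma has_ft_bounded m a : has_ft m a ->
  exists M : R, forall u, normc (a u) <= M.
Proof.
move=> [I cI [_ Ia]]; have [C IC] := cfunctional_bounded cI.
by exists C => u; rewrite -Ia; apply: IC => [|x]; [exact: char_bfun|
  rewrite normc_char].
Qed.

Lemma has_ft_cmeasure m a : has_ft m a -> exists mu, mu =m m.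
Proof.
by move=> [I cI [mI Ia]]; have [mu muI] := cfunctional_measure cI; exists mu =>
  A mA; rewrite muI// mI.
Qed.

Lemma fourier_stieltjesE mu u :
  fourier_stieltjes mu u = cintegral mu setT (char (- u)).
Proof.
rewrite /fourier_stieltjes; congr cintegral; apply/funext => x.
by rewrite /char mulrNz mulrN mulNr.
Qed.

Lemma has_ft_fourier mu : has_ft mu (fourier_stieltjes mu).
Proof.
exists (cintegral mu setT); first exact: cintegral_functional.
by split => [A mA|u]; [rewrite cintegral_ind|rewrite fourier_stieltjesE].
Qed.

Lemma has_ftE mu a : has_ft mu a -> forall u, cintegral mu setT (char u) = a (- u).
Proof.
move=> mua u; rewrite -(has_ft_fun (has_ft_fourier mu) mua).
by rewrite fourier_stieltjesE opprK.
Qed.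

Lemma has_ftD m m' a b : has_ft m a -> has_ft m' b ->
  has_ft (fun A => m A + m' A) (fun u => a u + b u).
Proof.
move=> [I cI [mI Ia]] [J cJ [mJ Jb]].
exists (fun f => I f + J f); first exact: cfunctional_add.
by split => [A mA|u]; [rewrite mI// mJ|rewrite Ia Jb].
Qed.

Lemma has_ftZ m a c : has_ft m a -> has_ft (fun A => c * m A) (fun u => c * a u).
Proof.
move=> [I cI [mI Ia]]; exists (fun f => c * I f); first exact: cfunctional_scale.
by split => [A mA|u]; [rewrite mI|rewrite Ia].
Qed.

Lemma cmaddE mu nu A : measurable A -> cmadd mu nu A = mu A + nu A.
Proof.
move=> mA; rewrite /cmeasure_fun /cmadd /= /cadd /=.
by rewrite !fineD// fin_num_measure.
Qed.

Lemma cmscaleE c mu A : measurable A -> cmscale c mu A = c * mu A.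
Proof.
move=> mA; rewrite /cmeasure_fun /cmscale /= /cadd /= /cscale /=.
have fr := fin_num_measure (cmre mu) A mA.
have fi := fin_num_measure (cmim mu) A mA.
rewrite !fineD ?fin_numM// !fineM//=.
by apply: complex_eqP; rewrite ?cReM ?cImM /= ?mulNr.
Qed.

Lemma has_ft_cmadd mu nu a b : has_ft mu a -> has_ft nu b ->
  has_ft (cmadd mu nu) (fun u => a u + b u).
Proof.
move=> mua nub; apply: has_ft_eqm (has_ftD mua nub) => A mA.
by rewrite cmaddE.
Qed.

Lemma has_ft_cmscale c mu a : has_ft mu a ->
  has_ft (cmscale c mu) (fun u => c * a u).
Proof.
by move=> mua; apply: has_ft_eqm (has_ftZ c mua) => A mA; rewrite cmscaleE.
Qed.

Lemma has_ft_cmzero : has_ft (cmzero T R) (fun=> 0).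
Proof.
exists (fun=> 0) => //; split => // [f g _ _|c f _|fs f M _ _ _].
- by rewrite addr0.
- by rewrite mulr0.
- exact: ccvg_cst.
Qed.

Lemma has_ft_density g mu : bfun g ->
  has_ft (with_density g mu)
    (fun u => cintegral mu setT (fun x => g x * char (- u) x)).
Proof.
move=> bg; exists (fun f => cintegral mu setT (fun x => g x * f x)).
  exact: cfunctional_density (cintegral_functional mu) bg.
by split => // A mA; rewrite /with_density cintegral_mkcond.
Qed.

Lemma has_ft_char_density mu a n c : has_ft mu a ->
  has_ft (with_density (fun x => c * char n x) mu) (fun u => c * a (u - n)).
Proof.
move=> mua; have bg : bfun (fun x : T => c * char n x).
  by apply: bfunZ; exact: char_bfun.
apply: eq_has_ft (has_ft_density mu bg) => u.
rewrite -[X in cintegral _ _ X](_ : (fun x => c * char (n - u) x) = _).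
  rewrite (cfunctionalZ (cintegral_functional mu)); last exact: char_bfun.
  by rewrite (has_ftE mua) opprB.
by apply/funext => x; rewrite charD mulrA.
Qed.

(** * Products and convolutions *)

Lemma cproductE mu nu E : measurable E ->
  cproduct mu nu E = cintegral mu setT (fun x =>
    cintegral nu setT (fun y => cind R E (x, y))).
Proof.
move=> mE; rewrite /cproduct; congr cintegral; apply/funext => x.
rewrite -cintegral_ind; last exact: measurable_xsection.
by congr cintegral; apply/funext => y; rewrite /cind !indicE mem_xsection.
Qed.

Lemma iter_functional mu nu : cfunctional (fun f : T * T -> R[i] =>
  cintegral mu setT (fun x => cintegral nu setT (fun y => f (x, y)))).
Proof. by apply: cfunctional_iter; exact: cintegral_functional. Qed.

Lemma iter_chars mu nu a b u v : has_ft mu a -> has_ft nu b ->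
  cintegral mu setT (fun x => cintegral nu setT (fun y => char u x * char v y)) =
  a (- u) * b (- v).
Proof.
move=> mua nub; rewrite -(has_ftE mua) -(has_ftE nub) mulrC.
rewrite -(cfunctionalZ (cintegral_functional mu)); last exact: char_bfun.
congr cintegral; apply/funext => x; rewrite mulrC.
by rewrite (cfunctionalZ (cintegral_functional nu))//; exact: char_bfun.
Qed.

Lemma has_ft_convolution mu nu a b : has_ft mu a -> has_ft nu b ->
  has_ft (convolution mu nu) (fun u => a u * b u).
Proof.
move=> mua nub; exists (fun f : T -> R[i] => cintegral mu setT (fun x =>
    cintegral nu setT (fun y => f (x + y)))).
  exact: (cfunctional_comp (@bfun_addr) (iter_functional mu nu)).
split => [A mA|u].
  by rewrite /convolution cproductE//; exact: measurable_addr_preimage.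
rewrite -[u in RHS]opprK -(iter_chars _ _ mua nub).
congr cintegral; apply/funext => x; congr cintegral; apply/funext => y.
by rewrite char_addr.
Qed.

(** Both sides are complex measures on the square, so they agree as soon as
    their Fourier coefficients do; a factor is recovered from the product by
    freezing the frequency of the other one. *)
Lemma pushforward_product_iff mu1 mu2 a b : has_ft mu1 a -> has_ft mu2 b ->
  (exists nu1 nu2 : cmeasure T R,
     cpushforward (@sum_diff R) (cproduct mu1 mu2) =m cproduct nu1 nu2) <->
  (exists f g : int -> R[i], forall u v, a (u + v) * b (u - v) = f u * g v).
Proof.
move=> mu1a mu2b; pose I f := cintegral mu1 setT (fun x =>
  cintegral mu2 setT (fun y => f (@sum_diff R (x, y)))).
have cI : cfunctional I.
  exact: (cfunctional_comp (@bfun_sum_diff) (iter_functional mu1 mu2)).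
have I_char u v : I (fun p => char u p.1 * char v p.2) =
    a (- (u + v)) * b (- (u - v)).
  rewrite -(iter_chars _ _ mu1a mu2b); congr cintegral; apply/funext => x.
  by congr cintegral; apply/funext => y; rewrite /= char_sum_diff.
have IE E : measurable E ->
    cpushforward (@sum_diff R) (cproduct mu1 mu2) E = I (cind R E).
  move=> mE; rewrite /cpushforward cproductE//.
  exact: measurable_sum_diff_preimage.
have I_charN u v : I (fun p => char (- u) p.1 * char (- v) p.2) =
    a (u + v) * b (u - v).
  by rewrite I_char; congr (a _ * b _); ring.
split=> [[nu1 [nu2 nuE]]|[f [g fg]]].
  exists (fourier_stieltjes nu1), (fourier_stieltjes nu2) => u v.
  rewrite -[u in RHS]opprK -[v in RHS]opprK.
  rewrite -(iter_chars _ _ (has_ft_fourier nu1) (has_ft_fourier nu2)) -I_charN.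
  apply: (cfunctional_eq_ind cI (iter_functional nu1 nu2)).
    by move=> E mE; rewrite -IE// nuE// cproductE.
  by apply: characters2_bfun; exists (- u), (- v).
have suf nu1 nu2 f' g' : has_ft nu1 f' -> has_ft nu2 g' ->
    (forall u v, f' u * g' v = f u * g v) ->
    cpushforward (@sum_diff R) (cproduct mu1 mu2) =m cproduct nu1 nu2.
  move=> nu1f nu2g fg' E mE; rewrite IE// cproductE//.
  apply: (cfunctional_eq_bclosure cI (iter_functional nu1 nu2) _
    (torus2_bclosure (cind_bfun R mE))) => h [u [v hE]].
  split; first by apply: characters2_bfun; exists u, v.
  rewrite hE (iter_chars _ _ nu1f nu2g) fg' -fg I_char.
  by congr (a _ * b _); ring.
have [[[u0 v0] /eqP K0]|nfg] := pselect (exists p, f p.1 * g p.2 <> 0); last first.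
  exists (cmzero T R), (cmzero T R).
  apply: (suf _ _ _ _ has_ft_cmzero has_ft_cmzero) => u v.
  rewrite mul0r; apply: esym; apply: contrapT => fg0; apply: nfg.
  by exists (u, v).
rewrite /= in K0; set K := f u0 * g v0 in K0.
have b1 : bfun (fun p : T * T => K^-1 * char (- v0) p.2).
  by apply: bfunZ; exact: (bfun_comp measurable_snd (char_bfun (- v0))).
have b2 : bfun (fun p : T * T => char (- u0) p.1).
  exact: (bfun_comp measurable_fst (char_bfun (- u0))).
have ft1 : has_ft (fun A => I (fun p => K^-1 * char (- v0) p.2 * cind R A p.1))
    (fun u => K^-1 * (f u * g v0)).
  exists (fun h => I (fun p => K^-1 * char (- v0) p.2 * h p.1)).
    apply: (cfunctional_comp (h := @fst T T) _ (cfunctional_density cI b1)).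
    by move=> h; exact: bfun_comp measurable_fst.
  split => // u; rewrite -fg -I_charN -(cfunctionalZ cI).
    by congr I; apply/funext => p; rewrite -mulrA [char _ p.2 * _]mulrC.
  by apply: characters2_bfun; exists (- u), (- v0).
have ft2 : has_ft (fun A => I (fun p => char (- u0) p.1 * cind R A p.2))
    (fun v => f u0 * g v).
  exists (fun h => I (fun p => char (- u0) p.1 * h p.2)).
    apply: (cfunctional_comp (h := @snd T T) _ (cfunctional_density cI b2)).
    by move=> h; exact: bfun_comp measurable_snd.
  by split => // v; rewrite -fg -I_charN.
have [nu1 nu1E] := has_ft_cmeasure ft1; have [nu2 nu2E] := has_ft_cmeasure ft2.
exists nu1, nu2; apply: (suf _ _ (fun u => K^-1 * (f u * g v0))
  (fun v => f u0 * g v)).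
- by apply: has_ft_eqm ft1 => A mA; rewrite nu1E.
- by apply: has_ft_eqm ft2 => A mA; rewrite nu2E.
- move=> u v; apply: (mulfI K0); rewrite [K * (_ * _)]mulrA mulVKf// /K; ring.
Qed.

End torus_square.

(** * Supports of the solutions of a(u + v) b(u - v) = f(u) g(v) *)

(** What the functional equation leaves to the supports P of a and Q of b: the
    set of (u, v) with f(u) g(v) nonzero is a product set. *)
Definition rectangular (P Q : int -> bool) := forall u v u' v',
  P (u + v) -> Q (u - v) -> P (u' + v') -> Q (u' - v') ->
  P (u + v') /\ Q (u - v').

Lemma rectangularC P Q : rectangular P Q -> rectangular Q P.
Proof.
move=> PQ u v u' v' Qu Pu Qu' Pu'.
have := PQ u (- v) u' (- v'); rewrite !opprK.
by move=> /(_ Pu Qu Pu' Qu')[].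
Qed.

Lemma rectangular_swap P Q m n m' n' r s : rectangular P Q ->
  P m -> Q n -> P m' -> Q n' ->
  (2 %| m + n)%Z -> (2 %| m' + n')%Z ->
  2 * r = m + n + m' - n' -> 2 * s = m + n - m' + n' -> P r /\ Q s.
Proof.
move=> PQ Pm Qn Pm' Qn' mn mn' rE sE.
have [u uE] : exists u : int, 2 * u = m + n by exists ((m + n) %/ 2)%Z; lia.
have [u' u'E] : exists u : int, 2 * u = m' + n' by exists ((m' + n') %/ 2)%Z; lia.
have := PQ u (m - u) u' (m' - u').
have -> : u + (m - u) = m by lia.
have -> : u - (m - u) = n by lia.
have -> : u' + (m' - u') = m' by lia.
have -> : u' - (m' - u') = n' by lia.
have -> : u + (m' - u') = r by lia.
have -> : u - (m' - u') = s by lia.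
exact.
Qed.

(** Pairing m with both n and n + 2d and exchanging the coordinates v of the
    two pairs averages the frequencies on one side and spreads them on the
    other. *)
Lemma rectangular_mid P Q m n d : rectangular P Q ->
  (2 %| m + n)%Z -> P m -> Q n -> Q (n + 2 * d) ->
  [/\ Q (n + d), P (m - d) & P (m + d)].
Proof.
move=> PQ mn Pm Qn Qn'; split.
- by have [] := @rectangular_swap P Q m n m (n + 2 * d) (m - d) (n + d) PQ;
    try by []; lia.
- by have [] := @rectangular_swap P Q m n m (n + 2 * d) (m - d) (n + d) PQ;
    try by []; lia.
- by have [] := @rectangular_swap P Q m (n + 2 * d) m n (m + d) (n + d) PQ;
    try by []; lia.
Qed.

Lemma strong_int_ind (P : int -> Prop) :
  (forall n, (forall m, (`|m| < `|n|)%N -> P m) -> P n) -> forall n, P n.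
Proof.
move=> H n; have [k] := ubnP `|n|%N; elim: k n => // k IHk n nk.
by apply: H => m mn; apply: IHk; lia.
Qed.

(** If there are points of P and Q of the same parity in one parity class only,
    two points of Q in that class could be brought closer together by halving
    their distance again and again. *)
Lemma rectangular_single P Q m n : rectangular P Q ->
  (2 %| m + n)%Z -> P m -> Q n ->
  (forall m' n', ~~ (2 %| m' + m)%Z -> ~~ (2 %| n' + n)%Z -> P m' -> ~~ Q n') ->
  forall n', (2 %| n' + n)%Z -> Q n' -> n' = n.
Proof.
move=> PQ mn Pm Qn other.
have key : forall d, Q (n + 2 * d) -> d = 0.
  elim/strong_int_ind => d IHd Qd.
  have [Qh _ Ph] := rectangular_mid PQ mn Pm Qn Qd.
  have [d_odd|d_even] := boolP (2 %| d)%Z.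
    have dE : d = 2 * (d %/ 2)%Z by lia.
    have [->//|d0] := eqVneq d 0.
    rewrite [in n + d]dE in Qh; have := IHd (d %/ 2)%Z _ Qh; lia.
  have := other (m + d) (n + d) _ _ Ph; rewrite Qh.
  by move=> H; exfalso; have : false by apply: H; lia.
move=> n' nn' Qn'; have n'E : n' = n + 2 * ((n' - n) %/ 2)%Z by lia.
by rewrite n'E in Qn' *; rewrite (key _ Qn'); lia.
Qed.

(** As long as j exceeds w + 2, it can be replaced by its midpoint with
    whichever of w and w + 1 has the parity of j: that midpoint lies in Q and
    is still at least w + 2. *)
Lemma rectangular_up P Q w j : rectangular P Q ->
  (forall n, exists2 m, P m & (2 %| m + n)%Z) ->
  Q w -> Q (w + 1) -> Q j -> w + 1 < j -> Q (w + 2).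
Proof.
move=> PQ Pboth Qw Qw1.
suff key : forall d, 0 <= d -> Q (w + 2 + d) -> Q (w + 2).
  move=> Qj wj; apply: (key (j - w - 2)); first lia.
  by have -> : w + 2 + (j - w - 2) = j by lia.
elim/strong_int_ind => d IHd d0 Qd.
have [d00|d1] := eqVneq d 0; first by rewrite d00 addr0 in Qd.
have [c [Qc cw cE]] : exists c, [/\ Q c, w <= c <= w + 1 & (2 %| c + (w + d))%Z].
  have [?|?] := boolP (2 %| d)%Z; [exists w|exists (w + 1)];
  by split => //; lia.
have [m Pm mc] := Pboth c.
have cE' : w + 2 + d = c + 2 * ((w + 2 + d - c) %/ 2)%Z by lia.
rewrite cE' in Qd; have [Qh _ _] := rectangular_mid PQ mc Pm Qc Qd.
apply: (IHd (c - w - 2 + ((w + 2 + d - c) %/ 2)%Z)); [lia|lia|].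
by rewrite (_ : w + 2 + _ = c + ((w + 2 + d - c) %/ 2)%Z)//; lia.
Qed.

Lemma rectangularN P Q : rectangular P Q ->
  rectangular (fun m => P (- m)) (fun n => Q (- n)).
Proof.
move=> PQ u v u' v' h1 h2 h3 h4; have := PQ (- u) (- v) (- u') (- v').
have subN x y : - x - - y = - (x - y) :> int by ring.
by rewrite !subN -!opprD; exact.
Qed.

Lemma rectangular_down P Q w j : rectangular P Q ->
  (forall n, exists2 m, P m & (2 %| m + n)%Z) ->
  Q w -> Q (w + 1) -> Q j -> j < w -> Q (w - 1).
Proof.
move=> PQ Pboth Qw Qw1 Qj jw.
have := @rectangular_up _ _ (- (w + 1)) (- j) (rectangularN PQ); rewrite !opprK.
have -> : - (- (w + 1) + 1) = w by lia.
have -> : - (- (w + 1) + 2) = w - 1 by lia.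
apply => //; last by lia.
move=> n; have [m Pm mn] := Pboth (- n); exists (- m); first by rewrite opprK.
lia.
Qed.

(** A point n + d of Q moves to its midpoint with n or with n + k, whichever is
    at even distance; the minimality of k makes the displacement decrease. *)
Lemma rectangular_progression P Q n k : rectangular P Q ->
  (forall n, exists2 m, P m & (2 %| m + n)%Z) ->
  0 < k -> ~~ (2 %| k)%Z -> Q n -> Q (n + k) ->
  (forall x y, Q x -> Q y -> x < y -> k <= y - x) ->
  forall j, Q j -> (k %| j - n)%Z.
Proof.
move=> PQ Pboth k0 k_odd Qn Qnk kmin.
have halve c d : Q c -> Q (c + 2 * d) -> Q (c + d).
  move=> Qc Qd; have [m Pm mc] := Pboth c.
  by have [] := rectangular_mid PQ mc Pm Qc Qd.
suff key : forall d, Q (n + d) -> (k %| d)%Z.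
  by move=> j Qj; apply: key; rewrite addrC subrK.
elim/strong_int_ind => d IHd Qd.
have [d2|d2] := boolP (2 %| d)%Z.
  have [->|d0] := eqVneq d 0; first by rewrite dvdz0.
  have dE : d = 2 * (d %/ 2)%Z by lia.
  rewrite dE dvdz_mull//; apply: IHd; first lia.
  by apply: halve => //; rewrite -dE.
have [->|dk] := eqVneq d k; first exact: dvdzz.
have [dn|dn] := ltP d 0.
  (* - d >= k as k is the least distance, so (d + k) / 2 is closer to 0 than d *)
  have eE : d - k = 2 * ((d - k) %/ 2)%Z by lia.
  have ddk : - d >= k.
    have := kmin (n + d) n Qd Qn; lia.
  have : (k %| (d + k) %/ 2)%Z.
    apply: IHd; first lia.
    rewrite (_ : n + _ = n + k + ((d - k) %/ 2)%Z); last by lia.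
    by apply: halve => //; rewrite -eE; have -> : n + k + (d - k) = n + d by lia.
  move=> h; have -> : d = 2 * ((d + k) %/ 2)%Z - k by lia.
  by rewrite rpredB ?dvdzz//= dvdz_mull.
have dk' : k < d by have := kmin n (n + d) Qn Qd; lia.
have eE : d - k = 2 * ((d - k) %/ 2)%Z by lia.
have : (k %| (d + k) %/ 2)%Z.
  apply: IHd; first lia.
  rewrite (_ : n + _ = n + k + ((d - k) %/ 2)%Z); last by lia.
  by apply: halve => //; rewrite -eE; have -> : n + k + (d - k) = n + d by lia.
move=> h; have -> : d = 2 * ((d + k) %/ 2)%Z - k by lia.
by rewrite rpredB ?dvdzz//= dvdz_mull.
Qed.

(** The gap is minimized over both supports at once, so that the same k serves
    for P and Q. *)
Lemma ex_min_gap (P Q : int -> bool) :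
  (forall n, exists2 m, Q m & (2 %| m + n)%Z) -> exists2 k : int, 0 < k &
  ((exists n, Q n /\ Q (n + k)) \/ (exists m, P m /\ P (m + k))) /\
  (forall x y, x < y -> (Q x /\ Q y) \/ (P x /\ P y) -> k <= y - x).
Proof.
move=> Qboth; pose gap (d : nat) := `[< (0 < d)%N /\ ((exists n, Q n /\ Q (n + d%:Z)) \/
  (exists m, P m /\ P (m + d%:Z))) >].
have gapI x y : x < y -> (Q x /\ Q y) \/ (P x /\ P y) -> gap `|y - x|%N.
  move=> xy H; apply/asboolP; split; first lia.
  have yE : x + `|y - x|%N%:Z = y by lia.
  by case: H => [H|H]; [left|right]; exists x; rewrite yE.
have exgap : exists d, gap d.
  have [x Qx x0] := Qboth 0; have [y Qy y1] := Qboth 1.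
  have [xy|yx] := ltP x y.
    by exists `|y - x|%N; apply: gapI => //; left.
  by exists `|x - y|%N; apply: gapI; [lia|left].
case: (ex_minnP exgap) => d /asboolP[d0 dex] dmin.
exists d%:Z; first lia; split => // x y xy H.
have := dmin _ (gapI x y xy H); lia.
Qed.

(** Pair n with m and n + k with m', then exchange the coordinates v, taking
    the two pairs in either order: the two points of P so obtained differ
    by k. *)
Lemma rectangular_gap P Q n k : rectangular P Q ->
  (forall n, exists2 m, P m & (2 %| m + n)%Z) -> ~~ (2 %| k)%Z -> Q n -> Q (n + k) ->
  exists m, P m /\ P (m + k).
Proof.
move=> PQ Pboth k_odd Qn Qnk.
have [m Pm mn] := Pboth n; have [m' Pm' mn'] := Pboth (n + k).
exists ((m + m' - k) %/ 2)%Z; split.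
  by have [] := @rectangular_swap P Q m n m' (n + k) ((m + m' - k) %/ 2)%Z
    ((m + n - m' + n + k) %/ 2)%Z PQ; try by []; lia.
by have [] := @rectangular_swap P Q m' (n + k) m n (((m + m' - k) %/ 2)%Z + k)
    ((m' + (n + k) - m + n) %/ 2)%Z PQ; try by []; lia.
Qed.

(** The midpoint of an even gap would belong to Q and make a smaller gap. *)
Lemma rectangular_gap_odd P Q n k : rectangular P Q ->
  (forall n, exists2 m, P m & (2 %| m + n)%Z) -> 0 < k ->
  Q n -> Q (n + k) -> (forall x y, x < y -> Q x -> Q y -> k <= y - x) ->
  ~~ (2 %| k)%Z.
Proof.
move=> PQ Pboth k0 Qn Qnk kmin; apply/negP => k2.
have kE : k = 2 * (k %/ 2)%Z by lia.
have [m Pm mn] := Pboth n; rewrite kE in Qnk.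
have [Qh _ _] := rectangular_mid PQ mn Pm Qn Qnk.
have := kmin n (n + (k %/ 2)%Z) _ Qn Qh; lia.
Qed.

(** The least gap in either support is odd, it occurs in both supports, and
    each support is then a subset of a progression with that step. *)
Lemma rectangular_step P Q : rectangular P Q ->
  (forall n, exists2 m, P m & (2 %| m + n)%Z) ->
  (forall n, exists2 m, Q m & (2 %| m + n)%Z) ->
  exists k m n, [/\ 0 < k, ~~ (2 %| k)%Z, P m /\ P (m + k), Q n /\ Q (n + k) &
    (forall j, P j -> (k %| j - m)%Z) /\ (forall j, Q j -> (k %| j - n)%Z)].
Proof.
move=> PQ Pboth Qboth; have QP := rectangularC PQ.
have [k k0 [kex kmin]] := ex_min_gap P Qboth.
have kminQ x y : x < y -> Q x -> Q y -> k <= y - x.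
  by move=> xy Qx Qy; apply: kmin => //; left.
have kminP x y : x < y -> P x -> P y -> k <= y - x.
  by move=> xy Qx Qy; apply: kmin => //; right.
have [k_odd [m [Pm Pmk]] [n [Qn Qnk]]] : [/\ ~~ (2 %| k)%Z,
    exists m, P m /\ P (m + k) & exists n, Q n /\ Q (n + k)].
  case: kex => [[n [Qn Qnk]]|[m [Pm Pmk]]].
    have k_odd := rectangular_gap_odd PQ Pboth k0 Qn Qnk kminQ.
    split => //; last by exists n.
    exact: (rectangular_gap PQ Pboth k_odd Qn Qnk).
  have k_odd := rectangular_gap_odd QP Qboth k0 Pm Pmk kminP.
  split => //; first by exists m.
  exact: (rectangular_gap QP Qboth k_odd Pm Pmk).
exists k, m, n; split => //; split.
  by apply: (rectangular_progression QP) => // x y Px Py xy; exact: kminP.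
by apply: (rectangular_progression PQ) => // x y Px Py xy; exact: kminQ.
Qed.

Lemma rectangular_narrow P Q j e : rectangular P Q ->
  (forall n, exists2 m, P m & (2 %| m + n)%Z) ->
  Q j -> Q (j + 1) -> Q (j + 2) -> (2 %| j + e)%Z ->
  ~ (exists i, [/\ Q i, Q (i + 2) & (2 %| i + (e + 1))%Z]) ->
  forall i, Q i -> [\/ i = j + 1 - 1, i = j + 1 | i = j + 1 + 1].
Proof.
move=> PQ Pboth Q0 Q1 Q2 je nE i Qi.
have [ij|ij] := ltP (j + 2) i.
  case: nE; exists (j + 1); split => //; last lia.
  have Q2' : Q (j + 1 + 1) by have -> : j + 1 + 1 = j + 2 by lia.
  by apply: (rectangular_up PQ Pboth Q1 Q2' Qi); lia.
have [ij'|ij'] := ltP i j.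
  case: nE; exists (j - 1); split; last lia.
    exact: (rectangular_down PQ Pboth Q0 Q1 Qi).
  by have -> : j - 1 + 2 = j + 1 by lia.
have [h|[h|h]] : i = j + 1 - 1 \/ (i = j + 1 \/ i = j + 1 + 1) by lia.
- by constructor 1.
- by constructor 2.
- by constructor 3.
Qed.

Lemma rectangular_pair P Q y : rectangular P Q ->
  (forall n, exists2 m, P m & (2 %| m + n)%Z) ->
  Q y -> Q (y + 1) ->
  (forall e, ~ exists i, [/\ Q i, Q (i + 2) & (2 %| i + e)%Z]) ->
  forall i, Q i -> i = y \/ i = y + 1.
Proof.
move=> PQ Pboth Q0 Q1 nE i Qi.
have [ij|ij] := ltP (y + 1) i.
  case: (nE y); exists y; split => //; last lia.
  exact: (rectangular_up PQ Pboth Q0 Q1 Qi).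
have [ij'|ij'] := ltP i y; last lia.
case: (nE (y + 1)); exists (y - 1); split; last lia.
  exact: (rectangular_down PQ Pboth Q0 Q1 Qi).
by have -> : y - 1 + 2 = y + 1 by lia.
Qed.

Lemma all_of_steps (P : int -> bool) x : P x ->
  (forall i, P i -> P (i - 1) /\ P (i + 1)) -> forall i, P i.
Proof.
move=> Px step i.
have up (n : nat) : P (x + n%:Z).
  elim: n => [|n IHn]; first by rewrite addr0.
  by have := (step _ IHn).2; rewrite -addrA; congr P; lia.
have down (n : nat) : P (x - n%:Z).
  elim: n => [|n IHn]; first by rewrite subr0.
  by have := (step _ IHn).1; rewrite -addrA; congr P; lia.
have [xi|xi] := leP x i.
  by have := up `|i - x|%N; congr P; lia.
by have := down `|i - x|%N; congr P; lia.
Qed.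

(** Once two points at distance 2 of both parities occur, each support is
    invariant under unit steps; otherwise the supports have at most three
    points. *)
Lemma rectangular_consecutive P Q x y : rectangular P Q ->
  P x -> P (x + 1) -> Q y -> Q (y + 1) ->
  ((forall i, P i) /\ (forall j, Q j)) \/
  exists a b, [/\ ~~ (2 %| a + b)%Z,
    forall i, P i -> [\/ i = a - 1, i = a | i = a + 1] &
    forall j, Q j -> [\/ j = b - 1, j = b | j = b + 1]].
Proof.
move=> PQ P0 P1 Q0 Q1; have QP := rectangularC PQ.
have Pboth n : exists2 m, P m & (2 %| m + n)%Z.
  have [?|?] := boolP (2 %| x + n)%Z; first by exists x.
  by exists (x + 1) => //; lia.
have Qboth n : exists2 m, Q m & (2 %| m + n)%Z.
  have [?|?] := boolP (2 %| y + n)%Z; first by exists y.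
  by exists (y + 1) => //; lia.
pose E (S : int -> bool) e := exists i, [/\ S i, S (i + 2) & (2 %| i + e)%Z].
have step S S' e : rectangular S' S -> E S e ->
    forall i, (2 %| i + e)%Z -> S' i -> S' (i - 1) /\ S' (i + 1).
  move=> SS [j [Sj Sj2 je]] i ie Si.
  have ij : (2 %| i + j)%Z by lia.
  by have [] := @rectangular_mid _ _ i j 1 SS ij Si Sj Sj2.
have EE S S' e : rectangular S' S ->
    (forall n, exists2 m, S' m & (2 %| m + n)%Z) -> E S e -> E S' (e + 1).
  move=> SS both ES; have [i Si ie] := both e.
  have [Sm Sp] := step _ _ _ SS ES i ie Si.
  exists (i - 1); split => //; last lia.
  by have -> : i - 1 + 2 = i + 1 by lia.
have Eshift S e e' : (2 %| e - e')%Z -> E S e -> E S e'.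
  by move=> ee [i [? ? ?]]; exists i; split => //; lia.
have narrow S S' e : rectangular S' S -> rectangular S S' ->
    (forall n, exists2 m, S' m & (2 %| m + n)%Z) ->
    E S e -> ~ E S (e + 1) ->
    exists2 b, ~~ (2 %| b + e)%Z &
      forall j, S j -> [\/ j = b - 1, j = b | j = b + 1].
  move=> SS SS' both [j [Sj Sj2 je]] nE; exists (j + 1); first lia.
  have [m Sm mj] := both j.
  have Sj1 := (rectangular_mid SS mj Sm Sj (d := 1) Sj2).
  by apply: (rectangular_narrow SS both Sj _ Sj2 je nE); case: Sj1.
have one e : E Q e -> ~ E Q (e + 1) -> exists a b, [/\ ~~ (2 %| a + b)%Z,
    forall i, P i -> [\/ i = a - 1, i = a | i = a + 1] &
    forall j, Q j -> [\/ j = b - 1, j = b | j = b + 1]].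
  move=> EQ nEQ; have [b be Qb] := narrow _ _ _ PQ QP Pboth EQ nEQ.
  have EP := EE _ _ _ PQ Pboth EQ.
  have nEP : ~ E P (e + 1 + 1).
    move=> EP'; apply: nEQ; apply: Eshift (EE _ _ _ QP Qboth EP'); lia.
  have [a ae Pa] := narrow _ _ _ QP PQ Qboth EP nEP.
  by exists a, b; split => //; lia.
have [E0|nE0] := pselect (E Q 0); have [E1|nE1] := pselect (E Q 1).
- left; split.
    apply: (all_of_steps P0) => i Pi.
    have [i2|i2] := boolP (2 %| i + 0)%Z.
      exact: (step _ _ _ PQ E0 i i2 Pi).
    have i2' : (2 %| i + 1)%Z by lia.
    exact: (step _ _ _ PQ E1 i i2' Pi).
  apply: (all_of_steps Q0) => i Qi.
  have [i2|i2] := boolP (2 %| i + (0 + 1))%Z.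
    exact: (step _ _ _ QP (EE _ _ _ PQ Pboth E0) i i2 Qi).
  have i2' : (2 %| i + (1 + 1))%Z by lia.
  exact: (step _ _ _ QP (EE _ _ _ PQ Pboth E1) i i2' Qi).
- by right; apply: (one 0 E0); rewrite add0r.
- right; apply: (one 1 E1) => E0; apply: nE0; apply: Eshift E0; lia.
- right; have nEQ e : ~ E Q e.
    move=> Ee; have [e2|e2] := boolP (2 %| e)%Z.
      by apply: nE0; apply: Eshift Ee; lia.
    by apply: nE1; apply: Eshift Ee; lia.
  have nEP e : ~ E P e.
    by move=> Ee; apply: (nEQ (e + 1)); exact: (EE _ _ _ QP Qboth Ee).
  have Qpair := rectangular_pair PQ Pboth Q0 Q1 nEQ.
  have Ppair := rectangular_pair QP Qboth P0 P1 nEP.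
  have [xy|xy] := boolP (2 %| x + y)%Z.
    exists x, (y + 1); split; first lia.
      move=> i /Ppair[->|->]; [by constructor 2|by constructor 3].
    move=> i /Qpair[->|->]; [constructor 1; lia|by constructor 2].
  exists x, y; split => //.
    by move=> i /Ppair[->|->]; [constructor 2|constructor 3].
  by move=> i /Qpair[->|->]; [constructor 2|constructor 3].
Qed.

(** * The functional equation a(u + v) b(u - v) = f(u) g(v) *)

Section functional_equation.
Variable K : fieldType.
Implicit Types (a b : int -> K).

Definition separable a b :=
  exists f g : int -> K, forall u v, a (u + v) * b (u - v) = f u * g v.

Lemma separable_cross a b u v u' v' : separable a b ->
  (a (u + v) * b (u - v)) * (a (u' + v') * b (u' - v')) =
  (a (u + v') * b (u - v')) * (a (u' + v) * b (u' - v)).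
Proof. by move=> [f [g fg]]; rewrite !fg; ring. Qed.

Lemma separable_rectangular a b : separable a b ->
  rectangular (fun n => a n != 0) (fun n => b n != 0).
Proof.
move=> ab u v u' v' a1 b1 a2 b2.
have /eqP : (a (u + v) * b (u - v)) * (a (u' + v') * b (u' - v')) != 0.
  by rewrite !mulf_neq0.
rewrite (separable_cross _ _ _ _ ab) => /eqP.
by rewrite !mulf_eq0 !negb_or => /andP[/andP[]].
Qed.

Lemma separable_comp a b m n k : separable a b -> (2 %| m + n)%Z ->
  separable (fun i => a (m + k * i)) (fun j => b (n + k * j)).
Proof.
move=> [f [g fg]] mn; have nE : n = m + 2 * ((n - m) %/ 2)%Z by lia.
set h := ((n - m) %/ 2)%Z in nE.
exists (fun u => f (m + h + k * u)), (fun v => g (k * v - h)) => u v.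
by rewrite -fg; congr (a _ * b _); rewrite ?nE; ring.
Qed.

(** Of the pairs formed from m, m - k, m + k and n, n - k, n + k, the four with
    an even sum are a two by two minor of a(u + v) b(u - v). *)
Lemma separable_three a b m n k : separable a b ->
  ~~ (2 %| k)%Z -> ~~ (2 %| m + n)%Z ->
  a m ^+ 2 * b (n - k) * b (n + k) = b n ^+ 2 * a (m - k) * a (m + k).
Proof.
move=> ab k_odd mn; pose h := ((m + n + k) %/ 2)%Z.
have hE : 2 * h = m + n + k by rewrite /h; lia.
have := separable_cross h (m - h) (h - k) (m - h + k) ab.
have -> : h + (m - h) = m by ring.
have -> : h - (m - h) = n + k by lia.
have -> : h - k + (m - h + k) = m by ring.
have -> : h - k - (m - h + k) = n - k by lia.
have -> : h + (m - h + k) = m + k by ring.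
have -> : h - (m - h + k) = n by lia.
have -> : h - k + (m - h) = m - k by ring.
have -> : h - k - (m - h) = n by lia.
move=> H; transitivity (a m * b (n + k) * (a m * b (n - k))); first by ring.
by rewrite H; ring.
Qed.

(** The possible supports. In the first six shapes the products
    a(u + v) b(u - v) vanish except possibly at one point; the last one reduces
    to sequences without zeros. *)
Variant separable_spec a b : Prop :=
  | SepZero1 of (forall n, a n = 0)
  | SepZero2 of (forall n, b n = 0)
  | SepPoint1 m n of (2 %| m + n)%Z & (forall i, i != m -> a i = 0) &
      (forall j, j != n -> (2 %| j + n)%Z -> b j = 0)
  | SepPoint2 m n of (2 %| m + n)%Z &
      (forall i, i != m -> (2 %| i + m)%Z -> a i = 0) &
      (forall j, j != n -> b j = 0)
  | SepEven of (forall n, ~~ (2 %| n)%Z -> a n = 0) &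
      (forall n, (2 %| n)%Z -> b n = 0)
  | SepOdd of (forall n, (2 %| n)%Z -> a n = 0) &
      (forall n, ~~ (2 %| n)%Z -> b n = 0)
  | SepThree m n k of ~~ (2 %| k)%Z & ~~ (2 %| m + n)%Z &
      a m ^+ 2 * b (n - k) * b (n + k) = b n ^+ 2 * a (m - k) * a (m + k) &
      (forall i, i != m - k -> i != m -> i != m + k -> a i = 0) &
      (forall j, j != n - k -> j != n -> j != n + k -> b j = 0)
  | SepProgression m n k of 0 < k & ~~ (2 %| k)%Z & (2 %| m + n)%Z &
      (forall i, ~~ (k %| i - m)%Z -> a i = 0) &
      (forall j, ~~ (k %| j - n)%Z -> b j = 0) &
      (forall i, a (m + k * i) != 0) & (forall j, b (n + k * j) != 0).

Lemma separable_both a b : separable a b ->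
  (forall n, exists2 m, a m != 0 & (2 %| m + n)%Z) ->
  (forall n, exists2 m, b m != 0 & (2 %| m + n)%Z) -> separable_spec a b.
Proof.
move=> ab aboth bboth; have R := separable_rectangular ab.
have [k [m [n [k0 k_odd [am amk] [bn bnk] [adiv bdiv]]]]] :=
  rectangular_step R aboth bboth.
have azero i : ~~ (k %| i - m)%Z -> a i = 0.
  by move=> ki; apply/eqP; apply: contraNT ki; exact: adiv.
have bzero j : ~~ (k %| j - n)%Z -> b j = 0.
  by move=> kj; apply/eqP; apply: contraNT kj; exact: bdiv.
have {bzero} [n' [nn' mn [y [by0 by1]]]] : exists n', [/\ forall j,
    ~~ (k %| j - n')%Z -> b j = 0, (2 %| m + n')%Z &
    exists y, b (n' + k * y) != 0 /\ b (n' + k * (y + 1)) != 0].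
  have [mn|mn] := boolP (2 %| m + n)%Z.
    by exists n; split => //; exists 0; rewrite mulr0 add0r mulr1 addr0.
  exists (n + k); split; last first.
  - exists (-1); split.
      by rewrite mulrN1 addrK.
    by rewrite addNr mulr0 addr0.
  - lia.
  - move=> j kj; apply: bzero; apply: contraNN kj => kj.
    by rewrite opprD addrA rpredB//; exact: dvdzz.
have S := separable_comp k ab mn.
have a0 : a (m + k * 0) != 0 by rewrite mulr0 addr0.
have a1 : a (m + k * (0 + 1)) != 0 by rewrite add0r mulr1.
have [[ap bp]|[x [z [xz ax bz]]]] :=
    rectangular_consecutive (separable_rectangular S) a0 a1 by0 by1.
  exact: (SepProgression k0 k_odd mn azero nn').
pose m1 := m + k * x; pose n1 := n' + k * z.
have mn1 : ~~ (2 %| m1 + n1)%Z.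
  have -> : m1 + n1 = m + n' + k * (x + z) by rewrite /m1 /n1; ring.
  move: (x + z) (m + n') xz mn => s t s_odd t_even; clear - k_odd s_odd t_even.
  have -> : s = 2 * (s %/ 2)%Z + 1 by lia.
  have -> : k * (2 * (s %/ 2)%Z + 1) = 2 * (k * (s %/ 2)%Z) + k by ring.
  by move: (k * _); lia.
apply: (SepThree k_odd mn1 (separable_three ab k_odd mn1)).
  move=> i i1 i2 i3; have [ki|/azero//] := boolP (k %| i - m)%Z.
  apply/eqP; apply/negPn; apply/negP => ai.
  have iE : i = m + k * ((i - m) %/ k)%Z.
    by rewrite [k * _]mulrC divzK// addrC subrK.
  move: ai; rewrite iE => /ax[h|h|h]; rewrite h in iE.
  - by case/eqP: i1; rewrite iE /m1; ring.
  - by case/eqP: i2; rewrite iE /m1; ring.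
  - by case/eqP: i3; rewrite iE /m1; ring.
move=> i i1 i2 i3; have [ki|/nn'//] := boolP (k %| i - n')%Z.
apply/eqP; apply/negPn; apply/negP => ai.
have iE : i = n' + k * ((i - n') %/ k)%Z.
  by rewrite [k * _]mulrC divzK// addrC subrK.
move: ai; rewrite iE => /bz[h|h|h]; rewrite h in iE.
- by case/eqP: i1; rewrite iE /n1; ring.
- by case/eqP: i2; rewrite iE /n1; ring.
- by case/eqP: i3; rewrite iE /n1; ring.
Qed.

(** When only one parity class contributes, each support has a single point in
    it, and one of the supports has no other point. *)
Lemma separable_one_class a b m n : separable a b -> (2 %| m + n)%Z ->
  a m != 0 -> b n != 0 ->
  (forall i, ~~ (2 %| i + m)%Z -> a i = 0) \/
  (forall j, ~~ (2 %| j + n)%Z -> b j = 0) -> separable_spec a b.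
Proof.
move=> ab mn am bn H; have R := separable_rectangular ab.
have Pn i : (2 %| i + m)%Z -> a i != 0 -> i = m.
  move=> im ai; apply: (rectangular_single (rectangularC R) _ bn am) => //.
    by rewrite addrC.
  move=> j' i' jn im' bj; case: H => [H|H]; first by rewrite H ?eqxx.
  by rewrite H ?eqxx in bj.
have Qn j : (2 %| j + n)%Z -> b j != 0 -> j = n.
  move=> jn bj; apply: (rectangular_single R mn am bn) => //.
  move=> i' j' im jn' ai; case: H => [H|H]; first by rewrite H ?eqxx in ai.
  by rewrite H ?eqxx.
case: H => H.
  apply: (SepPoint1 mn) => [i im|j jn j2].
    have [i2|/H//] := boolP (2 %| i + m)%Z.
    by apply/eqP; apply: contraNT im => /(Pn _ i2) ->.
  by apply/eqP; apply: contraNT jn => /(Qn _ j2) ->.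
apply: (SepPoint2 mn) => [i im i2|j jn].
  by apply/eqP; apply: contraNT im => /(Pn _ i2) ->.
have [j2|/H//] := boolP (2 %| j + n)%Z.
by apply/eqP; apply: contraNT jn => /(Qn _ j2) ->.
Qed.

Lemma separableP a b : separable a b -> separable_spec a b.
Proof.
move=> ab.
have cls (c : int -> K) (e : bool) : (exists2 m, c m != 0 & (2 %| m)%Z = e) \/
    (forall m, (2 %| m)%Z = e -> c m = 0).
  have [?|h] := pselect (exists2 m, c m != 0 & (2 %| m)%Z = e); first by left.
  right => m me; apply/eqP; apply: contrapT => /negP cm; apply: h.
  by exists m.
have [[m am m2]|a0] := cls a true; have [[n bn n2]|b0] := cls b true;
  have [[m' am' m2']|a1] := cls a false; have [[n' bn' n2']|b1] := cls b false.
- apply: separable_both => // i.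
    by have [?|?] := boolP (2 %| i)%Z; [exists m|exists m'] => //; lia.
  by have [?|?] := boolP (2 %| i)%Z; [exists n|exists n'] => //; lia.
- by apply: (separable_one_class ab _ am bn); [lia|
    right => j jn; apply: b1; lia].
- by apply: (separable_one_class ab _ am bn); [lia|
    left => j jn; apply: a1; lia].
- by apply: (separable_one_class ab _ am bn); [lia|
    left => j jn; apply: a1; lia].
- by apply: (separable_one_class ab _ am' bn'); [lia|
    right => j jn; apply: b0; lia].
- by apply: SepZero2 => j; have [?|/negbTE ?] := boolP (2 %| j)%Z;
    [exact: b0|exact: b1].
- by apply: SepEven => // j j2; [apply: a1; exact: negbTE].
- by apply: SepEven => // j j2; [apply: a1; exact: negbTE].
- by apply: (separable_one_class ab _ am' bn'); [lia|
    left => j jn; apply: a0; lia].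
- by apply: SepOdd => // j j2; [apply: b1; exact: negbTE].
- by apply: SepZero1 => j; have [?|/negbTE ?] := boolP (2 %| j)%Z;
    [exact: a0|exact: a1].
- by apply: SepZero1 => j; have [?|/negbTE ?] := boolP (2 %| j)%Z;
    [exact: a0|exact: a1].
- by apply: (separable_one_class ab _ am' bn'); [lia|
    left => j jn; apply: a0; lia].
- by apply: SepZero2 => j; have [?|/negbTE ?] := boolP (2 %| j)%Z;
    [exact: b0|exact: b1].
- by apply: SepZero1 => j; have [?|/negbTE ?] := boolP (2 %| j)%Z;
    [exact: a0|exact: a1].
- by apply: SepZero1 => j; have [?|/negbTE ?] := boolP (2 %| j)%Z;
    [exact: a0|exact: a1].
Qed.

(** Both sequences obey the same second order recurrence, which can be run in
    either direction. *)
Lemma second_difference_unique (p q t : int -> K) :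
  (forall i, p i != 0) -> (forall i, q i != 0) ->
  (forall i, p (i - 1) * p (i + 1) = p i ^+ 2 * t i) ->
  (forall i, q (i - 1) * q (i + 1) = q i ^+ 2 * t i) ->
  p 0 = q 0 -> p 1 = q 1 -> p =1 q.
Proof.
move=> p0 q0 pt qt e0 e1.
have up (n : nat) : p n%:Z = q n%:Z /\ p (n%:Z + 1) = q (n%:Z + 1).
  elim: n => [|n [h1 h2]]; first by rewrite add0r.
  have nE : n.+1%:Z = n%:Z + 1 by lia.
  rewrite nE; split => //; have := pt (n%:Z + 1); have := qt (n%:Z + 1).
  by rewrite addrK -h1 -h2 => <- /(mulfI (p0 _)).
have down (n : nat) : p (- n%:Z) = q (- n%:Z) /\ p (- n%:Z + 1) = q (- n%:Z + 1).
  elim: n => [|n [h1 h2]]; first by rewrite oppr0 add0r.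
  have nE : - n.+1%:Z = - n%:Z - 1 by lia.
  rewrite nE subrK; split => //; have := pt (- n%:Z); have := qt (- n%:Z).
  by rewrite -h1 -h2 => <- /(mulIf (p0 _)).
move=> i; have [i0|i0] := leP 0 i.
  by have [+ _] := up `|i|%N; congr (p _ = q _); lia.
by have [+ _] := down `|i|%N; congr (p _ = q _); lia.
Qed.

(** The cross identity at neighbouring frequencies equates the second
    logarithmic difference of p at i with that of q at j whenever i + j is
    odd. *)
Lemma separable_second_difference p q : separable p q ->
  (forall i, p i != 0) -> (forall i, q i != 0) ->
  exists r s, [/\ r != 0, s != 0,
    forall i, p (i - 1) * p (i + 1) = p i ^+ 2 * (if (2 %| i)%Z then s else r) &
    forall i, q (i - 1) * q (i + 1) = q i ^+ 2 * (if (2 %| i)%Z then r else s)].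
Proof.
move=> pq p0 q0.
pose P2 i := p (i - 1) * p (i + 1) / p i ^+ 2.
pose Q2 i := q (i - 1) * q (i + 1) / q i ^+ 2.
have P2E i : p (i - 1) * p (i + 1) = p i ^+ 2 * P2 i.
  by rewrite /P2 [RHS]mulrC divfK// expf_neq0.
have Q2E i : q (i - 1) * q (i + 1) = q i ^+ 2 * Q2 i.
  by rewrite /Q2 [RHS]mulrC divfK// expf_neq0.
have PQ i j : ~~ (2 %| i + j)%Z -> P2 i = Q2 j.
  move=> ij; pose u := ((i - 1 + j) %/ 2)%Z; pose v := i - 1 - u.
  have uE : 2 * u = i - 1 + j by rewrite /u; lia.
  have := separable_cross u v (u + 1) (v + 1) pq.
  have -> : u + v = i - 1 by rewrite /v; lia.
  have -> : u - v = j by rewrite /v; lia.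
  have -> : u + 1 + (v + 1) = i + 1 by rewrite /v; lia.
  have -> : u + 1 - (v + 1) = j by rewrite /v; lia.
  have -> : u + (v + 1) = i by rewrite /v; lia.
  have -> : u - (v + 1) = j - 1 by rewrite /v; lia.
  have -> : u + 1 + v = i by rewrite /v; lia.
  have -> : u + 1 - v = j + 1 by rewrite /v; lia.
  move=> H; rewrite /P2 /Q2.
  have pi := p0 i; have qj := q0 j.
  apply: (mulIf (expf_neq0 2 pi)); rewrite divfK ?expf_neq0//.
  apply: (mulIf (expf_neq0 2 qj)).
  transitivity (p (i - 1) * q j * (p (i + 1) * q j)); first by ring.
  by rewrite H; field.
have P2_0 i : P2 i != 0.
  by rewrite /P2 mulf_neq0 ?mulf_neq0// invr_neq0// expf_neq0.
exists (P2 1), (P2 0); split => // i.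
  rewrite P2E; congr (_ * _); case: ifPn => i2.
    by rewrite (PQ i 1) ?(PQ 0 1)//; lia.
  by rewrite (PQ i 0) ?(PQ 1 0)//; lia.
rewrite Q2E; congr (_ * _); case: ifPn => i2.
  by rewrite -(PQ 1 i)//; lia.
by rewrite -(PQ 0 i)//; lia.
Qed.

End functional_equation.

(** * Nowhere zero bounded solutions *)

Section exponential_solutions.
Variable R : realType.

Lemma cexp_surj (z : R[i]) : z != 0 -> exists w, cexp w = z.
Proof.
case: z => x y z0; set r := Num.sqrt (x ^+ 2 + y ^+ 2).
have s0 : 0 < x ^+ 2 + y ^+ 2.
  rewrite lt_neqAle addr_ge0 ?sqr_ge0// andbT eq_sym.
  by apply: contraNN z0; rewrite paddr_eq0 ?sqr_ge0// !sqrf_eq0 => /andP[/eqP->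
    /eqP->].
have r0 : 0 < r by rewrite sqrtr_gt0.
have rr : r ^+ 2 = x ^+ 2 + y ^+ 2 by rewrite sqr_sqrtr// ltW.
have [t [ct st]] : exists t, cos t = x / r /\ sin t = y / r.
  have xr : -1 <= x / r <= 1.
    rewrite -ler_norml normrM normfV [X in _ / X]gtr0_norm// ler_pdivrMr// mul1r.
    rewrite -(@ler_pXn2r _ 2)//; last by rewrite nnegrE ltW.
    by rewrite real_normK ?num_real// rr lerDl sqr_ge0.
  have sE : sin (acos (x / r)) = `|y / r|.
    rewrite sin_acos// -sqrtr_sqr; congr Num.sqrt.
    rewrite !expr_div_n -(divff (lt0r_neq0 (exprn_gt0 2 r0))) -mulrBl rr; congr (_ / _).
    ring.
  have [y0|y0] := leP 0 (y / r).
    by exists (acos (x / r)); rewrite acosK ?in_itv//= sE ger0_norm.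
  exists (- acos (x / r)); rewrite cosN sinN acosK ?in_itv//= sE ltr0_norm//.
  by rewrite opprK.
exists (ln r +i* t); rewrite /cexp /= lnK ?posrE// ct st.
by rewrite [r * (x / r)]mulrC [r * (y / r)]mulrC !divfK ?gt_eqF.
Qed.

Definition parity (i : int) : R[i] := if (2 %| i)%Z then 1 else -1.

Lemma cexp_second_difference (c2 c4 w l : R[i]) (i : int)
    (p := fun i : int => cexp (c4 + parity i * c2 + w * i%:~R ^+ 2 + l * i%:~R)) :
  p (i - 1) * p (i + 1) = p i ^+ 2 * cexp (2 * w - 4 * (parity i * c2)).
Proof.
have par (j : int) : ~~ (2 %| i + j)%Z -> parity j = - parity i.
  move=> ij; rewrite /parity; have [i2|i2] := boolP (2 %| i)%Z.
    by rewrite ifF//; lia.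
  by rewrite ifT ?opprK//; lia.
rewrite /p [X in _ = X * _]expr2 -!cexpD; congr cexp.
rewrite (par (i - 1)); last lia; rewrite (par (i + 1)); last lia.
by rewrite !intrD (_ : (-1)%:~R = -1)//; ring.
Qed.

(** The quadratic coefficient w and the parity coefficient c2 are fitted to the
    two values of the second difference, the remaining coefficients to the
    values at 0 and 1. *)
Lemma separable_exponential (p q : int -> R[i]) : separable p q ->
  (forall i, p i != 0) -> (forall i, q i != 0) ->
  exists c2 c4 c6 w l l',
    (forall i, p i = cexp (c4 + parity i * c2 + w * i%:~R ^+ 2 + l * i%:~R)) /\
    (forall i, q i = cexp (c6 - parity i * c2 + w * i%:~R ^+ 2 + l' * i%:~R)).
Proof.
move=> pq p0 q0; have [r [s [r0 s0 pE qE]]] := separable_second_difference pq p0 q0.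
have [L1 L1E] := cexp_surj s0; have [L2 L2E] := cexp_surj r0.
have [P0 P0E] := cexp_surj (p0 0); have [P1 P1E] := cexp_surj (p0 1).
have [Q0 Q0E] := cexp_surj (q0 0); have [Q1 Q1E] := cexp_surj (q0 1).
pose w := (L1 + L2) / 4; pose c2 := (L2 - L1) / 8.
have par0 : parity 0 = 1 by [].
have par1 : parity 1 = -1 by [].
exists c2, (P0 - c2), (Q0 + c2), w, (P1 - P0 + c2 + c2 - w), (Q1 - Q0 - c2 - c2 - w).
split.
  apply: (second_difference_unique p0 _ pE); first by move=> i; exact: cexp_neq0.
  - move=> i; rewrite cexp_second_difference /parity; congr (_ * _).
    by case: ifPn => _; rewrite -?L1E -?L2E; congr cexp; rewrite /w /c2; field.
  - by rewrite par0 -P0E; congr cexp; ring.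
  - by rewrite par1 -P1E; congr cexp; ring.
have qE' i : cexp (Q0 + c2 - parity i * c2 + w * i%:~R ^+ 2 +
    (Q1 - Q0 - c2 - c2 - w) * i%:~R) = cexp (Q0 + c2 + parity i * (- c2) +
    w * i%:~R ^+ 2 + (Q1 - Q0 - c2 - c2 - w) * i%:~R).
  by rewrite mulrN.
apply: (second_difference_unique q0 _ qE); first by move=> i; exact: cexp_neq0.
- move=> i; rewrite !qE' cexp_second_difference /parity; congr (_ * _).
  by case: ifPn => _; rewrite -?L1E -?L2E; congr cexp; rewrite /w /c2; field.
- by rewrite par0 -Q0E; congr cexp; ring.
- by rewrite par1 -Q1E; congr cexp; ring.
Qed.

Lemma bounded_quadratic (A B M : R) :
  (forall i : int, A * i%:~R ^+ 2 + B * i%:~R <= M) ->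
  A <= 0 /\ (A = 0 -> B = 0).
Proof.
move=> H.
have arch (x : R) : exists n : nat, x < n.+1%:R.
  exists (Num.bound `|x|); apply: (le_lt_trans (ler_norm x)).
  by apply: (lt_trans (archi_boundP (normr_ge0 x))); rewrite ltr_nat.
have A0 : A <= 0.
  rewrite leNgt; apply/negP => A0; have [n nM] := arch (M / A).
  have := H n.+1; have := H (- n.+1%:Z); rewrite mulrNz -!pmulrn sqrrN.
  rewrite ltr_pdivrMr// in nM.
  have : n.+1%:R * A <= A * n.+1%:R ^+ 2.
    by rewrite mulrC ler_pM2l// expr2 ler_peMl// ler1n.
  by rewrite mulrN; lra.
split => // A00; apply/eqP; rewrite eq_le !leNgt; apply/andP; split; apply/negP.
  move=> B0; have [n nM] := arch (M / B); rewrite ltr_pdivrMr// in nM.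
  by have := H n.+1; rewrite A00 mul0r add0r -pmulrn; lra.
move=> B0; have nB0 : 0 < - B by lra.
have [n nM] := arch (M / (- B)); rewrite ltr_pdivrMr// in nM.
by have := H (- n.+1%:Z); rewrite A00 mul0r add0r mulrNz -pmulrn; lra.
Qed.

Lemma bounded_exponential (c2 c4 w l : R[i]) (M : R) :
  (forall i, normc (cexp (c4 + parity i * c2 + w * i%:~R ^+ 2 + l * i%:~R)) <= M) ->
  complex.Re w <= 0 /\ (complex.Re w = 0 -> complex.Re l = 0).
Proof.
move=> H.
apply: (@bounded_quadratic _ _ (M + `|complex.Re c4| + `|complex.Re c2|)) => i.
have := H i; rewrite normc_cexp -(rmorph_int (real_complex R)) -rmorphXn.
have ReZ (z : R[i]) (x : R) : complex.Re (z * x%:C) = complex.Re z * x.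
  by rewrite cReM /= mulr0 subr0.
rewrite !cReD !ReZ.
have : - complex.Re (parity i * c2) <= `|complex.Re c2|.
  rewrite /parity; case: ifPn => _; rewrite ?mul1r ?mulN1r; last first.
    by rewrite raddfN opprK ler_norm.
  by rewrite -normrN ler_norm.
have : - complex.Re c4 <= `|complex.Re c4| by rewrite -normrN ler_norm.
set x := complex.Re c4 + _ + _ + _; have := expR_ge1Dx x; rewrite /x; lra.
Qed.

End exponential_solutions.

(** * Sufficiency of the support conditions *)

Section sufficiency.
Variable K : fieldType.
Implicit Types (a b : int -> K) (m n k : int).

Lemma separableC a b : separable a b -> separable b a.
Proof.
move=> [f [g fg]]; exists f, (fun v => g (- v)) => u v.
by rewrite -fg opprK mulrC.
Qed.

Lemma separable_zero a b : (forall u v, a (u + v) * b (u - v) = 0) ->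
  separable a b.
Proof.
by move=> ab0; exists (fun=> 0), (fun=> 0) => u v; rewrite ab0 mulr0.
Qed.

Lemma separable_parity a b : (forall n, ~~ (2 %| n)%Z -> a n = 0) ->
  (forall n, (2 %| n)%Z -> b n = 0) -> separable a b.
Proof.
move=> a0 b0; apply: separable_zero => u v.
have [uv|uv] := boolP (2 %| u - v)%Z; first by rewrite (b0 _ uv) mulr0.
by rewrite a0 ?mul0r//; lia.
Qed.

Lemma separable_point a b m n : (2 %| m + n)%Z ->
  (forall i, i != m -> a i = 0) ->
  (forall j, j != n -> (2 %| j + n)%Z -> b j = 0) -> separable a b.
Proof.
move=> mn a0 b0; exists (fun u => (2 * u == m + n)%:R * (a m * b n)).
exists (fun v => (2 * v == m - n)%:R) => u v.
have [uv|uv] := eqVneq (u + v) m; last first.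
  rewrite (a0 _ uv) mul0r; have [u2|_] := eqVneq (2 * u); last by rewrite !mul0r.
  by rewrite [2 * v == _](_ : _ = false) ?mulr0//; lia.
have [uv'|uv'] := eqVneq (u - v) n; last first.
  rewrite b0//; last lia.
  by rewrite mulr0 [2 * u == _](_ : _ = false) ?mul0r//; lia.
have -> : 2 * u = m + n by lia.
have -> : 2 * v = m - n by lia.
by rewrite uv uv' !eqxx mul1r mulr1.
Qed.

(** The row and the column through a nonzero entry of the matrix
    a(u + v) b(u - v) provide the factors. *)
Lemma cross_separable a b :
  (forall u v u' v', (a (u + v) * b (u - v)) * (a (u' + v') * b (u' - v')) =
    (a (u + v') * b (u - v')) * (a (u' + v) * b (u' - v))) -> separable a b.
Proof.
move=> cross.
have [[[u0 v0] /= /eqP X0]|X0] :=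
    pselect (exists p, a (p.1 + p.2) * b (p.1 - p.2) <> 0); last first.
  apply: separable_zero => u v; apply: contrapT => uv; apply: X0.
  by exists (u, v).
exists (fun u => a (u + v0) * b (u - v0)).
exists (fun v => a (u0 + v) * b (u0 - v) / (a (u0 + v0) * b (u0 - v0))) => u v.
by rewrite mulrA; apply: (mulIf X0); rewrite divfK// cross.
Qed.

(** The products a(u + v) b(u - v) that can be nonzero form a two by two
    block, because u + v and u - v have the same parity; the relation between
    the coefficients is the vanishing of its determinant. *)
Lemma three_separable a b m n k : ~~ (2 %| k)%Z -> ~~ (2 %| m + n)%Z ->
  a m ^+ 2 * b (n - k) * b (n + k) = b n ^+ 2 * a (m - k) * a (m + k) ->
  (forall i, i != m - k -> i != m -> i != m + k -> a i = 0) ->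
  (forall j, j != n - k -> j != n -> j != n + k -> b j = 0) -> separable a b.
Proof.
move=> k_odd mn rel a0 b0; pose h := ((m + n + k) %/ 2)%Z.
have hE : 2 * h = m + n + k by rewrite /h; lia.
pose X u v := a (u + v) * b (u - v).
have Xu u v : u != h -> u != h - k -> X u v = 0.
  move=> uh uhk; rewrite /X.
  have [->|i1] := eqVneq (a (u + v)) 0; first by rewrite mul0r.
  have [->|i2] := eqVneq (b (u - v)) 0; first by rewrite mulr0.
  have : [|| u + v == m - k, u + v == m | u + v == m + k].
    by apply: contraNT i1; rewrite !negb_or => /and3P[*]; rewrite a0.
  have : [|| u - v == n - k, u - v == n | u - v == n + k].
    by apply: contraNT i2; rewrite !negb_or => /and3P[*]; rewrite b0.
  lia.
have Xv u v : v != m - h -> v != m - h + k -> X u v = 0.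
  move=> vh vhk; rewrite /X.
  have [->|i1] := eqVneq (a (u + v)) 0; first by rewrite mul0r.
  have [->|i2] := eqVneq (b (u - v)) 0; first by rewrite mulr0.
  have : [|| u + v == m - k, u + v == m | u + v == m + k].
    by apply: contraNT i1; rewrite !negb_or => /and3P[*]; rewrite a0.
  have : [|| u - v == n - k, u - v == n | u - v == n + k].
    by apply: contraNT i2; rewrite !negb_or => /and3P[*]; rewrite b0.
  lia.
have det : X h (m - h) * X (h - k) (m - h + k) = X h (m - h + k) * X (h - k) (m - h).
  rewrite /X.
  have -> : h + (m - h) = m by ring.
  have -> : h - (m - h) = n + k by lia.
  have -> : h - k + (m - h + k) = m by ring.
  have -> : h - k - (m - h + k) = n - k by lia.
  have -> : h + (m - h + k) = m + k by ring.
  have -> : h - (m - h + k) = n by lia.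
  have -> : h - k + (m - h) = m - k by ring.
  have -> : h - k - (m - h) = n by lia.
  transitivity (a m ^+ 2 * b (n - k) * b (n + k)); first by ring.
  by rewrite rel; ring.
apply: cross_separable => u v u' v'; rewrite -![a _ * b _]/(X _ _).
have [uh|uh] := boolP ((u == h) || (u == h - k)); last first.
  by move: uh; rewrite negb_or => /andP[*]; rewrite !(Xu u)// !mul0r.
have [uh'|uh'] := boolP ((u' == h) || (u' == h - k)); last first.
  by move: uh'; rewrite negb_or => /andP[*]; rewrite !(Xu u')// !mulr0.
have [vh|vh] := boolP ((v == m - h) || (v == m - h + k)); last first.
  by move: vh; rewrite negb_or => /andP[*]; rewrite !(Xv _ v)// mul0r mulr0.
have [vh'|vh'] := boolP ((v' == m - h) || (v' == m - h + k)); last first.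
  by move: vh'; rewrite negb_or => /andP[*]; rewrite !(Xv _ v')// mul0r mulr0.
case/orP: uh => /eqP->; case/orP: uh' => /eqP->; case/orP: vh => /eqP->;
  case/orP: vh' => /eqP->; first [done|exact: mulrC|exact: det|exact: esym|
  by rewrite mulrC det mulrC|by rewrite mulrC -det mulrC].
Qed.

End sufficiency.

(** * Haar measure *)

Section haar_measure.
Context {R : realType}.
Local Notation T := (torus R).
Local Notation U := (uniform_prob (@twopi_gt0 R)).

(** The constant 1 is added to make the integrand nonnegative; G is an
    antiderivative of 1 + g. *)
Lemma uniform_zero_mean (g G : R -> R) : continuous g ->
  (forall x, `|g x| <= 1) -> (forall x : R, is_derive x 1 G (1 + g x)) ->
  G (2 * pi) - G 0 = 2 * pi -> \int[U]_x g x = 0.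
Proof.
move=> cg g1 dG GE; have p0 := @twopi_gt0 R.
have c1g : continuous (fun x => 1 + g x).
  by move=> x; apply: cvgD; [exact: cvg_cst|exact: cg].
have mg : measurable_fun setT g by exact: continuous_measurable_fun.
have bg : rbfun g by split => //; exists 1.
have b1 : rbfun (fun _ : measurableTypeR R => 1 : R).
  by split; [exact: measurable_cst|exists 1 => x; rewrite normr1].
have cG : continuous G.
  move=> x; apply: differentiable_continuous; apply/derivable1_diffP.
  by have [] := dG x.
have : \int[U]_x (1 + g x) = 1.
  rewrite /Rintegral integral_uniform; last 2 first.
  - by apply/measurable_EFinP; exact: continuous_measurable_fun.
  - by move=> x; rewrite lee_fin; have := g1 x; rewrite ler_norml => /andP[]; lra.
  rewrite (@continuous_FTC2 _ _ G)//.
  - by rewrite -EFinB GE subr0 -EFinM /= mulVf// gt_eqF.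
  - exact: continuous_subspaceT.
  - split.
    + by move=> x _; have [] := dG x.
    + by apply: cvg_at_right_filter; exact: cG.
    + by apply: cvg_at_left_filter; exact: cG.
  - by move=> x _; rewrite derive1E; have [] := dG x.
rewrite (rfunctionalD (measure_rfunctional U) b1 bg).
rewrite Rintegral_cst//= probability_setT mulr1 /=.
by move=> h; apply: (addrI 1); rewrite h addr0.
Qed.

Lemma is_derive_linear (u x : R) : is_derive x 1 (fun t : R => u * t) u.
Proof.
have := @is_deriveM _ _ (cst u) id x 1 0 1 (is_derive_cst _ _ _) (is_derive_id _ _).
by rewrite scaler0 addr0 /= => /is_derive_eq; apply; rewrite /GRing.scale /= mulr1.
Qed.

Lemma uniform_trig (f g : R -> R) (u : R) : u != 0 -> continuous g ->
  (forall x, `|g x| <= 1) -> (forall x : R, is_derive x 1 f (g x)) ->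
  f (u * (2 * pi)) = f 0 -> \int[U]_x g (u * x) = 0.
Proof.
move=> u0 cg g1 dfg fE; pose G : R -> R := id + u^-1 \*: (f \o *%R u).
have GE y : G y = y + u^-1 * f (u * y) by [].
have cgu : continuous (fun x => g (u * x)).
  move=> x; apply: continuous_comp; last exact: cg.
  by apply: cvgM; [exact: cvg_cst|exact: cvg_id].
have gu1 x : `|g (u * x)| <= 1 by exact: g1.
have dG (x : R) : is_derive x 1 G (1 + g (u * x)).
  have dl := is_derive_linear u x; have du := dfg (u * x).
  have dfu := is_derive1_comp (f := f) (g := *%R u) du dl.
  have dZ := is_deriveZ u^-1 dfu.
  have <- : u^-1 * (g (u * x) * u) = g (u * x) by rewrite mulrCA mulVf ?mulr1.
  exact: (is_deriveD (is_derive_id x 1) dZ).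
have G2pi : G (2 * pi) - G 0 = 2 * pi by rewrite !GE mulr0 fE; ring.
exact: (uniform_zero_mean cgu gu1 dG G2pi).
Qed.

Lemma haar_char (u : int) : cintegral (haar R) setT (char u) = (u == 0)%:R.
Proof.
rewrite /haar cintegral_of_measure; last exact: char_bfun.
have [mR mI [M cM]] := @char_bfun R u.
have tr (h : R[i] -> R) (g : R -> R) : (forall z, `|h z| <= normc z) ->
    measurable_fun setT (fun x : T => h (char u x)) ->
    (forall t, h (char u (to_torus t)) = g (u%:~R * t)) ->
    \int[distribution U (@to_torus R)]_x h (char u x) = \int[U]_x g (u%:~R * x).
  move=> hn mh hE; rewrite /Rintegral integral_distribution.
  - by congr fine; apply: eq_integral => t _; rewrite /= hE.
  - exact/measurable_EFinP.
  - have : rbfun (fun t : measurableTypeR R => h (char u (to_torus t))).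
      split; first by have := measurableT_comp mh (@measurable_to_torus R).
      by exists M => t; apply: le_trans (hn _) (cM _).
    by move/(rbfun_integrable U).
have [->|u0] := eqVneq u 0.
  rewrite (_ : char 0 = fun=> 1); last by apply/funext => x; rewrite char0.
  have P1 : distribution U (@to_torus R) setT = 1%E by exact: probability_setT.
  have cst1 (c : R) : \int[distribution U (@to_torus R)]__ c = c.
    rewrite Rintegral_cst// -[RHS]mulr1; congr (_ * _).
    exact: (congr1 fine P1).
  by apply: complex_eqP; rewrite /= cst1.
have u0' : u%:~R != 0 :> R by rewrite intr_eq0.
have e2pi : cexp ('i%C * (u%:~R * (2 * pi))%:C) = 1 :> R[i].
  by rewrite mulrzl cexp_2pi_int.
rewrite (tr (@complex.Re R) cos normr_Re_le mR); last first.
  by move=> t; rewrite char_to_torus cexp_i.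
rewrite (tr (@complex.Im R) sin normr_Im_le mI); last first.
  by move=> t; rewrite char_to_torus cexp_i.
rewrite cexp_i in e2pi; case: e2pi => c2 s2.
have -> : \int[U]_x cos (u%:~R * x) = 0.
  apply: (@uniform_trig (@sin R)) => //.
  - exact: continuous_cos.
  - exact: cos_max.
  - by rewrite s2 sin0.
have -> // : \int[U]_x sin (u%:~R * x) = 0.
apply: (@uniform_trig (- @cos R)) => //.
- exact: continuous_sin.
- exact: sin_max.
- by move=> x; rewrite -[sin x]opprK; exact: is_deriveN.
- by rewrite -[LHS]/(- cos _) -[RHS]/(- cos _) c2 cos0.
Qed.

Lemma has_ft_haar : has_ft (haar R) (fun u => (u == 0)%:R).
Proof.
apply: eq_has_ft (has_ft_fourier (haar R)) => u.
by rewrite fourier_stieltjesE haar_char oppr_eq0.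
Qed.

End haar_measure.

(** * Transforms of translates, dilates and twists *)

Section constructions.
Context {R : realType}.
Local Notation T := (torus R).
Implicit Types (m : set T -> R[i]) (a b : int -> R[i]) (mu rho sigma : cmeasure T R).

Lemma has_ft_cdirac (s : T) : has_ft (cdirac s) (fun u => char (- u) s).
Proof.
exists (fun f => f s); first exact: cfunctional_eval.
by split => // A mA; rewrite /cdirac /cmeasure_fun /= diracE /cind indicE.
Qed.

Lemma has_ft_translate m a (s : T) : has_ft m a ->
  exists m', has_ft m' (fun u => a u * char (- u) s).
Proof.
move=> ma; have [mu muE] := has_ft_cmeasure ma; exists (convolution mu (cdirac s)).
apply: has_ft_convolution; last exact: has_ft_cdirac.
by apply: has_ft_eqm ma => A mA; rewrite muE.
Qed.

Lemma char_pi (u : int) : char u (to_torus pi) = parity R u :> R[i].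
Proof.
have even (v : int) : char (2 * v) (to_torus pi) = 1 :> R[i].
  rewrite char_to_torus (_ : _ * pi = (2 * pi) *~ v) ?cexp_2pi_int//.
  by rewrite intrM -mulrzr; ring.
rewrite /parity; have [u2|u2] := boolP (2 %| u)%Z.
  by have -> : u = 2 * (u %/ 2)%Z by lia.
have -> : u = 2 * (u %/ 2)%Z + 1 by lia.
rewrite charD even mul1r char_to_torus mul1r cexp_i cospi sinpi.
by apply: complex_eqP; rewrite /= ?oppr0.
Qed.

Lemma parityN (u : int) : parity R (- u) = parity R u.
Proof. by rewrite /parity; congr (if _ then _ else _); lia. Qed.

Lemma has_ft_parity m a : has_ft m a ->
  exists m', has_ft m' (fun u => a u * parity R u).
Proof.
move=> /(has_ft_translate (to_torus pi))[m' m'a]; exists m'.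
by apply: eq_has_ft m'a => u; rewrite char_pi parityN.
Qed.

Lemma cexp_parity (c : R[i]) u :
  cexp (parity R u * c) = ccosh c + parity R u * csinh c.
Proof.
by rewrite /parity /ccosh /csinh; case: ifPn => _; rewrite ?mul1r ?mulN1r; field.
Qed.

Lemma has_ft_cexp_parity m a c : has_ft m a ->
  exists m', has_ft m' (fun u => a u * cexp (parity R u * c)).
Proof.
move=> ma; have [m' m'a] := has_ft_parity ma.
exists (fun A => ccosh c * m A + csinh c * m' A).
apply: eq_has_ft (has_ftD (has_ftZ (ccosh c) ma) (has_ftZ (csinh c) m'a)) => u.
by rewrite cexp_parity; ring.
Qed.

Lemma Mplus_iff mu a : has_ft mu a ->
  Mplus mu <-> (forall u, ~~ (2 %| u)%Z -> a u = 0).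
Proof.
move=> mua.
have ft := has_ft_convolution mua (has_ft_cdirac (to_torus pi)).
rewrite /Mplus (has_ft_iff ft mua); split => H u.
  move=> u2; have := H u; rewrite char_pi parityN /parity (negbTE u2) mulrN1.
  move=> h; have : 2 * a u = 0 by rewrite mulr_natl mulr2n -{1}h addNr.
  by move/eqP; rewrite mulf_eq0 pnatr_eq0 /= => /eqP.
rewrite char_pi parityN /parity; case: ifPn => [_|/H->]; first by rewrite mulr1.
by rewrite mul0r.
Qed.

Lemma Mminus_iff mu a : has_ft mu a ->
  Mminus mu <-> (forall u, (2 %| u)%Z -> a u = 0).
Proof.
move=> mua.
have ft := has_ft_convolution mua (has_ft_cdirac (to_torus pi)).
have ftN : has_ft (fun A => - mu A) (fun u => - a u).
  apply: has_ft_eqm (eq_has_ft _ (has_ftZ (-1) mua)) => [A _|u];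
  by rewrite mulN1r.
rewrite /Mminus (has_ft_iff ft ftN); split => H u.
  move=> u2; have := H u; rewrite char_pi parityN /parity u2 mulr1.
  move=> h; have : 2 * a u = 0 by rewrite mulr_natl mulr2n {1}h addNr.
  by move/eqP; rewrite mulf_eq0 pnatr_eq0 /= => /eqP.
rewrite char_pi parityN /parity; case: ifPn => [/H->|_]; first by rewrite mul0r oppr0.
by rewrite mulrN1.
Qed.

End constructions.

(** * Dilations *)

Section dilations.
Context {R : realType}.
Local Notation T := (torus R).
Implicit Types (a : int -> R[i]) (rho sigma : cmeasure T R) (x y theta : T).

Lemma to_torus0 : @to_torus R 0 = 0.
Proof. exact: (GRing.raddf0 \pi_T%qT). Qed.

Lemma to_torusMn (t : R) k : to_torus (t *+ k) = to_torus t *+ k.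
Proof.
by elim: k => [|k IHk]; rewrite ?mulr0n ?to_torus0// !mulrS to_torusD IHk.
Qed.

Lemma char_mulrn u x k : char u (x *+ k) = char (u * k%:Z) x.
Proof.
rewrite -(to_torus_repr x) -to_torusMn !char_to_torus; congr cexp.
by rewrite intrM -mulr_natl mulrA.
Qed.

Lemma char1_inj x : char 1 x = 1 -> x = 0.
Proof.
rewrite -(to_torus_repr x) char_to_torus mul1r; set t := repr x => t1.
have [n nt] := mod_2pi t; set s := t + _ in nt.
have st : to_torus s = to_torus t by apply/to_torusP; exists n; rewrite /s; ring.
suff s0 : s = 0 by rewrite -st s0 to_torus0.
have : cos `|s| = cos 0.
  rewrite cos_norm cos0.
  have : cexp ('i%C * s%:C) = 1 :> R[i].
    by rewrite /s rmorphD mulrDr cexpD t1 cexp_2pi_int mulr1.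
  by rewrite cexp_i => -[].
move/cos_inj; rewrite !in_itv/= lexx pi_ge0 normr_ge0 nt => /(_ isT isT).
by move/normr0_eq0.
Qed.

Section fixed.
Variables (k : nat) (theta : T).
Hypothesis k0 : (0 < k)%N.

Let root_of y : T := to_torus (repr (y - theta) / k%:R).
Let omega (j : nat) : T := to_torus (2 * pi * j%:R / k%:R).

Let k0' : k%:R != 0 :> R. Proof. by rewrite pnatr_eq0 -lt0n. Qed.

Let pi0 : 2 * pi != 0 :> R. Proof. by rewrite gt_eqF// twopi_gt0. Qed.

Let to_torus_div (t : R) : to_torus (t / k%:R) *+ k = to_torus t.
Proof. by rewrite -to_torusMn -[(_ / _) *+ k]mulr_natr divfK. Qed.

Let to_torus_2pi (n : int) : to_torus (2 * pi * n%:~R) = 0 :> T.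
Proof.
by rewrite -to_torus0; apply/to_torusP; exists n; rewrite subr0 mulrzr.
Qed.

Lemma fiber_bij y : set_bij `I_k [set x | y = x *+ k + theta]
  (fun j => root_of y + omega j).
Proof.
have rootk : root_of y *+ k = y - theta.
  by rewrite /root_of to_torus_div to_torus_repr.
split.
- move=> j _ /=; rewrite mulrnDl rootk /omega to_torus_div.
  by rewrite (to_torus_2pi j) addr0 subrK.
- move=> i j /set_mem/= ik /set_mem/= jk /addrI /to_torusP[n].
  rewrite -mulrBl -mulrBr -mulrzr -mulrA => /(mulfI pi0)/(congr1 (fun s : R => s * k%:R)).
  rewrite divfK// => ijn.
  have : (i%:Z - j%:Z)%:~R = (n * k%:Z)%:~R :> R by rewrite intrB intrM.
  move=> /eqP; rewrite eqr_int => /eqP ijn'.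
  have [n0|n0] := eqVneq n 0; first by rewrite n0 mul0r in ijn'; lia.
  have : `|i%:Z - j%:Z| < k%:Z by lia.
  by rewrite ijn' normrM; nia.
- move=> x /= yx.
  have [n nE] : exists n : int, repr (x - root_of y) * k%:R = 2 * pi * n%:~R.
    have : to_torus (repr (x - root_of y) * k%:R) = to_torus 0 :> T.
      rewrite mulr_natr to_torusMn to_torus_repr mulrnBl rootk yx addrK subrr.
      by rewrite to_torus0.
    by move=> /to_torusP[n]; rewrite subr0 => ->; exists n; rewrite mulrzr.
  pose r := `|(n %% k%:Z)%Z|%N; have rk : (r < k)%N by rewrite /r; lia.
  exists r => //; rewrite addrC; apply/eqP; rewrite eq_sym -subr_eq; apply/eqP.
  rewrite -(to_torus_repr (x - root_of y)); apply/to_torusP.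
  exists (n %/ k%:Z)%Z; apply: (mulIf k0'); rewrite mulrBl nE divfK//.
  rewrite -[2 * pi * n%:~R - _]mulrBr -[2 * pi *~ _]mulrzr -[RHS]mulrA.
  congr (_ * _).
  have -> : k%:R = k%:Z%:~R :> R by [].
  rewrite -intrM -[r%:R]/(r%:Z%:~R) -intrB; congr (_%:~R).
  have := divz_eq n k; rewrite /r; lia.
Qed.

Lemma fiber_sum (phi : T -> R[i]) y :
  \sum_(x \in [set x | y = x *+ k + theta]) phi x =
  \sum_(j < k) phi (root_of y + omega j).
Proof. by rewrite (reindex_fsbig _ _ _ _ (fiber_bij y)) -fsbig_ord. Qed.

(** The fibre is a coset of the k-th roots of unity, over which a character
    sums to zero unless it is trivial on them. *)
Lemma fiber_char n y :
  \sum_(x \in [set x | y = x *+ k + theta]) char n x =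
  if (k%:Z %| n)%Z then k%:R * char (n %/ k%:Z)%Z (y - theta) else 0.
Proof.
rewrite fiber_sum; set z := char n (omega 1).
have zE j : char n (omega j) = z ^+ j.
  elim: j => [|j IHj]; first by rewrite /omega mulr0 mul0r to_torus0 -(mulr0n 0)
    char_mulrn mulr0 char0.
  rewrite exprS -IHj /z -char_addr -to_torusD; congr (char _ (to_torus _)).
  by rewrite -mulrDl -mulrDr -natrD add1n.
under eq_bigr do rewrite char_addr zE; rewrite -mulr_sumr.
have zn : z = char 1 (to_torus (2 * pi * n%:~R / k%:R)).
  by rewrite /z /omega !char_to_torus mul1r mulr1 mulrA [n%:~R * _]mulrC.
case: ifPn => [kn|kn].
  have nE : n = (n %/ k%:Z)%Z * k%:Z by rewrite divzK.
  have -> : z = 1.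
    rewrite zn {1}nE intrM mulrA mulfK// to_torus_2pi -(mulr0n 0).
    by rewrite char_mulrn mulr0 char0.
  under eq_bigr do rewrite expr1n; rewrite sumr_const card_ord mulrC.
  rewrite [in char n _]nE -char_mulrn to_torus_div.
  by rewrite to_torus_repr.
suff z1 : z != 1.
  have := subrX1 z k; rewrite -zE /omega mulfK//.
  have -> : to_torus (2 * pi) = 0 :> T by have := to_torus_2pi 1; rewrite mulr1.
  rewrite -(mulr0n 0) char_mulrn mulr0 char0 subrr => /esym/eqP.
  by rewrite mulf_eq0 subr_eq0 (negbTE z1) => /eqP ->; rewrite mulr0.
apply: contraNN kn => /eqP; rewrite zn => /char1_inj; rewrite -to_torus0.
move/to_torusP => [m]; rewrite subr0 => /(congr1 (fun s : R => s * k%:R)).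
rewrite divfK// -[2 * pi *~ m]mulrzr -[RHS]mulrA => /(mulfI pi0).
have -> : k%:R = k%:Z%:~R :> R by [].
by rewrite -intrM => /intr_inj ->; exact: dvdz_mull.
Qed.

Definition dilate_ft a (n : int) : R[i] :=
  if (k%:Z %| n)%Z then char (n %/ k%:Z)%Z theta * a (n %/ k%:Z)%Z else 0.

Lemma bounded_borelP (f : T -> R[i]) : bounded_borel f <-> bfun f.
Proof.
split=> -[rf jf [M fM]]; split => //.
  exists (complex.Re M) => x; have := fM x.
  by rewrite normc_def lecE => /andP[_]; case: (f x).
by exists M%:C => x; rewrite normc_def lecR; have := fM x; case: (f x).
Qed.

Let kC : k%:R != 0 :> R[i]. Proof. by rewrite pnatr_eq0 -lt0n. Qed.

Let fiber_char_fun n : (fun y =>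
    \sum_(x \in [set x | y = x *+ k + theta]) char n x) =
  fun y => (if (k%:Z %| n)%Z then
    k%:R * char (- (n %/ k%:Z)%Z) theta else 0) * char (n %/ k%:Z)%Z y.
Proof.
apply/funext => y; rewrite fiber_char; case: ifP => _; last by rewrite mul0r.
by rewrite char_subr mulrAC mulrA.
Qed.

Let fiber_char_integral rho a n : has_ft rho a ->
  k%:R^-1 * cintegral rho setT (fun y =>
    \sum_(x \in [set x | y = x *+ k + theta]) char n x) = dilate_ft a (- n).
Proof.
move=> rhoa; rewrite fiber_char_fun.
rewrite (cfunctionalZ (cintegral_functional rho)); last exact: char_bfun.
rewrite (has_ftE rhoa) /dilate_ft rpredN; case: ifPn => kn; last first.
  by rewrite mul0r mulr0.
have -> : (- n %/ k%:Z)%Z = - (n %/ k%:Z)%Z.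
  by rewrite -{1}(divzK kn) -mulNr mulzK//; lia.
by rewrite mulrA mulrA mulVf// mul1r.
Qed.

Lemma is_dilation_ft rho sigma a : has_ft rho a ->
  is_dilation rho k theta sigma -> has_ft sigma (dilate_ft a).
Proof.
move=> rhoa dil; apply: eq_has_ft (has_ft_fourier sigma) => n.
rewrite fourier_stieltjesE dil; last by apply/bounded_borelP; exact: char_bfun.
by rewrite (fiber_char_integral _ rhoa) opprK.
Qed.

(** The identity defining a dilation holds for characters, hence for their
    bounded limits; measurability of the fibre sums comes along. *)
Lemma ft_is_dilation rho sigma a : has_ft rho a ->
  has_ft sigma (dilate_ft a) -> is_dilation rho k theta sigma.
Proof.
move=> rhoa sigmaa phi /bounded_borelP/torus_bclosure.
have cr := cintegral_functional rho; have cs := cintegral_functional sigma.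
pose S (phi : T -> R[i]) y := \sum_(x \in [set x | y = x *+ k + theta]) phi x.
suff : bclosure (@characters R) phi -> [/\ bfun phi, bfun (S phi) &
  cintegral sigma setT phi = k%:R^-1 * cintegral rho setT (S phi)].
  by move=> /[apply] -[].
elim=> {phi} [_ [n ->]|f g _ [bf bSf IHf] _ [bg bSg IHg]|c f _ [bf bSf IHf]|
  fs f M _ bfs fsM fsf].
- split; first exact: char_bfun.
    by rewrite /S fiber_char_fun; apply: bfunZ; exact: char_bfun.
  by rewrite (fiber_char_integral _ rhoa) (has_ftE sigmaa).
- have SD : S (fun x => f x + g x) = fun y => S f y + S g y.
    by apply/funext => y; rewrite /S !fiber_sum big_split.
  rewrite SD (cfunctionalD cs)// (cfunctionalD cr)// IHf IHg mulrDr.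
  by split => //; exact: bfunD.
- have SZ : S (fun x => c * f x) = fun y => c * S f y.
    by apply/funext => y; rewrite /S !fiber_sum mulr_sumr.
  rewrite SZ (cfunctionalZ cs)// (cfunctionalZ cr)// IHf mulrCA.
  by split => //; exact: bfunZ.
- have bfs1 n : bfun (fs n) by case: (bfs n).
  have bfs2 n : bfun (S (fs n)) by case: (bfs n).
  have sum_le n (h : 'I_n -> R[i]) : (forall i, normc (h i) <= M) ->
      normc (\sum_(i < n) h i) <= n%:R * M.
    elim: n h => [|n IHn] h hM; first by rewrite big_ord0 normc0 mul0r.
    rewrite big_ord_recl; apply: le_trans (normcD _ _) _.
    rewrite -natr1 mulrDl mul1r [leRHS]addrC; apply: lerD => //.
    by apply: IHn => i; exact: hM.
  have SM n y : normc (S (fs n) y) <= k%:R * M.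
    by rewrite /S fiber_sum; apply: sum_le => i; exact: fsM.
  have Slim y : ccvg (fun n => S (fs n) y) (S f y).
    rewrite /S fiber_sum; under eq_fun do rewrite fiber_sum.
    elim: k => [|m IHm].
      by rewrite big_ord0; under eq_fun do rewrite big_ord0; exact: ccvg_cst.
    rewrite big_ord_recr; under eq_fun do rewrite big_ord_recr.
    by apply: ccvgD => //; exact: fsf.
  split; first exact: bfun_lim bfs1 fsM fsf.
    exact: bfun_lim bfs2 SM Slim.
  apply: (ccvg_unique (cfunctional_lim cs bfs1 fsM fsf)).
  have -> : (fun n => cintegral sigma setT (fs n)) =
      fun n => k%:R^-1 * cintegral rho setT (S (fs n)).
    by apply/funext => n; case: (bfs n).
  apply: ccvgM; first exact: ccvg_cst.
  exact: (cfunctional_lim cr bfs2 SM Slim).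
Qed.

End fixed.

End dilations.

(** * Theta series *)

Section theta_series.
Context {R : realType}.
Local Notation T := (torus R).

Definition symmetric_sum (t : int -> R[i]) (N : nat) : R[i] :=
  \sum_(j < N.*2.+1) t (j%:Z - N%:Z).

Lemma symmetric_sumS t N :
  symmetric_sum t N.+1 = symmetric_sum t N + (t N.+1%:Z + t (- N.+1%:Z)).
Proof.
rewrite /symmetric_sum doubleS [LHS]big_ord_recl [X in _ + X]big_ord_recr /=.
rewrite addrCA; congr (_ + _).
  by apply: eq_bigr => i _; congr t; rewrite /bump /=; lia.
by rewrite addrC; congr (t _ + t _); rewrite /bump /=; lia.
Qed.

Section geometric_bound.
Variables (D r : R) (t : int -> R[i]).
Hypothesis r01 : 0 <= r < 1.
Hypothesis tD : forall u, normc (t u) <= D * r ^+ `|u|%N.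

Let D0 : 0 <= D.
Proof. by have := tD 0; rewrite mulr1; apply: le_trans; exact: normc_ge0. Qed.

Let term (n : nat) : R[i] := if n is 0%N then t 0 else t n%:Z + t (- n%:Z).

Let symmetric_sumE N : symmetric_sum t N = \sum_(0 <= n < N.+1) term n.
Proof.
elim: N => [|N IHN]; last by rewrite symmetric_sumS IHN [RHS]big_nat_recr.
by rewrite /symmetric_sum big_nat1 big_ord_recl big_ord0 addr0.
Qed.

Let termD n : normc (term n) <= 2 * D * r ^+ n.
Proof.
case: n => [|n].
  by have := tD 0; rewrite expr0 !mulr1; have := D0; lra.
apply: le_trans (normcD _ _) _.
have h1 := tD n.+1%:Z; have h2 := tD (- n.+1%:Z).
have e1 : `|n.+1%:Z|%N = n.+1 by lia.
have e2 : `|- n.+1%:Z|%N = n.+1 by lia.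
rewrite e1 in h1; rewrite e2 in h2; lra.
Qed.

Let geo_sum N : \sum_(0 <= n < N) r ^+ n <= (1 - r)^-1.
Proof.
case/andP: r01 => r0 r1; rewrite -[leRHS]mul1r ler_pdivlMr; last by rewrite subr_gt0.
have := subrX1 r N; rewrite big_mkord => h.
have : 0 <= r ^+ N by rewrite exprn_ge0.
by rewrite mulrC -opprB mulNr -h; lra.
Qed.

Lemma symmetric_sum_bounded N : normc (symmetric_sum t N) <= 2 * D * (1 - r)^-1.
Proof.
rewrite symmetric_sumE; apply: (@le_trans _ _ (\sum_(0 <= n < N.+1) 2 * D * r ^+ n)).
  elim: N.+1 => [|n IHn]; first by rewrite !big_nil normc0.
  rewrite !big_nat_recr//=; apply: le_trans (normcD _ _) _.
  by apply: lerD => //; exact: termD.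
by rewrite -mulr_sumr ler_wpM2l ?geo_sum// mulr_ge0.
Qed.

Lemma symmetric_sum_cvg : ccvg (symmetric_sum t) (clim (symmetric_sum t)).
Proof.
case/andP: r01 => r0 r1.
have main (h : R[i] -> R) : (forall z w, h (z + w) = h z + h w) -> h 0 = 0 ->
    (forall z, `|h z| <= normc z) -> cvgn (fun N => h (symmetric_sum t N)).
  move=> hD h0 hn.
  have hs N : h (symmetric_sum t N) = series (fun n => h (term n)) N.+1.
    by rewrite symmetric_sumE /series /= (big_morph h hD h0).
  under eq_fun do rewrite hs.
  have : cvgn (series (fun n => h (term n))).
    apply: normed_cvg; apply: (@series_le_cvg _ _ (geometric (2 * D) r)).
    - by move=> n; exact: normr_ge0.
    - by move=> n; rewrite /= !mulr_ge0 ?exprn_ge0.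
    - by move=> n; apply: le_trans (hn _) _; exact: termD.
    - by apply: is_cvg_geometric_series; rewrite ger0_norm.
  by move=> /cvg_ex[l hl]; apply/cvg_ex; exists l; rewrite -cvg_shiftS in hl.
by split; [apply: (main _ (@cReD R)) => //; exact: normr_Re_le|
  apply: (main _ (@cImD R)) => //; exact: normr_Im_le].
Qed.

End geometric_bound.

(** Completing the square: a Gaussian beats every exponential. *)
Lemma gaussian_bound (A B : R) : 0 < A -> exists2 D : R, 0 <= D &
  forall u : int, expR (- A * u%:~R ^+ 2 + B * u%:~R) <= D * expR (-1) ^+ `|u|%N.
Proof.
move=> A0; pose b := `|B| + 1; exists (expR (b ^+ 2 / (4 * A))).
  exact: expR_ge0.
move=> u; rewrite -expRM_natl -expRD ler_expR.
set x := `|u|%N%:R : R.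
have xE : x = `|u%:~R| by rewrite /x -intr_norm natr_absz.
have x2 : u%:~R ^+ 2 = x ^+ 2 by rewrite xE real_normK ?num_real.
have Bx : B * u%:~R <= `|B| * x.
  by rewrite xE -normrM; exact: ler_norm.
rewrite x2 mulrN1 -/x.
have : 0 <= (2 * A * x - b) ^+ 2 / (4 * A) by rewrite divr_ge0 ?sqr_ge0//; lra.
have -> : (2 * A * x - b) ^+ 2 / (4 * A) = A * x ^+ 2 - b * x + b ^+ 2 / (4 * A).
  by field; rewrite gt_eqF.
rewrite /b in Bx *; lra.
Qed.

Definition theta_coef (c tau : R[i]) (u : int) : R[i] :=
  cexp (pi%:C * 'i%C * tau * u%:~R ^+ 2 + 2 * pi%:C * 'i%C * c * u%:~R).

Lemma theta_coef_bound (c tau : R[i]) : 0 < complex.Im tau ->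
  exists2 D : R, 0 <= D & forall u,
    normc (theta_coef c tau u) <= D * expR (-1) ^+ `|u|%N.
Proof.
move=> tau0.
have [D D0 HD] := @gaussian_bound (pi * complex.Im tau) (- 2 * pi * complex.Im c)
  (mulr_gt0 (pi_gt0 R) tau0).
exists D => // u; rewrite /theta_coef normc_cexp; apply: le_trans (HD u).
rewrite ler_expR -(rmorph_int (real_complex R)) -rmorphXn.
have -> : (2 : R[i]) = (2 : R)%:C by rewrite rmorph_nat.
case: tau c {tau0 HD} => a b [x y] /=; rewrite le_eqVlt; apply/orP; left.
by apply/eqP; ring.
Qed.

Variable k : nat.
Hypothesis k0 : (0 < k)%N.
Variables (c tau : R[i]).
Hypothesis tau0 : 0 < complex.Im tau.

Definition torus_theta (x : T) : R[i] :=
  theta (k%:R * angle x / (2 * pi%:C) + c) tau.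

Let summand (x : T) (u : int) : R[i] := theta_coef c tau u * char (k%:Z * u) x.

Let torus_thetaE x : torus_theta x = clim (symmetric_sum (summand x)).
Proof.
rewrite /torus_theta /theta; congr clim; apply/funext => N.
apply: eq_bigr => j _; rewrite /summand /theta_coef /char -cexpD; congr cexp.
set u : int := j%:Z - N%:Z.
have p0 : pi%:C != 0 :> R[i] by rewrite eq_complex /= eqxx andbT gt_eqF// pi_gt0.
rewrite [(k%:Z * u)%:~R]intrM -[k%:Z%:~R]/(k%:R) [(u ^+ 2)%:~R]rmorphXn /=.
by move: (pi%:C) p0 => P p0; field.
Qed.

Let summand_bound : exists2 D : R, 0 <= D & forall y u,
  normc (summand y u) <= D * expR (-1) ^+ `|u|%N.
Proof.
have [D D0 HD] := theta_coef_bound c tau0; exists D => // y u.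
by rewrite normcM normc_char mulr1.
Qed.

Let expRN1 : (0 : R) <= expR (-1) < (1 : R).
Proof. by rewrite expR_ge0 expR_lt1; lra. Qed.

Let sum_bfun N : bfun (fun x => symmetric_sum (summand x) N).
Proof.
have [] // := cfunctional_sum (n := N.*2.+1)
  (fs := fun j x => summand x (j%:Z - N%:Z)) (cintegral_functional (haar R)).
by move=> j; apply: bfunZ; exact: char_bfun.
Qed.

Lemma torus_theta_bfun : bfun torus_theta.
Proof.
have [D D0 HD] := summand_bound.
apply: (bfun_lim (fs := fun N x => symmetric_sum (summand x) N)
  (M := 2 * D * (1 - expR (-1))^-1)) => //.
- by move=> N x; apply: (symmetric_sum_bounded expRN1); exact: HD.
- move=> x; rewrite torus_thetaE.
  by apply: (symmetric_sum_cvg expRN1 (D := D)); exact: HD.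
Qed.

(** The series converges boundedly, so it may be integrated term by term, and
    only the frequency n of the series survives. *)
Lemma torus_theta_haar n :
  cintegral (haar R) setT (fun x => torus_theta x * char (- n) x) =
  if (k%:Z %| n)%Z then theta_coef c tau (n %/ k%:Z)%Z else 0.
Proof.
have [D D0 HD] := summand_bound; have cH := cintegral_functional (haar R).
pose s N x := symmetric_sum (summand x) N * char (- n) x.
have bs N : bfun (s N) by apply: bfunM => //; exact: char_bfun.
have sM N x : normc (s N x) <= 2 * D * (1 - expR (-1))^-1.
  rewrite normcM normc_char mulr1.
  by apply: (symmetric_sum_bounded expRN1); exact: HD.
have slim x : ccvg (s ^~ x) (torus_theta x * char (- n) x).
  apply: ccvgM; last exact: ccvg_cst; rewrite torus_thetaE.
  by apply: (symmetric_sum_cvg expRN1 (D := D)); exact: HD.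
apply: (ccvg_unique (cfunctional_lim cH bs sM slim)).
have IE N : cintegral (haar R) setT (s N) = \sum_(j < N.*2.+1)
    theta_coef c tau (j%:Z - N%:Z) * (k%:Z * (j%:Z - N%:Z) == n)%:R.
  have -> : s N = fun x => \sum_(j < N.*2.+1)
      theta_coef c tau (j%:Z - N%:Z) * char (k%:Z * (j%:Z - N%:Z) - n) x.
    apply/funext => x; rewrite /s /symmetric_sum mulr_suml.
    by apply: eq_bigr => j _; rewrite charD mulrA.
  have [_ ->] := cfunctional_sum (n := N.*2.+1) (fs := fun j x =>
    theta_coef c tau (j%:Z - N%:Z) * char (k%:Z * (j%:Z - N%:Z) - n) x) cH
    (fun j => bfunZ _ (char_bfun _)).
  apply: eq_bigr => j _; rewrite (cfunctionalZ cH); last exact: char_bfun.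
  by rewrite haar_char subr_eq0.
case: ifPn => kn; last first.
  rewrite (_ : (fun N => _) = fun=> 0); first exact: ccvg_cst.
  apply/funext => N; rewrite IE big1// => j _.
  have [jn|_] := eqVneq (k%:Z * (j%:Z - N%:Z)) n; last by rewrite mulr0.
  by rewrite -jn dvdz_mulr ?dvdzz in kn.
set q := (n %/ k%:Z)%Z; have nE : n = k%:Z * q by rewrite mulrC divzK.
apply: (@ccvg_shift _ _ _ `|q|%N).
rewrite (_ : (fun N => _) = fun=> theta_coef c tau q); first exact: ccvg_cst.
apply/funext => N; rewrite IE; set M := (N + `|q|)%N.
pose p := `|(q + M%:Z)%R|%N.
have pE : p%:Z - M%:Z = q by rewrite /p /M; lia.
have pM : (p < M.*2.+1)%N by rewrite /p /M; lia.
rewrite (bigD1 (Ordinal pM))//= big1 ?addr0.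
  rewrite pE.
  by rewrite nE eqxx mulr1.
move=> j jq; have [jn|_] := eqVneq (k%:Z * (j%:Z - M%:Z)) n; last by rewrite mulr0.
case/eqP: jq; apply: val_inj => /=.
have kz : k%:Z != 0 by lia.
by move: jn; rewrite nE => /(mulfI kz); rewrite -pE; lia.
Qed.

End theta_series.

(** * Transforms of the solutions *)

Section solution_transforms.
Context {R : realType}.
Local Notation T := (torus R).
Implicit Types (p q : int -> R[i]) (mu rho : cmeasure T R).

Definition spread (k m : int) p (n : int) : R[i] :=
  if (k %| n - m)%Z then p ((n - m) %/ k)%Z else 0.

Lemma eq_spread k m p q : p =1 q -> spread k m p =1 spread k m q.
Proof. by move=> /funext ->. Qed.

(** As k is odd, u + v and u - v lie in the progressions exactly when u and v
    themselves lie in progressions with step k. *)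
Lemma separable_spread k m n p q : separable p q -> 0 < k -> ~~ (2 %| k)%Z ->
  (2 %| m + n)%Z -> separable (spread k m p) (spread k n q).
Proof.
move=> [f [g fg]] k0 k_odd mn; pose h := ((m + n) %/ 2)%Z.
have hE : m + n = 2 * h by rewrite /h; lia.
exists (spread k h f), (spread k (m - h) g) => u v; rewrite /spread.
have e1 : u + v - m = (u - h) + (v - (m - h)) by ring.
have e2 : u - v - n = (u - h) - (v - (m - h)) by lia.
rewrite e1 e2; move: (u - h) (v - (m - h)) => x y {e1 e2}.
have [/dvdzP[x' ->]|kx] := boolP (k %| x)%Z; last first.
  rewrite mul0r; have [kxy|_] := boolP (k %| x + y)%Z; last by rewrite mul0r.
  have [kxy'|_] := boolP (k %| x - y)%Z; last by rewrite mulr0.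
  case/negP: kx; have := rpredD kxy kxy'.
  have -> : x + y + (x - y) = 2 * x by ring.
  by rewrite Gauss_dvdzr//; rewrite coprimezE coprime_sym coprime2n; lia.
have [/dvdzP[y' ->]|ky] := boolP (k %| y)%Z; last first.
  by rewrite mulr0 ifF ?mul0r//; apply/negbTE; rewrite rpredDl// dvdz_mull.
by rewrite -mulrDl -mulrBl !dvdz_mull// !mulzK ?gt_eqF.
Qed.

Definition quadratic_exp (c2 c4 w l : R[i]) (j : int) : R[i] :=
  cexp (c4 + parity R j * c2 + w * j%:~R ^+ 2 + l * j%:~R).

(** The parallelogram law decouples the quadratic term, and the parity terms
    cancel because u + v and u - v have the same parity. *)
Lemma separable_quadratic_exp c2 c4 c6 w l l' :
  separable (quadratic_exp c2 c4 w l) (quadratic_exp (- c2) c6 w l').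
Proof.
exists (fun x => cexp (2 * w * x%:~R ^+ 2 + (l + l') * x%:~R)).
exists (fun y => cexp (c4 + c6 + 2 * w * y%:~R ^+ 2 + (l - l') * y%:~R)) => x y.
rewrite /quadratic_exp -!cexpD; congr cexp.
have -> : parity R (x - y) = parity R (x + y).
  by rewrite /parity; congr (if _ then _ else _); lia.
by rewrite !intrD mulrNz; ring.
Qed.

Lemma theta_coef_half (c tau : R[i]) j :
  theta_coef (c + 2^-1) tau j = parity R j * theta_coef c tau j.
Proof.
rewrite -char_pi char_to_torus -cexpD; congr cexp.
by rewrite rmorphM /= rmorph_int; field.
Qed.

(** Shifting the argument of theta by one half multiplies the coefficient at j
    by (-1)^j, so the hyperbolic combination multiplies it by
    exp ((-1)^j c2). *)
Lemma theta_density_ft (c2 c3 c4 tau : R[i]) (k : nat) (m : int) :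
  0 < complex.Im tau -> (0 < k)%N ->
  has_ft (with_density (fun x =>
      cexp ('i%C * m%:~R * angle x + c4) *
      (ccosh c2 * theta (k%:R * angle x / (2 * pi%:C) + c3) tau +
       csinh c2 * theta (k%:R * angle x / (2 * pi%:C) + c3 + 2^-1) tau))
      (haar R))
    (spread k m (quadratic_exp c2 c4 (pi%:C * 'i%C * tau) (2 * pi%:C * 'i%C * c3))).
Proof.
move=> tau0 k0; have cH := cintegral_functional (haar R).
have b1 := torus_theta_bfun k c3 tau0.
have b2 := torus_theta_bfun k (c3 + 2^-1) tau0.
pose g (x : T) := cexp c4 * (char m x * (ccosh c2 * torus_theta k c3 tau x +
  csinh c2 * torus_theta k (c3 + 2^-1) tau x)).
have bg : bfun g.
  apply: bfunZ; apply: bfunM; first exact: char_bfun.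
  by apply: bfunD; exact: bfunZ.
rewrite (_ : (fun x => _) = g); last first.
  apply/funext => x; rewrite /g /torus_theta /char addrA cexpD.
  by rewrite [cexp _ * cexp c4]mulrC mulrA.
apply: eq_has_ft (has_ft_density (haar R) bg) => n.
pose t1 x := torus_theta k c3 tau x * char (- (n - m)) x.
pose t2 x := torus_theta k (c3 + 2^-1) tau x * char (- (n - m)) x.
have bt1 : bfun t1 by apply: bfunM => //; exact: char_bfun.
have bt2 : bfun t2 by apply: bfunM => //; exact: char_bfun.
rewrite (_ : (fun x => _) =
    fun x => cexp c4 * (ccosh c2 * t1 x + csinh c2 * t2 x)); last first.
  apply/funext => x; rewrite /g /t1 /t2 opprB charD; ring.
rewrite (cfunctionalZ cH); last by apply: bfunD; exact: bfunZ.
rewrite (cfunctionalD cH); [|exact: bfunZ|exact: bfunZ].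
rewrite !(cfunctionalZ cH)// /t1 /t2 !torus_theta_haar// /spread.
case: ifPn => _; last by rewrite !mulr0 addr0 mulr0.
set j := (_ %/ _)%Z; rewrite theta_coef_half mulrA -mulrDl.
rewrite [csinh c2 * _]mulrC -cexp_parity /theta_coef /quadratic_exp -!cexpD.
by congr cexp; ring.
Qed.

Lemma ccoshN (c : R[i]) : ccosh (- c) = ccosh c.
Proof. by rewrite /ccosh opprK addrC. Qed.

Lemma csinhN (c : R[i]) : csinh (- c) = - csinh c.
Proof. by rewrite /csinh opprK -mulNr opprB. Qed.

Lemma dilation_density_ft rho1 rho1' (h : int -> R[i]) (c2 c4 : R[i]) (k : nat)
    (theta : T) (m : int) :
  has_ft rho1 (dilate_ft k theta h) ->
  has_ft rho1' (dilate_ft k (theta + to_torus pi) h) ->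
  has_ft (with_density (fun x => cexp ('i%C * m%:~R * angle x + c4))
      (cmadd (cmscale (ccosh c2) rho1) (cmscale (csinh c2) rho1')))
    (spread k m (fun j => cexp (c4 + parity R j * c2) * char j theta * h j)).
Proof.
move=> r1 r1'.
have ft := has_ft_cmadd (has_ft_cmscale (ccosh c2) r1) (has_ft_cmscale (csinh c2) r1').
rewrite (_ : (fun x => _) = fun x => cexp c4 * char m x); last first.
  by apply/funext => x; rewrite cexpD mulrC.
apply: eq_has_ft (has_ft_char_density m (cexp c4) ft) => n.
rewrite /dilate_ft /spread; case: ifPn => _; last by rewrite !mulr0 addr0 mulr0.
by rewrite char_addr char_pi cexpD cexp_parity; ring.
Qed.

(** The pushforward under x |-> k x. *)
Lemma has_ft_mulrn (m : set T -> R[i]) (a : int -> R[i]) (k : nat) :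
  has_ft m a -> exists m', has_ft m' (fun u => a (u * k%:Z)).
Proof.
move=> [I cI [mI Ia]]; pose J (f : T -> R[i]) := I (f \o (fun x : T => x *+ k)).
exists (fun A => J (cind R A)), J.
  apply: cfunctional_comp cI => f /torus_bclosure bf.
  apply: (@bclosure_bfun _ _ _ (@characters R)) => [_ [u ->]|].
    exact: char_bfun.
  apply: bclosure_comp bf => _ [u ->]; exists (u * k%:Z).
  by apply/funext => x; rewrite /= char_mulrn.
split => // u; rewrite /J -Ia; congr I; apply/funext => x /=.
by rewrite char_mulrn mulNr.
Qed.

End solution_transforms.

(** * The cases of the classification, in terms of transforms *)

Section cases.
Context {R : realType}.
Local Notation T := (torus R).
Implicit Types (a b : int -> R[i]) (mu rho nu : cmeasure T R) (m n k : int).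

Lemma has_ft_char_haar m (A : R[i]) :
  has_ft (with_density (fun x => A * char m x) (haar R))
    (fun i => A * (i == m)%:R).
Proof.
apply: eq_has_ft (has_ft_char_density m A has_ft_haar) => i.
by rewrite subr_eq0.
Qed.

Lemma zero_iff mu a : has_ft mu a ->
  mu =m cmzero T R <-> (forall i, a i = 0).
Proof. by move=> mua; exact: (has_ft_iff mua has_ft_cmzero). Qed.

Lemma single_frequency_iff mu a m : has_ft mu a ->
  (exists A : R[i], mu =m with_density (fun x => A * char m x) (haar R)) <->
  (forall i, i != m -> a i = 0).
Proof.
move=> mua; split=> [[A muA] i im|a0].
  move/(has_ft_iff mua (has_ft_char_haar m A)): muA => ->.
  by rewrite (negbTE im) mulr0.
exists (a m); apply/(has_ft_iff mua (has_ft_char_haar m _)) => i.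
by have [->|im] := eqVneq i m; rewrite ?mulr1// mulr0 a0.
Qed.

(** The modulation by n turns the condition on the frequencies congruent to n
    into one on the even frequencies; the Haar measure takes care of the
    frequency 0. *)
Lemma half_frequencies_iff mu a n : has_ft mu a ->
  (exists (A : R[i]) nu, Mminus nu /\
     mu =m with_density (char n) (cmadd (cmscale A (haar R)) nu)) <->
  (forall j, j != n -> (2 %| j + n)%Z -> a j = 0).
Proof.
move=> mua.
have ft A nu c : has_ft nu c ->
    has_ft (with_density (char n) (cmadd (cmscale A (haar R)) nu))
      (fun j => A * (j == n)%:R + c (j - n)).
  move=> nuc; have := has_ft_char_density n 1
    (has_ft_cmadd (has_ft_cmscale A (@has_ft_haar R)) nuc).
  rewrite (_ : (fun x => 1 * _) = char n); last by apply/funext => x; rewrite mul1r.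
  by apply: eq_has_ft => j; rewrite mul1r subr_eq0.
split=> [[A [nu [nuM muE]]] j jn jn2|a0].
  have nuc := has_ft_fourier nu.
  move/(has_ft_iff mua (ft A _ _ nuc)): muE => ->.
  rewrite (negbTE jn) mulr0 add0r; move/(Mminus_iff nuc): nuM; apply; lia.
have shift := has_ft_char_density (- n) 1 mua.
have corr := has_ftZ (- a n) (@has_ft_haar R).
have [nu nuE] := has_ft_cmeasure (has_ftD shift corr).
have nuc : has_ft nu (fun u => a (u + n) - a n * (u == 0)%:R).
  apply: has_ft_eqm (eq_has_ft _ (has_ftD shift corr)) => [A mA|u].
    by rewrite nuE.
  by rewrite mul1r opprK mulNr.
exists (a n), nu; split.
  apply/(Mminus_iff nuc) => u u2; have [->|u0] := eqVneq u 0.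
    by rewrite add0r mulr1 subrr.
  rewrite mulr0 subr0 a0//; last lia.
  by apply: contraNneq u0 => h; apply/eqP; lia.
apply/(has_ft_iff mua (ft _ _ _ nuc)) => j.
by rewrite subrK subr_eq0 addrC subrK.
Qed.

Lemma has_ft_three m k (A1 A2 A3 : R[i]) :
  has_ft (with_density (fun x => A1 * char m x + A2 * char (m - k) x +
      A3 * char (m + k) x) (haar R))
    (fun i => A1 * (i == m)%:R + A2 * (i == m - k)%:R + A3 * (i == m + k)%:R).
Proof.
have bc (A : R[i]) u : bfun (fun x : T => A * char u x).
  by apply: bfunZ; exact: char_bfun.
have cH := cintegral_functional (haar R).
have b12 := bfunD (bc A1 m) (bc A2 (m - k)).
apply: eq_has_ft (has_ft_density (haar R) (bfunD b12 (bc A3 (m + k)))) => i.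
have e (A : R[i]) u : cintegral (haar R) setT (fun x => A * char u x * char (- i) x) =
    A * (i == u)%:R.
  rewrite -(has_ft_fun (has_ft_density (haar R) (bc A u)) (has_ft_char_haar u A)).
  by [].
under [X in cintegral _ _ X]eq_fun do rewrite !mulrDl.
have bm (A : R[i]) u : bfun (fun x : T => A * char u x * char (- i) x).
  by apply: bfunM; [exact: bc|exact: char_bfun].
by rewrite !(cfunctionalD cH) ?e//; exact: bfunD.
Qed.

Lemma three_frequencies_iff mu1 mu2 a b m n k : has_ft mu1 a -> has_ft mu2 b ->
  ~~ (2 %| k)%Z ->
  (exists A1 A2 A3 A4 A5 A6 : R[i],
    [/\ A1 ^+ 2 * A5 * A6 = A4 ^+ 2 * A2 * A3,
      mu1 =m with_density (fun x => A1 * char m x + A2 * char (m - k) x +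
        A3 * char (m + k) x) (haar R) &
      mu2 =m with_density (fun x => A4 * char n x + A5 * char (n - k) x +
        A6 * char (n + k) x) (haar R)]) <->
  [/\ a m ^+ 2 * b (n - k) * b (n + k) = b n ^+ 2 * a (m - k) * a (m + k),
      (forall i, i != m - k -> i != m -> i != m + k -> a i = 0) &
      (forall j, j != n - k -> j != n -> j != n + k -> b j = 0)].
Proof.
move=> mu1a mu2b k_odd.
pose t (p : int) (B1 B2 B3 : R[i]) i :=
  B1 * (i == p)%:R + B2 * (i == p - k)%:R + B3 * (i == p + k)%:R.
have d1 (p : int) : (p == p - k) = false by lia.
have d2 (p : int) : (p == p + k) = false by lia.
have d3 (p : int) : (p - k == p + k) = false by lia.
have t0 p B1 B2 B3 : t p B1 B2 B3 p = B1.
  by rewrite /t eqxx d1 d2 mulr1 !mulr0 !addr0.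
have t1 p B1 B2 B3 : t p B1 B2 B3 (p - k) = B2.
  by rewrite /t eqxx eq_sym d1 d3 mulr1 !mulr0 addr0 add0r.
have t2 p B1 B2 B3 : t p B1 B2 B3 (p + k) = B3.
  by rewrite /t eqxx eq_sym d2 [p + k == p - k]eq_sym d3 mulr1 !mulr0 !add0r.
have t3 p B1 B2 B3 i : i != p - k -> i != p -> i != p + k -> t p B1 B2 B3 i = 0.
  by rewrite /t => /negbTE -> /negbTE -> /negbTE ->; rewrite !mulr0 !addr0.
have tE (c : int -> R[i]) p :
    (forall i, i != p - k -> i != p -> i != p + k -> c i = 0) ->
    c =1 t p (c p) (c (p - k)) (c (p + k)).
  move=> c0 i; have [->|i1] := eqVneq i (p - k); first by rewrite t1.
  have [->|i2] := eqVneq i p; first by rewrite t0.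
  have [->|i3] := eqVneq i (p + k); first by rewrite t2.
  by rewrite c0// t3.
split=> [[A1 [A2 [A3 [A4 [A5 [A6 [rel mu1E mu2E]]]]]]]|[rel a0 b0]].
  have aE := (has_ft_iff mu1a (has_ft_three m k A1 A2 A3)).1 mu1E.
  have bE := (has_ft_iff mu2b (has_ft_three n k A4 A5 A6)).1 mu2E.
  split; last 2 first.
  - by move=> i *; rewrite aE -/(t m A1 A2 A3 i) t3.
  - by move=> i *; rewrite bE -/(t n A4 A5 A6 i) t3.
  by rewrite !aE !bE -!/(t _ _ _ _ _) !t0 !t1 !t2.
exists (a m), (a (m - k)), (a (m + k)), (b n), (b (n - k)), (b (n + k)).
split => //; first by apply/(has_ft_iff mu1a (has_ft_three _ _ _ _ _)); exact: tE.
by apply/(has_ft_iff mu2b (has_ft_three _ _ _ _ _)); exact: tE.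
Qed.

End cases.

(** * Theta functions and quadratic phases *)

Section gaussian_cases.
Context {R : realType}.
Local Notation T := (torus R).
Implicit Types (a b : int -> R[i]) (mu rho sigma : cmeasure T R) (m n : int).
Implicit Types (c l w z tau : R[i]) (C s : R) (k : nat) (theta : T).

Let theta_density c2 c3 c4 tau k m (x : T) : R[i] :=
  cexp ('i%C * m%:~R * angle x + c4) *
  (ccosh c2 * Defs.theta (k%:R * angle x / (2 * pi%:C) + c3) tau +
   csinh c2 * Defs.theta (k%:R * angle x / (2 * pi%:C) + c3 + 2^-1) tau).

(** The parameters correspond through w = pi i tau, l = 2 pi i c3 and
    l' = 2 pi i c5. *)
Lemma theta_case_iff mu1 mu2 a b m n k : has_ft mu1 a -> has_ft mu2 b ->
  (0 < k)%N ->
  (exists c2 c3 c4 c5 c6 tau : R[i], [/\ 0 < complex.Im tau,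
    mu1 =m with_density (fun x => cexp ('i%C * m%:~R * angle x + c4) *
      (ccosh c2 * Defs.theta (k%:R * angle x / (2 * pi%:C) + c3) tau +
       csinh c2 * Defs.theta (k%:R * angle x / (2 * pi%:C) + c3 + 2^-1) tau))
      (haar R) &
    mu2 =m with_density (fun x => cexp ('i%C * n%:~R * angle x + c6) *
      (ccosh c2 * Defs.theta (k%:R * angle x / (2 * pi%:C) + c5) tau -
       csinh c2 * Defs.theta (k%:R * angle x / (2 * pi%:C) + c5 + 2^-1) tau))
      (haar R)]) <->
  (exists c2 c4 c6 w l l' : R[i], [/\ complex.Re w < 0,
    a =1 spread k m (quadratic_exp c2 c4 w l) &
    b =1 spread k n (quadratic_exp (- c2) c6 w l')]).
Proof.
move=> mu1a mu2b k0.
have neg c2 c5 c6 tau : (fun x : T => cexp ('i%C * n%:~R * angle x + c6) *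
      (ccosh c2 * Defs.theta (k%:R * angle x / (2 * pi%:C) + c5) tau -
       csinh c2 * Defs.theta (k%:R * angle x / (2 * pi%:C) + c5 + 2^-1) tau)) =
    theta_density (- c2) c5 c6 tau k n.
  by apply/funext => x; rewrite /theta_density ccoshN csinhN mulNr.
have p0 : pi%:C != 0 :> R[i] by rewrite eq_complex /= eqxx andbT gt_eqF// pi_gt0.
have i0 : 'i%C != 0 :> R[i] by rewrite eq_complex /= oner_eq0 andbF.
have Im_pi z : complex.Re (pi%:C * 'i%C * z) = - pi * complex.Im z.
  by case: z => x y /=; ring.
split=> [[c2 [c3 [c4 [c5 [c6 [tau [tau0 mu1E mu2E]]]]]]]|
    [c2 [c4 [c6 [w [l [l' [w0 aE bE]]]]]]]].
  rewrite neg in mu2E; exists c2, c4, c6, (pi%:C * 'i%C * tau),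
    (2 * pi%:C * 'i%C * c3), (2 * pi%:C * 'i%C * c5).
  split; first by rewrite Im_pi mulNr oppr_lt0 mulr_gt0// pi_gt0.
    exact: (has_ft_iff mu1a (theta_density_ft c2 c3 c4 m tau0 k0)).1 mu1E.
  exact: (has_ft_iff mu2b (theta_density_ft (- c2) c5 c6 n tau0 k0)).1 mu2E.
pose tau := w / (pi%:C * 'i%C).
have wE : pi%:C * 'i%C * tau = w by rewrite /tau mulrC divfK// mulf_neq0.
have lE z : 2 * pi%:C * 'i%C * (z / (2 * pi%:C * 'i%C)) = z.
  by rewrite mulrC divfK// !mulf_neq0// pnatr_eq0.
have tau0 : 0 < complex.Im tau.
  by move: w0; rewrite -wE Im_pi mulNr oppr_lt0 pmulr_rgt0// pi_gt0.
move: (l / _) (l' / _) (lE l) (lE l') => c3 c5 l_c3 l_c5.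
rewrite -{}wE in aE bE; rewrite -l_c3 in aE; rewrite -l_c5 in bE.
exists c2, c3, c4, c5, c6, tau; move: tau tau0 aE bE => {w w0 lE l_c3 l_c5} tau tau0 aE bE.
split; first exact: tau0.
  exact: (has_ft_iff mu1a (theta_density_ft c2 _ c4 m tau0 k0)).2 aE.
rewrite neg; exact: (has_ft_iff mu2b (theta_density_ft (- c2) _ c6 n tau0 k0)).2 bE.
Qed.

Let chirp C (u : int) : R[i] := cexp ('i%C * C%:C * (u ^+ 2)%:~R).

Lemma has_ft_exists (M : set T -> R[i]) a : has_ft M a ->
  exists mu, has_ft mu a.
Proof.
move=> Ma; have [mu muM] := has_ft_cmeasure Ma; exists mu.
by apply: has_ft_eqm Ma => A mA; rewrite muM.
Qed.

Lemma dilate_ft_addpi k theta a n : odd k ->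
  dilate_ft k (theta + to_torus pi) a n = dilate_ft k theta a n * parity R n.
Proof.
move=> k_odd; rewrite /dilate_ft; case: ifPn => [kn|_]; last by rewrite mul0r.
have nE := divzK kn; set q := (n %/ k)%Z in nE *.
rewrite char_addr char_pi (_ : parity R n = parity R q); first by ring.
have kE : k%:Z = 2 * k./2%:Z + 1 by have := odd_double_half k; lia.
rewrite -nE kE /parity; congr (if _ then _ else _).
have -> : q * (2 * k./2%:Z + 1) = 2 * (q * k./2%:Z) + q by ring.
by move: (q * _); lia.
Qed.

Lemma spread_dilate_ft C c2 c4 k theta m :
  spread k m (fun j => cexp (c4 + parity R j * c2) * char j theta * chirp C j) =1
  spread k m (quadratic_exp c2 c4 ('i%C * C%:C) ('i%C * angle theta)).
Proof.
apply: eq_spread => j; rewrite /quadratic_exp /chirp /char -!cexpD; congr cexp.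
by rewrite [(j ^+ 2)%:~R]rmorphXn /=; ring.
Qed.

(** The factor exp ((-1)^j c2) can be divided out of the transform of mu,
    because multiplication by (-1)^j is translation by pi. *)
Lemma extract_dilation mu a m c2 c4 C k theta : odd k -> has_ft mu a ->
  a =1 spread k m (quadratic_exp c2 c4 ('i%C * C%:C) ('i%C * angle theta)) ->
  exists sigma, has_ft sigma (dilate_ft k theta (chirp C)).
Proof.
move=> k_odd mua aE.
have [s1 s1a] := has_ft_exists (has_ft_char_density (- m) (cexp (- c4)) mua).
have [M Ms] := has_ft_cexp_parity (- c2) s1a.
apply: (@has_ft_exists M); apply: eq_has_ft Ms => u.
rewrite aE -spread_dilate_ft /spread opprK addrK /dilate_ft.
case: ifPn => [ku|_]; last by rewrite mulr0 mul0r.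
have uE := divzK ku; set q := (u %/ k)%Z in uE *.
have -> : parity R u = parity R q.
  have kE : k%:Z = 2 * k./2%:Z + 1 by have := odd_double_half k; lia.
  rewrite -uE kE /parity; congr (if _ then _ else _).
  have -> : q * (2 * k./2%:Z + 1) = 2 * (q * k./2%:Z) + q by ring.
  by move: (q * _); lia.
have e : cexp (- c4) * cexp (c4 + parity R q * c2) * cexp (parity R q * - c2) = 1.
  by rewrite -!cexpD -cexp0; congr cexp; ring.
by rewrite -[RHS]mul1r -e; ring.
Qed.

(** Pushing the dilate forward under x |-> k x recovers the original measure up
    to a translation. *)
Lemma dilate_ft_undo C sigma k theta : (0 < k)%N ->
  has_ft sigma (dilate_ft k theta (chirp C)) -> exists rho, has_ft rho (chirp C).
Proof.
move=> k0 sa; have [M Ma] := has_ft_mulrn k sa.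
have [M' Ma'] := has_ft_translate theta Ma; apply: (@has_ft_exists M').
apply: eq_has_ft Ma' => u; rewrite /dilate_ft dvdz_mull ?dvdzz//.
rewrite mulzK; last lia.
rewrite mulrAC -(charD u (- u) theta) subrr char0 mul1r; reflexivity.
Qed.

Lemma chirp_case_iff mu1 mu2 a b m n k : has_ft mu1 a -> has_ft mu2 b -> odd k ->
  (exists C rho, (forall u : int, fourier_stieltjes rho u = chirp C u) /\
     exists (c2 c4 c6 : R[i]) (theta1 theta2 : T)
       (rho1 rho1' rho2 rho2' : cmeasure T R),
       [/\ [/\ is_dilation rho k theta1 rho1,
             is_dilation rho k (theta1 + to_torus pi) rho1',
             is_dilation rho k theta2 rho2 &
             is_dilation rho k (theta2 + to_torus pi) rho2'],
         mu1 =m with_density (fun x => cexp ('i%C * m%:~R * angle x + c4))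
                  (cmadd (cmscale (ccosh c2) rho1)
                         (cmscale (csinh c2) rho1')) &
         mu2 =m with_density (fun x => cexp ('i%C * n%:~R * angle x + c6))
                  (cmadd (cmscale (ccosh c2) rho2)
                         (cmscale (- csinh c2) rho2'))]) <->
  (exists (c2 c4 c6 : R[i]) C (theta1 theta2 : T),
    a =1 spread k m (quadratic_exp c2 c4 ('i%C * C%:C) ('i%C * angle theta1)) /\
    b =1 spread k n (quadratic_exp (- c2) c6 ('i%C * C%:C) ('i%C * angle theta2))).
Proof.
move=> mu1a mu2b k_odd; have k0 : (0 < k)%N by case: (k) k_odd.
split=> [[C [rho [rhoC [c2 [c4 [c6 [th1 [th2 [r1 [r1' [r2 [r2' [[d1 d1' d2 d2']
    mu1E mu2E]]]]]]]]]]]]]|[c2 [c4 [c6 [C [th1 [th2 [aE bE]]]]]]]].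
  have rhoa : has_ft rho (chirp C) := eq_has_ft rhoC (has_ft_fourier rho).
  rewrite -ccoshN -csinhN in mu2E.
  exists c2, c4, c6, C, th1, th2; split=> i; rewrite -spread_dilate_ft; move: i.
    exact: (has_ft_iff mu1a (dilation_density_ft c2 c4 m
      (is_dilation_ft k0 rhoa d1) (is_dilation_ft k0 rhoa d1'))).1 mu1E.
  exact: (has_ft_iff mu2b (dilation_density_ft (- c2) c6 n
    (is_dilation_ft k0 rhoa d2) (is_dilation_ft k0 rhoa d2'))).1 mu2E.
have [r1 r1a] := extract_dilation k_odd mu1a aE.
have [r2 r2a] := extract_dilation k_odd mu2b bE.
have [rho rhoa] := dilate_ft_undo k0 r1a.
have shift sigma theta : has_ft sigma (dilate_ft k theta (chirp C)) ->
    exists sigma', has_ft sigma' (dilate_ft k (theta + to_torus pi) (chirp C)).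
  move=> /has_ft_parity[M Ma]; apply: (@has_ft_exists M); apply: eq_has_ft Ma => u.
  by rewrite dilate_ft_addpi.
have [r1' r1a'] := shift _ _ r1a; have [r2' r2a'] := shift _ _ r2a.
exists C, rho; split; first exact: has_ft_fun (has_ft_fourier rho) rhoa.
exists c2, c4, c6, th1, th2, r1, r1', r2, r2'; split.
- by split; apply: (ft_is_dilation k0 rhoa).
- apply: (has_ft_iff mu1a (dilation_density_ft c2 c4 m r1a r1a')).2 => i.
  by rewrite aE -spread_dilate_ft.
- rewrite -ccoshN -csinhN.
  apply: (has_ft_iff mu2b (dilation_density_ft (- c2) c6 n r2a r2a')).2 => i.
  by rewrite bE -spread_dilate_ft.
Qed.

End gaussian_cases.

(** * The classification *)

Section progression.
Context {R : realType}.
Local Notation T := (torus R).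
Implicit Types (a b : int -> R[i]) (mu : cmeasure T R) (m n k : int).

Lemma spread_shift a m k : k != 0 ->
  (forall i, ~~ (k %| i - m)%Z -> a i = 0) ->
  a =1 spread k m (fun j => a (m + k * j)).
Proof.
move=> k0 a0 i; rewrite /spread; case: ifPn => [ki|/a0//]; congr a.
by rewrite [k * _]mulrC divzK// addrC subrK.
Qed.

Lemma quadratic_exp_angle (c2 c4 w : R[i]) (s : R) :
  quadratic_exp c2 c4 w ('i%C * s%:C) =1
  quadratic_exp c2 c4 w ('i%C * angle (to_torus s)).
Proof.
move=> j; rewrite /quadratic_exp !cexpD; congr (_ * _).
have := char_to_torus j s; rewrite /char mulrAC => ->; congr cexp.
by rewrite rmorphM /= rmorph_int -mulrA [s%:C * _]mulrC.
Qed.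

Lemma imaginaryE (z : R[i]) : complex.Re z = 0 -> z = 'i%C * (complex.Im z)%:C.
Proof. by case: z => x y /= ->; apply: complex_eqP => /=; ring. Qed.

(** The transforms are bounded, so the real part of the quadratic coefficient w
    is at most zero. If it is negative the coefficients decay like those of a
    theta function; if it is zero the linear coefficients must be imaginary as
    well, and they become translations. *)
Lemma progression_solution mu1 mu2 a b m n k : has_ft mu1 a -> has_ft mu2 b ->
  separable a b -> 0 < k -> (2 %| m + n)%Z ->
  (forall i, ~~ (k %| i - m)%Z -> a i = 0) ->
  (forall j, ~~ (k %| j - n)%Z -> b j = 0) ->
  (forall i, a (m + k * i) != 0) -> (forall j, b (n + k * j) != 0) ->
  (exists c2 c4 c6 w l l' : R[i], [/\ complex.Re w < 0,
    a =1 spread k m (quadratic_exp c2 c4 w l) &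
    b =1 spread k n (quadratic_exp (- c2) c6 w l')]) \/
  (exists (c2 c4 c6 : R[i]) (C : R) (theta1 theta2 : T),
    a =1 spread k m (quadratic_exp c2 c4 ('i%C * C%:C) ('i%C * angle theta1)) /\
    b =1 spread k n (quadratic_exp (- c2) c6 ('i%C * C%:C) ('i%C * angle theta2))).
Proof.
move=> mu1a mu2b ab k0 mn a0 b0 an0 bn0; have kn0 : k != 0 by rewrite gt_eqF.
have [M1 aM] := has_ft_bounded mu1a; have [M2 bM] := has_ft_bounded mu2b.
have [c2 [c4 [c6 [w [l [l' [pE qE]]]]]]] :=
  separable_exponential (separable_comp k ab mn) an0 bn0.
have aE : a =1 spread k m (quadratic_exp c2 c4 w l).
  by move=> i; rewrite (spread_shift kn0 a0); exact: eq_spread.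
have bE : b =1 spread k n (quadratic_exp (- c2) c6 w l').
  move=> i; rewrite (spread_shift kn0 b0); apply: eq_spread => j.
  by rewrite qE /quadratic_exp mulrN.
have [w0 wl] : complex.Re w <= 0 /\ (complex.Re w = 0 -> complex.Re l = 0).
  by apply: (@bounded_exponential _ c2 c4 _ _ M1) => j; rewrite -pE.
have [_ wl'] : complex.Re w <= 0 /\ (complex.Re w = 0 -> complex.Re l' = 0).
  by apply: (@bounded_exponential _ (- c2) c6 _ _ M2) => j; rewrite mulrN -qE.
have [w0'|w0'] := eqVneq (complex.Re w) 0; [right|left]; last first.
  by exists c2, c4, c6, w, l, l'; split => //; rewrite lt_neqAle w0' w0.
exists c2, c4, c6, (complex.Im w), (to_torus (complex.Im l)),
  (to_torus (complex.Im l')).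
rewrite -(imaginaryE w0'); split => i; [rewrite aE|rewrite bE];
  apply: eq_spread => j; rewrite -quadratic_exp_angle -imaginaryE //.
  exact: wl.
exact: wl'.
Qed.

End progression.

Lemma progression_separable (R : realType) (a b : int -> R[i]) (k : nat) (m n : int)
    (c2 c4 c6 w l l' : R[i]) : odd k -> (2 %| m + n)%Z ->
  a =1 spread k m (quadratic_exp c2 c4 w l) ->
  b =1 spread k n (quadratic_exp (- c2) c6 w l') -> separable a b.
Proof.
move=> k_odd mn aE bE.
have [f [g fg]] := @separable_spread _ k m n _ _
  (separable_quadratic_exp c2 c4 c6 w l l') ltac:(by case: (k) k_odd)
  ltac:(by have := odd_double_half k; rewrite k_odd; lia) mn.
by exists f, g => u v; rewrite aE bE fg.
Qed.

Theorem corollary2p4 (R : realType) (mu1 mu2 : cmeasure (torus R) R) :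
  (exists nu1 nu2 : cmeasure (torus R) R,
     cpushforward (@sum_diff R) (cproduct mu1 mu2) =m cproduct nu1 nu2)
  <->
  (* (1) *)
  mu1 =m cmzero (torus R) R \/
  (* (2) *)
  mu2 =m cmzero (torus R) R \/
  (* (3) *)
  (exists (a1 a2 : int) (nu : cmeasure (torus R) R) (A1 A2 : R[i]),
     [/\ (2 %| a1 + a2)%Z, Mminus nu,
       mu1 =m with_density (fun x => A1 * cexp ('i%C * a1%:~R * angle x))
                (haar R) &
       mu2 =m with_density (fun x => cexp ('i%C * a2%:~R * angle x))
                (cmadd (cmscale A2 (haar R)) nu)]) \/
  (* (4) *)
  (exists (a1 a2 : int) (nu : cmeasure (torus R) R) (A1 A2 : R[i]),
     [/\ (2 %| a1 + a2)%Z, Mminus nu,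
       mu1 =m with_density (fun x => cexp ('i%C * a1%:~R * angle x))
                (cmadd (cmscale A1 (haar R)) nu) &
       mu2 =m with_density (fun x => A2 * cexp ('i%C * a2%:~R * angle x))
                (haar R)]) \/
  (* (5) *)
  (Mplus mu1 /\ Mminus mu2) \/
  (* (6) *)
  (Mminus mu1 /\ Mplus mu2) \/
  (* (7) *)
  (exists (a1 a2 k : int) (A1 A2 A3 A4 A5 A6 : R[i]),
     [/\ ~~ (2 %| k)%Z, ~~ (2 %| a1 + a2)%Z,
       A1 ^+ 2 * A5 * A6 = A4 ^+ 2 * A2 * A3,
       mu1 =m with_density (fun x =>
                A1 * cexp ('i%C * a1%:~R * angle x) +
                A2 * cexp ('i%C * (a1 - k)%:~R * angle x) +
                A3 * cexp ('i%C * (a1 + k)%:~R * angle x)) (haar R) &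
       mu2 =m with_density (fun x =>
                A4 * cexp ('i%C * a2%:~R * angle x) +
                A5 * cexp ('i%C * (a2 - k)%:~R * angle x) +
                A6 * cexp ('i%C * (a2 + k)%:~R * angle x)) (haar R)]) \/
  (* (8) *)
  (exists (c2 c3 c4 c5 c6 tau : R[i]) (k : nat) (a1 a2 : int),
     [/\ 0 < complex.Im tau, odd k, (2 %| a1 + a2)%Z,
       mu1 =m with_density (fun x =>
                cexp ('i%C * a1%:~R * angle x + c4) *
                (ccosh c2 *
                   theta (k%:R * angle x / (2 * pi%:C) + c3) tau +
                 csinh c2 *
                   theta (k%:R * angle x / (2 * pi%:C) + c3 + 2^-1) tau))
                (haar R) &
       mu2 =m with_density (fun x =>
                cexp ('i%C * a2%:~R * angle x + c6) *
                (ccosh c2 *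
                   theta (k%:R * angle x / (2 * pi%:C) + c5) tau -
                 csinh c2 *
                   theta (k%:R * angle x / (2 * pi%:C) + c5 + 2^-1) tau))
                (haar R)]) \/
  (* (9) *)
  (exists (C : R) (rho : cmeasure (torus R) R),
     (forall u : int, fourier_stieltjes rho u = cexp ('i%C * C%:C * (u ^+ 2)%:~R))
     /\
     exists (c2 c4 c6 : R[i]) (theta1 theta2 : torus R) (k : nat) (a1 a2 : int)
       (rho1 rho1' rho2 rho2' : cmeasure (torus R) R),
       [/\ odd k, (2 %| a1 + a2)%Z,
         [/\ is_dilation rho k theta1 rho1,
             is_dilation rho k (theta1 + to_torus pi) rho1',
             is_dilation rho k theta2 rho2 &
             is_dilation rho k (theta2 + to_torus pi) rho2'],
         mu1 =m with_density (fun x => cexp ('i%C * a1%:~R * angle x + c4))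
                  (cmadd (cmscale (ccosh c2) rho1)
                         (cmscale (csinh c2) rho1')) &
         mu2 =m with_density (fun x => cexp ('i%C * a2%:~R * angle x + c6))
                  (cmadd (cmscale (ccosh c2) rho2)
                         (cmscale (- csinh c2) rho2'))]).
Proof.
have mu1a := has_ft_fourier mu1; have mu2b := has_ft_fourier mu2.
move: (fourier_stieltjes mu1) (fourier_stieltjes mu2) mu1a mu2b => a b mu1a mu2b.
apply: (iff_trans (pushforward_product_iff mu1a mu2b)).
rewrite -/(separable a b); split.
  move=> ab; case: (separableP ab) => [a0|b0|m n mn a0 b0|m n mn a0 b0|a0 b0|a0 b0|
      m n k k_odd mn rel a0 b0|m n k k0 k_odd mn a0 b0 an0 bn0].
  - by left; apply/(zero_iff mu1a).
  - by right; left; apply/(zero_iff mu2b).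
  - have [A1 mu1E] := (single_frequency_iff m mu1a).2 a0.
    have [A2 [nu [nuM mu2E]]] := (half_frequencies_iff n mu2b).2 b0.
    do 2 right; left; exists m, n, nu, A1, A2; split.
    + exact: mn.
    + exact: nuM.
    + exact: mu1E.
    + exact: mu2E.
  - have [A2 mu2E] := (single_frequency_iff n mu2b).2 b0.
    have [A1 [nu [nuM mu1E]]] := (half_frequencies_iff m mu1a).2 a0.
    do 3 right; left; exists m, n, nu, A1, A2; split.
    + exact: mn.
    + exact: nuM.
    + exact: mu1E.
    + exact: mu2E.
  - by do 4 right; left; split; [apply/(Mplus_iff mu1a)|apply/(Mminus_iff mu2b)].
  - by do 5 right; left; split; [apply/(Mminus_iff mu1a)|apply/(Mplus_iff mu2b)].
  - have [A1 [A2 [A3 [A4 [A5 [A6 [rel' mu1E mu2E]]]]]]] :=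
      (three_frequencies_iff m n mu1a mu2b k_odd).2 (And3 rel a0 b0).
    do 6 right; left; exists m, n, k, A1, A2, A3, A4, A5, A6; split.
    + exact: k_odd.
    + exact: mn.
    + exact: rel'.
    + exact: mu1E.
    + exact: mu2E.
  - have [k' kk'] : exists k' : nat, k = k' by exists `|k|%N; lia.
    rewrite kk' in k0 k_odd a0 b0 an0 bn0 *.
    have k'0 : (0 < k')%N by lia.
    have k'_odd : odd k' by have := odd_double_half k'; case: (odd k') => //; lia.
    case: (progression_solution mu1a mu2b ab k0 mn a0 b0 an0 bn0) => H.
      do 7 right; left.
      have [c2 [c3 [c4 [c5 [c6 [tau [tau0 mu1E mu2E]]]]]]] :=
        (theta_case_iff m n mu1a mu2b k'0).2 H.
      exists c2, c3, c4, c5, c6, tau, k', m, n; split.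
      + exact: tau0.
      + exact: k'_odd.
      + exact: mn.
      + exact: mu1E.
      + exact: mu2E.
    do 8 right.
    have [C [rho [rhoC [c2 [c4 [c6 [th1 [th2 [r1 [r1' [r2 [r2' [dil mu1E mu2E]]]]]]]]]]]]] :=
      (chirp_case_iff m n mu1a mu2b k'_odd).2 H.
    exists C, rho; split; first exact: rhoC.
    exists c2, c4, c6, th1, th2, k', m, n, r1, r1', r2, r2'; split.
    + exact: k'_odd.
    + exact: mn.
    + exact: dil.
    + exact: mu1E.
    + exact: mu2E.
case=> [mu10|[mu20|[H|[H|[[H1 H2]|[[H1 H2]|[H|[H|H]]]]]]]].
- by apply: separable_zero => u v; rewrite ((zero_iff mu1a).1 mu10) mul0r.
- by apply: separable_zero => u v; rewrite ((zero_iff mu2b).1 mu20) mulr0.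
- have [m [n [nu [A1 [A2 [mn nuM mu1E mu2E]]]]]] := H.
  apply: (separable_point mn).
    apply/(single_frequency_iff m mu1a); exists A1; exact: mu1E.
  apply/(half_frequencies_iff n mu2b); exists A2, nu; split; first exact: nuM.
  exact: mu2E.
- have [m [n [nu [A1 [A2 [mn nuM mu1E mu2E]]]]]] := H.
  apply: separableC; apply: (@separable_point _ b a n m); first by rewrite addrC.
    apply/(single_frequency_iff n mu2b); exists A2; exact: mu2E.
  apply/(half_frequencies_iff m mu1a); exists A1, nu; split; first exact: nuM.
  exact: mu1E.
- by apply: separable_parity; [apply/(Mplus_iff mu1a)|apply/(Mminus_iff mu2b)].
- apply: separableC.
  by apply: separable_parity; [apply/(Mplus_iff mu2b)|apply/(Mminus_iff mu1a)].
- have [m [n [k [A1 [A2 [A3 [A4 [A5 [A6 [k_odd mn rel mu1E mu2E]]]]]]]]]] := H.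
  have [rel' a0 b0] : [/\ a m ^+ 2 * b (n - k) * b (n + k) =
        b n ^+ 2 * a (m - k) * a (m + k),
      (forall i, i != m - k -> i != m -> i != m + k -> a i = 0) &
      (forall j, j != n - k -> j != n -> j != n + k -> b j = 0)].
    apply/(three_frequencies_iff m n mu1a mu2b k_odd).
    by exists A1, A2, A3, A4, A5, A6; split; [exact: rel|exact: mu1E|exact: mu2E].
  exact: three_separable k_odd mn rel' a0 b0.
- have [c2 [c3 [c4 [c5 [c6 [tau [k [m [n [tau0 k_odd mn mu1E mu2E]]]]]]]]]] := H.
  have k0 : (0 < k)%N by case: (k) k_odd.
  have [c2' [c4' [c6' [w [l [l' [_ aE bE]]]]]]] : exists c2 c4 c6 w l l' : R[i],
      [/\ complex.Re w < 0, a =1 spread k m (quadratic_exp c2 c4 w l) &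
       b =1 spread k n (quadratic_exp (- c2) c6 w l')].
    apply/(theta_case_iff m n mu1a mu2b k0); exists c2, c3, c4, c5, c6, tau.
    by split; [exact: tau0|exact: mu1E|exact: mu2E].
  exact: (progression_separable k_odd mn aE bE).
- have [C [rho [rhoC [c2 [c4 [c6 [th1 [th2 [k [m [n [r1 [r1' [r2 [r2'
    [k_odd mn dil mu1E mu2E]]]]]]]]]]]]]]]] := H.
  have [c2' [c4' [c6' [C' [th1' [th2' [aE bE]]]]]]] :
      exists (c2 c4 c6 : R[i]) (C : R) (th1 th2 : torus R),
    a =1 spread k m (quadratic_exp c2 c4 ('i%C * C%:C) ('i%C * angle th1)) /\
    b =1 spread k n (quadratic_exp (- c2) c6 ('i%C * C%:C) ('i%C * angle th2)).
    apply/(chirp_case_iff m n mu1a mu2b k_odd).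
    exists C, rho; split; first exact: rhoC.
    exists c2, c4, c6, th1, th2, r1, r1', r2, r2'.
    by split; [exact: dil|exact: mu1E|exact: mu2E].
  exact: (progression_separable k_odd mn aE bE).
Qed.
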